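(* Let $\sigma\in M^{0}_{\rho,\Lambda}(\mathbb{Z}^n\times\mathbb{T}^n)$. Then $T_\sigma:\ell^2(\mathbb{Z}^n)\to\ell^2(\mathbb{Z}^n)$ is Fredholm if and only if it is $M$-elliptic, i.e. if and only if the symbol $\sigma$ is $M$-elliptic (of order $0$).
   Context: Write $\mathbb{T}^n=\mathbb{R}^n/\mathbb{Z}^n$ and $\mathbb{N}_0=\{0,1,2,\dots\}$. For $f$ on $\mathbb{Z}^n$ set $\Delta_{k_j}f(k)=f(k+e_j)-f(k)$ ($e_j$ the $j$-th unit vector) and $\Delta_k^\alpha=\Delta_{k_1}^{\alpha_1}\cdots\Delta_{k_n}^{\alpha_n}$ for $\alpha\in\mathbb{N}_0^n$. On smooth functions on $\mathbb{T}^n$ set $D_x^{(\beta)}=D_{x_1}^{(\beta_1)}\cdots D_{x_n}^{(\beta_n)}$, where $D_{x_j}^{(0)}=I$ and $D_{x_j}^{(\ell)}=\prod_{m=0}^{\ell-1}\big(\frac{1}{2\pi i}\frac{\partial}{\partial x_j}-m\big)$ for $\ell\ge1$. Write $k^\gamma=k_1^{\gamma_1}\cdots k_n^{\gamma_n}$. Weight function: $\Lambda:\mathbb{Z}^n\to(0,\infty)$ is a weight function if there are positive constants $\mu_0\le\mu_1\le\mu$ and $C_0,C_1$ with $C_0(1+|k|)^{\mu_0}\le\Lambda(k)\le C_1(1+|k|)^{\mu_1}$ for all $k\in\mathbb{Z}^n$, and for all $\alpha\in\mathbb{N}_0^n$, $\gamma\in\{0,1\}^n$ there is $C_{\alpha,\gamma}>0$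 with $|k^\gamma\Delta_k^{\alpha+\gamma}\Lambda(k)|\le C_{\alpha,\gamma}\Lambda(k)^{1-|\alpha|/\mu}$ for all $k\in\mathbb{Z}^n$. Fix such a $\Lambda$ (with its constants) and $\rho\in(0,1/\mu]$. Symbol classes: for $m\in\mathbb{R}$, $S^m_{\rho,\Lambda}(\mathbb{Z}^n\times\mathbb{T}^n)$ is the set of $\sigma:\mathbb{Z}^n\times\mathbb{T}^n\to\mathbb{C}$, smooth in $x$ for every $k$, such that for all $\alpha,\beta\in\mathbb{N}_0^n$ there is a constant $C>0$ with $|D_x^{(\beta)}\Delta_k^\alpha\sigma(k,x)|\le C\Lambda(k)^{m-\rho|\alpha|}$ for all $(k,x)$. $M^m_{\rho,\Lambda}(\mathbb{Z}^n\times\mathbb{T}^n)$ is the set of $\sigma:\mathbb{Z}^n\times\mathbb{T}^n\to\mathbb{C}$, smooth in $x$ for every $k$, such that $k^\gamma\Delta_k^\gamma\sigma(k,x)\in S^m_{\rho,\Lambda}(\mathbb{Z}^n\times\mathbb{T}^n)$ for all $\gamma\in\{0,1\}^n$. Operators: $\mathcal{S}(\mathbb{Z}^n)$ is the space of rapidly decreasing functions on $\mathbb{Z}^n$. For $f\in\mathcal{S}(\mathbb{Z}^n)$ put $\widehat f(x)=\sum_{k\in\mathbb{Z}^n}e^{-2\pi i k\cdot x}f(k)$ and $T_\sigma f(k)=\int_{\mathbb{T}^n}e^{2\pi i k\cdot x}\sigma(k,x)\widehat f(x)\,dx$. For $\sigma\in M^0_{\rho,\Lambda}$ the operator $T_\sigma$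 extends to a bounded operator on $\ell^2(\mathbb{Z}^n)$, still denoted $T_\sigma$. $M$-ellipticity: $\sigma\in M^m_{\rho,\Lambda}(\mathbb{Z}^n\times\mathbb{T}^n)$ is $M$-elliptic if there are positive constants $C,R_1$ with $|\sigma(k,x)|\ge C\Lambda(k)^m$ for all $x\in\mathbb{T}^n$ and all $k\in\mathbb{Z}^n$ with $|k|\ge R_1$. Fredholm: a closed, densely defined linear operator $T:X\to Y$ between complex Banach spaces is Fredholm if its range is a closed subspace of $Y$ and the null spaces of $T$ and of its adjoint $T^t$ are finite dimensional. *)

(* Defs.v *)
From HB Require Import structures.
From mathcomp Require Import all_boot all_order all_algebra.
From mathcomp Require Import finmap complex ring lra.
From mathcomp Require Import all_classical all_reals all_analysis.

Set Implicit Arguments.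
Unset Strict Implicit.
Unset Printing Implicit Defensive.

Import Order.TTheory GRing.Theory Num.Theory.
Import numFieldNormedType.Exports.
Import ComplexField.Normc.

Local Open Scope classical_set_scope.
Local Open Scope ring_scope.
Local Open Scope complex_scope.

(* Functions on T^n = R^n / Z^n are encoded as Z^n-periodic functions on R^n. *)

Section Lattice.
Context {R : realType} {n : nat}.
Implicit Types (k : 'rV[int]_n) (alpha : 'I_n -> nat) (gamma : 'I_n -> bool).

Definition euclid_norm k : R := Num.sqrt (\sum_j (k 0 j)%:~R ^+ 2).

Definition mi_abs alpha : nat := (\sum_j alpha j)%N.

Definition kpow (K : pzRingType) k gamma : K := \prod_j (k 0 j)%:~R ^+ gamma j.

Definition Delta1 (V : zmodType) (j : 'I_n) (f : 'rV[int]_n -> V) :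
    'rV[int]_n -> V :=
  fun k => f (k + delta_mx 0 j) - f k.

Definition Delta (V : zmodType) alpha (f : 'rV[int]_n -> V) : 'rV[int]_n -> V :=
  foldr (fun j h => iter (alpha j) (Delta1 j) h) f (enum 'I_n).

Definition dotZR k (x : 'rV[R]_n) : R := \sum_j (k 0 j)%:~R * x 0 j.

Definition is_weight (mu0 mu1 mu : R) (Lambda : 'rV[int]_n -> R) : Prop :=
  [/\ 0 < mu0, mu0 <= mu1, mu1 <= mu, forall k, 0 < Lambda k &
   (exists C0 C1 : R, [/\ 0 < C0, 0 < C1 & forall k,
      C0 * (1 + euclid_norm k) `^ mu0 <= Lambda k
        <= C1 * (1 + euclid_norm k) `^ mu1])
   /\
   (forall alpha gamma, exists2 C : R, 0 < C & forall k,
      `|kpow R k gamma * Delta (fun j => (alpha j + gamma j)%N) Lambda k|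
        <= C * Lambda k `^ (1 - (mi_abs alpha)%:R / mu))].

End Lattice.

Section Torus.
Context {R : realType} {n : nat}.
Implicit Types (g : 'rV[R]_n -> R[i]) (j : 'I_n) (beta : 'I_n -> nat).

Definition lattice_periodic g : Prop :=
  forall x (z : 'rV[int]_n), g (x + map_mx intr z) = g x.

Definition pd j g : 'rV[R]_n -> R[i] := fun x =>
  'D_(delta_mx 0 j) (fun y => complex.Re (g y)) x
    +i* 'D_(delta_mx 0 j) (fun y => complex.Im (g y)) x.

(* Smoothness of the real and imaginary parts: every iterated partial
   derivative exists and is continuous. *)
Definition smooth g : Prop := forall s : seq 'I_n,
  let h := foldr pd g s in
  [/\ continuous (fun y => complex.Re (h y)),
      continuous (fun y => complex.Im (h y)) &
      forall j x, derivable (fun y => complex.Re (h y)) x (delta_mx 0 j) /\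
                  derivable (fun y => complex.Im (h y)) x (delta_mx 0 j)].

Definition torus_smooth g : Prop := lattice_periodic g /\ smooth g.

(* D^(l) = prod_(m < l) ((2 pi i)^-1 d/dx_j - m). *)
Fixpoint D1 j (l : nat) g : 'rV[R]_n -> R[i] :=
  if l is m.+1 then
    fun x => (2 * pi *i)^-1 * pd j (D1 j m g) x - m%:R * D1 j m g x
  else g.

Definition Dx beta g : 'rV[R]_n -> R[i] :=
  foldr (fun j h => D1 j (beta j) h) g (enum 'I_n).

(* Integration over T^n is the iterated integral over the cube [0, 1]^n. *)
Definition set_coord (x : 'rV[R]_n) j (t : R) : 'rV[R]_n :=
  \row_i (if i == j then t else x 0 i).

Definition int_coord j (f : 'rV[R]_n -> R) : 'rV[R]_n -> R := fun x =>
  (\int[lebesgue_measure]_(t in `[0, 1]) f (set_coord x j t))%R.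

Definition torus_int_real (f : 'rV[R]_n -> R) : R :=
  foldr int_coord f (enum 'I_n) 0.

Definition torus_int g : R[i] :=
  torus_int_real (fun x => complex.Re (g x))
    +i* torus_int_real (fun x => complex.Im (g x)).

End Torus.

Section Symbols.
Context {R : realType} {n : nat}.
Variables (Lambda : 'rV[int]_n -> R) (rho : R).
Implicit Types (sigma : 'rV[int]_n -> 'rV[R]_n -> R[i]) (m : R).

Definition S_class m sigma : Prop :=
  (forall k, torus_smooth (sigma k)) /\
  forall alpha beta : 'I_n -> nat, exists2 C : R, 0 < C & forall k x,
    normc (Dx beta (fun y => Delta alpha (fun l => sigma l y) k) x)
      <= C * Lambda k `^ (m - rho * (mi_abs alpha)%:R).

Definition M_class m sigma : Prop :=
  (forall k, torus_smooth (sigma k)) /\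
  forall gamma : 'I_n -> bool,
    S_class m (fun k x => kpow R[i] k gamma * Delta gamma (fun l => sigma l x) k).

Definition M_elliptic m sigma : Prop :=
  exists C R1 : R, [/\ 0 < C, 0 < R1 & forall x k,
    R1 <= euclid_norm k -> C * Lambda k `^ m <= normc (sigma k x)].

End Symbols.

Section Quantization.
Context {R : realType} {n : nat}.
Implicit Types (f : 'rV[int]_n -> R[i]) (k : 'rV[int]_n) (x : 'rV[R]_n).

Definition rapidly_decreasing f : Prop :=
  forall N : nat, exists C : R, forall k,
    (1 + euclid_norm k) ^+ N * normc (f k) <= C.

(* The sum of an absolutely summable family. *)
Definition real_sum (I : choiceType) (u : I -> R) : R :=
  fine (\esum_(i in [set: I]) (EFin \o u)^\+ i
        - \esum_(i in [set: I]) (EFin \o u)^\- i)%E.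

Definition complex_sum (I : choiceType) (u : I -> R[i]) : R[i] :=
  real_sum (fun i => complex.Re (u i)) +i* real_sum (fun i => complex.Im (u i)).

Definition expi (t : R) : R[i] := cos t +i* sin t.

Definition fourier f x : R[i] :=
  complex_sum (fun k => expi (- (2 * pi * dotZR k x)) * f k).

Definition pdo (sigma : 'rV[int]_n -> 'rV[R]_n -> R[i]) f k : R[i] :=
  torus_int (fun x => expi (2 * pi * dotZR k x) * sigma k x * fourier f x).

End Quantization.

Section SquareSummable.
Context {R : realType} {I : choiceType}.
Implicit Types f g : I -> R[i].

Definition sqsum f : \bar R := (\esum_(i in [set: I]) (normc (f i) ^+ 2)%:E)%E.

Definition square_summable : {pred I -> R[i]} := [pred f | (sqsum f < +oo)%E].

Definition ell2_norm f : R := Num.sqrt (fine (sqsum f)).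

Lemma sqsum_ge0 f : (0 <= sqsum f)%E.
Proof. by apply: esum_ge0 => i _; rewrite lee_fin sqr_ge0. Qed.

Lemma normc_ge0 (z : R[i]) : 0 <= normc z.
Proof. by case: z => a b; exact: sqrtr_ge0. Qed.

Lemma normc_normE (z : R[i]) : `|z| = (normc z)%:C.
Proof. by case: z. Qed.

Lemma le_normcD (y z : R[i]) : normc (y + z) <= normc y + normc z.
Proof. by rewrite -lecR rmorphD/= -!normc_normE ler_normD. Qed.

Lemma le_sqr_normcD (t : R) (y z : R[i]) : 0 < t ->
  normc (y + z) ^+ 2 <= (1 + t) * normc y ^+ 2 + (1 + t^-1) * normc z ^+ 2.
Proof.
move=> t0; have tn0 : t != 0 by rewrite gt_eqF.
set a := normc y; set b := normc z.
apply: (@le_trans _ _ ((a + b) ^+ 2)).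
  by rewrite ler_pXn2r ?nnegrE ?addr_ge0 ?normc_ge0 ?le_normcD.
rewrite -subr_ge0.
have -> : (1 + t) * a ^+ 2 + (1 + t^-1) * b ^+ 2 - (a + b) ^+ 2
  = t^-1 * (t * a - b) ^+ 2 by field.
by rewrite mulr_ge0 ?invr_ge0 ?sqr_ge0 ?ltW.
Qed.

Lemma sqsum_le f (M : R) : (sqsum f <= M%:E)%E <->
  forall A : {fset I}, \sum_(i <- A) normc (f i) ^+ 2 <= M.
Proof.
split=> [fM A|fM].
  rewrite -lee_fin; apply: le_trans fM; apply: ereal_sup_ubound.
  exists [set` A]; first by split.
  by rewrite fsbig_finite//= set_fsetK sumEFin.
apply: ge_ereal_sup => _ [A [finA _] <-].
by rewrite fsbig_finite//= sumEFin lee_fin.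
Qed.

Lemma sqr_ell2_norm f : f \in square_summable ->
  sqsum f = (ell2_norm f ^+ 2)%:E.
Proof.
rewrite inE => fy; rewrite /ell2_norm sqr_sqrtr ?fine_ge0 ?sqsum_ge0//.
by rewrite fineK// ge0_fin_numE ?sqsum_ge0.
Qed.

Lemma ell2_norm_le f (M : R) : 0 <= M ->
  (forall A : {fset I}, \sum_(i <- A) normc (f i) ^+ 2 <= M ^+ 2) <->
  f \in square_summable /\ ell2_norm f <= M.
Proof.
move=> M0; split=> [/sqsum_le fM|[fs fM] A].
  have fs : f \in square_summable by rewrite inE (le_lt_trans fM)// ltry.
  split=> //; move: fM; rewrite sqr_ell2_norm// lee_fin.
  by rewrite ler_pXn2r// nnegrE sqrtr_ge0.
have /sqsum_le -> // : (sqsum f <= (M ^+ 2)%:E)%E.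
by rewrite sqr_ell2_norm// lee_fin ler_pXn2r// nnegrE sqrtr_ge0.
Qed.

Lemma ell2_norm_sum f (A : {fset I}) : f \in square_summable ->
  \sum_(i <- A) normc (f i) ^+ 2 <= ell2_norm f ^+ 2.
Proof.
move=> fs; have /(ell2_norm_le f) H := sqrtr_ge0 (fine (sqsum f)).
by apply: (H.2 _ A); split.
Qed.

Lemma ell2_normD f g : f \in square_summable -> g \in square_summable ->
  f + g \in square_summable /\ ell2_norm (f + g) <= ell2_norm f + ell2_norm g.
Proof.
move=> fs gs; set a := ell2_norm f; set b := ell2_norm g.
have a0 : 0 <= a := sqrtr_ge0 _; have b0 : 0 <= b := sqrtr_ge0 _.
apply/ell2_norm_le; first exact: addr_ge0.
move=> A; apply/ler_addgt0Pr => e e0.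
have [d d0 dab] : exists2 d, 0 < d & (a + b + d) ^+ 2 <= (a + b) ^+ 2 + e.
  pose d := Num.min 1 (e / (2 * (a + b) + 1)).
  have s0 : 0 < 2 * (a + b) + 1 by rewrite ltr_wpDl// mulr_ge0// addr_ge0.
  have d0 : 0 < d by rewrite lt_min ltr01 divr_gt0.
  exists d => //.
  have : d <= 1 by rewrite ge_min lexx.
  have : d * (2 * (a + b) + 1) <= e by rewrite -ler_pdivlMr// ge_min lexx orbT.
  by nra.
apply: le_trans dab.
pose a' := a + d / 2; pose b' := b + d / 2.
have d20 : 0 < d / 2 by rewrite divr_gt0.
have a'0 : 0 < a' by rewrite ltr_wpDl.
have b'0 : 0 < b' by rewrite ltr_wpDl.
pose t := b' / a'; have t0 : 0 < t by rewrite divr_gt0.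
apply: (@le_trans _ _ (\sum_(i <- A)
   ((1 + t) * normc (f i) ^+ 2 + (1 + t^-1) * normc (g i) ^+ 2))).
  by apply: ler_sum => i _; exact: le_sqr_normcD.
rewrite big_split/= -!mulr_sumr.
have -> : a + b + d = a' + b' by rewrite /a' /b'; field.
have -> : (a' + b') ^+ 2 = (1 + t) * a' ^+ 2 + (1 + t^-1) * b' ^+ 2.
  by rewrite /t; field; rewrite !gt_eqF.
have t1 : 0 <= 1 + t by rewrite addr_ge0 ?ltW.
have t2 : 0 <= 1 + t^-1 by rewrite addr_ge0 ?invr_ge0 ?ltW.
apply: lerD; apply: ler_wpM2l => //.
- apply: le_trans (ell2_norm_sum A fs) _.
  by rewrite ler_pXn2r ?nnegrE// ?(ltW a'0)// lerDl ltW.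
- apply: le_trans (ell2_norm_sum A gs) _.
  by rewrite ler_pXn2r ?nnegrE// ?(ltW b'0)// lerDl ltW.
Qed.

Lemma ell2_normZ (c : R[i]) f : f \in square_summable ->
  c *: f \in square_summable /\ ell2_norm (c *: f) <= normc c * ell2_norm f.
Proof.
move=> fs; apply/ell2_norm_le; first by rewrite mulr_ge0 ?normc_ge0 ?sqrtr_ge0.
move=> A; under eq_bigr do rewrite normcM exprMn.
by rewrite -mulr_sumr exprMn ler_wpM2l ?sqr_ge0// ell2_norm_sum.
Qed.

Lemma square_summable0 : 0 \in square_summable.
Proof.
apply: (proj1 ((ell2_norm_le 0 (lexx 0)).1 _)) => A.
by rewrite big1 ?sqr_ge0// => i _; rewrite normc0 expr0n.
Qed.

Lemma square_summable_submod : submod_closed square_summable.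
Proof.
split=> [|c f g fs gs]; first exact: square_summable0.
by apply: (ell2_normD _ gs).1; exact: (ell2_normZ c fs).1.
Qed.

HB.instance Definition _ := GRing.isSubmodClosed.Build R[i] (I -> R[i])
  square_summable square_summable_submod.

Record ell2 := Ell2 { ell2_fun :> I -> R[i] ; ell2P : ell2_fun \in square_summable }.

HB.instance Definition _ := [isSub for ell2_fun].
HB.instance Definition _ := [Choice of ell2 by <:].
HB.instance Definition _ := [SubChoice_isSubLmodule of ell2 by <:].

Lemma ell2_normC_D (f g : ell2) :
  (ell2_norm (f + g : ell2))%:C <= (ell2_norm f)%:C + (ell2_norm g)%:C :> R[i].
Proof. by rewrite -rmorphD lecR; exact: (ell2_normD (ell2P f) (ell2P g)).2. Qed.

Lemma ell2_normC_Z (c : R[i]) (f : ell2) :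
  (ell2_norm (c *: f : ell2))%:C = `|c| * (ell2_norm f)%:C :> R[i].
Proof.
rewrite normc_normE -rmorphM; congr (_%:C); apply/le_anti/andP; split.
  exact: (ell2_normZ c (ell2P f)).2.
have [->|c0] := eqVneq c 0; first by rewrite normc0 mul0r sqrtr_ge0.
have cf : c *: (f : I -> R[i]) \in square_summable := (ell2_normZ c (ell2P f)).1.
have := (ell2_normZ c^-1 cf).2; rewrite scalerA mulVf// scale1r.
rewrite normcV mulrC ler_pdivlMr ?[ell2_norm f * _]mulrC//.
by rewrite lt_def normc_ge0 andbT; apply: contra c0 => /eqP/eq0_normc ->.
Qed.

Lemma ell2_norm_coord f i : f \in square_summable -> normc (f i) <= ell2_norm f.
Proof.
move=> fs; rewrite -(@ler_pXn2r _ 2)// ?nnegrE ?normc_ge0 ?sqrtr_ge0//.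
by have := ell2_norm_sum [fset i]%fset fs; rewrite big_seq_fset1.
Qed.

Lemma ell2_normC_eq0 (f : ell2) : (ell2_norm f)%:C = 0 :> R[i] -> f = 0.
Proof.
move=> /(@complexI R) f0; apply/val_inj/funext => i /=.
apply/eq0_normc/le_anti; rewrite normc_ge0 andbT -f0.
exact: ell2_norm_coord (ell2P f).
Qed.

HB.instance Definition _ := Lmodule_isNormed.Build R[i] ell2
  ell2_normC_D ell2_normC_Z ell2_normC_eq0.

Lemma ell2_normE (f : ell2) : `|f| = (ell2_norm f)%:C.
Proof. by []. Qed.

Lemma ell2_ballE (f : ell2) (e : R) (g : ell2) :
  ball f e%:C g <-> ell2_norm (f - g : ell2) < e.
Proof. by rewrite -ball_normE/= /ball_/= ell2_normE ltcR. Qed.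

Lemma ell2_complete (F : set_system ell2) : ProperFilter F -> cauchy F -> cvg F.
Proof.
move=> FF Fc.
have Fb (e : R) : 0 < e -> exists f : ell2, F [set g | ell2_norm (f - g : ell2) < e].
  move=> e0; have /cauchyP /(_ (e%:C)) := Fc.
  rewrite ltcR => /(_ e0) [f fe]; exists f.
  by apply: filterS fe => g; rewrite ell2_ballE.
have Fp (p : ell2 -> R) :
    (forall f g : ell2, `|p f - p g| <= ell2_norm (f - g : ell2)) ->
    cvg (p @ F).
  move=> pN; apply: R_complete; apply/cauchyP => e e0.
  have [f fe] := Fb e e0; exists (p f).
  suff : F [set g | ball (p f) e (p g)] by [].
  apply: filterS fe => g /= fg.
  exact: (le_lt_trans (pN _ _) fg : `|p f - p g| < e).
have leRe (z : R[i]) : `|complex.Re z| <= normc z.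
  by case: z => a b /=; rewrite -sqrtr_sqr ler_wsqrtr// lerDl sqr_ge0.
have leIm (z : R[i]) : `|complex.Im z| <= normc z.
  by case: z => a b /=; rewrite -sqrtr_sqr ler_wsqrtr// lerDr sqr_ge0.
have cRe i : cvg ((fun f : ell2 => complex.Re (f i)) @ F).
  apply: Fp => f g; rewrite -raddfB; apply: le_trans (leRe _) _.
  exact: (ell2_norm_coord i (ell2P (f - g))).
have cIm i : cvg ((fun f : ell2 => complex.Im (f i)) @ F).
  apply: Fp => f g; rewrite -raddfB; apply: le_trans (leIm _) _.
  exact: (ell2_norm_coord i (ell2P (f - g))).
pose h : I -> R[i] := fun i =>
  lim ((fun f : ell2 => complex.Re (f i)) @ F)
  +i* lim ((fun f : ell2 => complex.Im (f i)) @ F).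
have cv2 (u : ell2 -> R) (a l : R) : u @ F --> l ->
    (fun g : ell2 => (a - u g) ^+ 2) @ F --> (a - l) ^+ 2.
  move=> ul; have aul : (fun g : ell2 => a - u g) @ F --> a - l.
    by apply: cvgB; [exact: cvg_cst|].
  exact: (cvgM aul aul).
have hP (e : R) (f : ell2) : 0 < e -> F [set g | ell2_norm (f - g : ell2) < e] ->
    (f : I -> R[i]) - h \in square_summable /\
    ell2_norm ((f : I -> R[i]) - h) <= e.
  move=> e0 fe; apply/ell2_norm_le; first exact: ltW.
  move=> A.
  have cvA : (fun g : ell2 => \sum_(i <- A) ((complex.Re (f i) - complex.Re (g i)) ^+ 2 +
       (complex.Im (f i) - complex.Im (g i)) ^+ 2)) @ F -->
     \sum_(i <- A) ((complex.Re (f i) - complex.Re (h i)) ^+ 2 +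
       (complex.Im (f i) - complex.Im (h i)) ^+ 2).
    apply: cvg_big => [|i _]; first exact: add_continuous.
    by apply: cvgD; apply: cv2; [exact: cRe|exact: cIm].
  have nE (u v : R[i]) : normc (u - v) ^+ 2 =
     (complex.Re u - complex.Re v) ^+ 2 + (complex.Im u - complex.Im v) ^+ 2.
    by case: u v => a b [c d]/=; rewrite sqr_sqrtr// addr_ge0 ?sqr_ge0.
  under eq_bigr do rewrite nE.
  apply: (cvgr_to_le cvA); apply: filterS fe => g /= fg.
  apply: (@le_trans _ _ (ell2_norm (f - g : ell2) ^+ 2)).
    apply: le_trans (ell2_norm_sum A (ell2P (f - g))); apply: ler_sum => i _.
    exact: (eq_ind _ (fun t => t <= _) (lexx _) _ (nE (f i) (g i))).
  by rewrite ler_pXn2r ?nnegrE ?sqrtr_ge0 ?ltW.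
have [f0 f0P] := Fb 1 ltr01.
have hs : h \in square_summable.
  have -> : h = (f0 : I -> R[i]) - ((f0 : I -> R[i]) - h).
    by rewrite subKr.
  by rewrite rpredB ?(ell2P f0)//; exact: (hP 1 f0 ltr01 f0P).1.
apply/cvg_ex; exists (Ell2 hs); apply/cvgrPdist_lt => -[e e'].
rewrite ltcE/=. move=> /andP[/eqP -> e0].
have e20 : 0 < e / 2 by rewrite divr_gt0.
have [f fP] := Fb _ e20; have := (hP _ f e20 fP).2 => fh.
apply: filterS fP => g /= fg; rewrite ell2_normE ltcR.
have -> : Ell2 hs - g = (f - g) - (f - Ell2 hs) by rewrite opprB [RHS]addrC addrA subrK.
apply: le_lt_trans (_ : ell2_norm (f - g : ell2) + ell2_norm (f - Ell2 hs : ell2) < e).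
  have := ler_normB (f - g) (f - Ell2 hs : ell2).
  by rewrite !ell2_normE -rmorphD lecR.
by rewrite [ltRHS]splitr; exact: ltr_leD.
Qed.

HB.instance Definition _ := Uniform_isComplete.Build ell2 ell2_complete.

End SquareSummable.
Arguments ell2 R I : clear implicits.

Section Fredholm.
Context {R : realType}.

Definition finite_dim (V : lmodType R[i]) (A : set V) : Prop :=
  exists s : seq V, forall v, A v ->
    exists c : 'I_(size s) -> R[i], v = \sum_i c i *: s`_i.

Definition dual_space (X : normedModType R[i]) : set (X -> R[i]) :=
  [set phi | scalar phi /\ continuous (phi : X -> R[i]^o)].

Context {X Y : completeNormedModType R[i]}.
Variables (D : set X) (T : X -> Y).

Definition linear_on : Prop :=
  D 0 /\ forall (a : R[i]) x y, D x -> D y ->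
    D (a *: x + y) /\ T (a *: x + y) = a *: T x + T y.

(* [adjoint phi psi] is "phi is in the domain of T^t and T^t phi = psi". *)
Definition adjoint (phi : Y -> R[i]) (psi : X -> R[i]) : Prop :=
  [/\ dual_space phi, dual_space psi & forall x, D x -> phi (T x) = psi x].

(* An operator with domain D is a total function considered on D only. *)
Definition fredholm : Prop :=
  [/\ linear_on, dense D & closed [set p : X * Y | D p.1 /\ p.2 = T p.1]] /\
  [/\ closed (T @` D),
      finite_dim [set x | D x /\ T x = 0] &
      finite_dim [set phi | adjoint phi 0]].

End Fredholm.

Section PdoEll2.
Context {R : realType} {n : nat}.

Definition bounded_extension (sigma : 'rV[int]_n -> 'rV[R]_n -> R[i])
    (T : ell2 R 'rV[int]_n -> ell2 R 'rV[int]_n) : Prop :=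
  [/\ linear T, exists M : R, forall u, `|T u| <= M%:C * `|u| &
      forall u : ell2 R 'rV[int]_n, rapidly_decreasing u -> T u = pdo sigma u :> ('rV[int]_n -> R[i])].

(* The extension is unique, the rapidly decreasing functions being dense in
   l^2; without one, [pdo_ell2 sigma] is the zero map. *)
Definition pdo_ell2 (sigma : 'rV[int]_n -> 'rV[R]_n -> R[i]) :
    ell2 R 'rV[int]_n -> ell2 R 'rV[int]_n :=
  xget (fun=> 0) [set T | bounded_extension sigma T].

End PdoEll2.

(* Main.v *)
Require Import Defs.
From mathcomp Require Import all_boot all_order all_algebra.
From mathcomp Require Import finmap complex ring lra zify.
From mathcomp Require Import all_classical all_reals all_analysis.

Set Implicit Arguments.
Unset Strict Implicit.
Unset Printing Implicit Defensive.

Import Order.TTheory GRing.Theory Num.Theory.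
Import numFieldNormedType.Exports.
Import ComplexField.Normc.

Local Open Scope classical_set_scope.
Local Open Scope ring_scope.
Local Open Scope complex_scope.

(** Write T for the operator, [sigma] for its symbol and a(k, m) for the m-th Fourier
   coefficient of [sigma k], so that (T u)(k) is the sum over m of a(k, m) u(k + m).
   Two consequences of the symbol estimates carry the proof.
   - The derivatives of order at most 2 in each variable are bounded uniformly in k.
     Hence |a(k, m)| is at most a constant times the summable weight [decay m], and T
     is the norm limit of its truncations to finitely many diagonals
     ([S_class_tame], [fcoef_decay], [pdo_ell2_band]).
   - The differences in k tend to zero at infinity. Hence far away T looks, at every
     bounded scale, like a convolution operator, that is, like the multiplication of
     the Fourier transform by the function [sigma k] with k frozen ([S_class_slow]).

   If [sigma] is elliptic, let b(k, m) be the Fourier coefficients of 1 / [sigma k] for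
   large k. The sequences a(k, .) and b(k, .) are inverse to each other for convolution,
   so that, by slow oscillation, the compositions of (truncations of) the two operators
   in both orders are close to the identity outside a finite set of lattice points
   ([band_inverse]). One order bounds T from below on the families that vanish on a
   finite set, hence the kernel is finite dimensional and the range is closed; the
   other order shows that a functional vanishing on the range is determined by its
   values at finitely many unit vectors ([fredholm_of_parametrix]).

   If [sigma] is not elliptic, there are points k0 as far away as desired, and x0, with
   [sigma k0 x0] as small as desired. The plane wave of frequency x0 cut off to a large
   box around k0 is then almost annihilated by T ([wave_packet_almost_null]). If T had
   closed range, the open mapping theorem would correct such packets to elements of the
   kernel by small perturbations; packets with disjoint supports stay independent after
   the correction, and the kernel would be infinite dimensional
   ([fredholm_no_far_packets]).

   The Fourier analysis on the torus is done on finite grids, where the inversion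
   formula and the decay of coefficients are algebraic identities and estimates; the
   integrals are limits of grid averages with an explicit error for Lipschitz functions.
   Regularity is measured by mixed difference quotients instead of derivatives, so that
   it passes from a function to its reciprocal by an elementary induction. *)

(** * Complex numbers, characters of the torus and boxes of lattice points *)

Section ComplexModulus.
Context {R : realType}.
Implicit Types y z : R[i].

Lemma normc_real (x : R) : normc x%:C = `|x|.
Proof. by rewrite /= expr0n addr0 sqrtr_sqr. Qed.

Lemma normcN z : normc (- z) = normc z.
Proof. by case: z => a b /=; rewrite !sqrrN. Qed.

Lemma normc1 : normc (1 : R[i]) = 1.
Proof. by rewrite /= expr1n expr0n addr0 sqrtr1. Qed.

Lemma le_normcB y z : normc (y - z) <= normc y + normc z.
Proof. by rewrite -(normcN z) le_normcD. Qed.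

Lemma normc_distC y z : normc (y - z) = normc (z - y).
Proof. by rewrite -normcN opprB. Qed.

Lemma le_normc_dist y z t : normc (y - z) <= normc (y - t) + normc (t - z).
Proof. by apply: le_trans (le_normcD _ _); rewrite addrA subrK. Qed.

Lemma le_normc_sum (I : Type) (r : seq I) (P : pred I) (F : I -> R[i]) :
  normc (\sum_(i <- r | P i) F i) <= \sum_(i <- r | P i) normc (F i).
Proof.
elim/big_ind2: _ => //; first by rewrite normc0.
by move=> x a y b xa yb; apply: le_trans (le_normcD _ _) (lerD _ _).
Qed.

Lemma normcE z : normc z ^+ 2 = complex.Re z ^+ 2 + complex.Im z ^+ 2.
Proof. by case: z => a b /=; rewrite sqr_sqrtr// addr_ge0 ?sqr_ge0. Qed.

Lemma normc_Re z : `|complex.Re z| <= normc z.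
Proof. by case: z => a b /=; rewrite -sqrtr_sqr ler_wsqrtr// lerDl sqr_ge0. Qed.

Lemma normc_Im z : `|complex.Im z| <= normc z.
Proof. by case: z => a b /=; rewrite -sqrtr_sqr ler_wsqrtr// lerDr sqr_ge0. Qed.

Lemma normc_ReIm z : normc z <= `|complex.Re z| + `|complex.Im z|.
Proof.
rewrite -(@ler_pXn2r _ 2)// ?nnegrE ?addr_ge0 ?Defs.normc_ge0// normcE.
rewrite -[X in X + _]real_normK ?num_real// -[X in _ + X]real_normK ?num_real//.
by rewrite sqrrD lerD2r lerDl mulrn_wge0// mulr_ge0.
Qed.

Lemma Re_realM (x : R) z : complex.Re (x%:C * z) = x * complex.Re z.
Proof. by case: z => a b /=; rewrite mul0r subr0. Qed.

Lemma Im_realM (x : R) z : complex.Im (x%:C * z) = x * complex.Im z.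
Proof. by case: z => a b /=; rewrite mul0r addr0. Qed.

Lemma invr_natC (p : nat) : p%:R^-1 = (p%:R^-1)%:C :> R[i].
Proof. by rewrite fmorphV rmorph_nat. Qed.

(** Identities between integrals, sums and other limits are obtained from estimates
   with an arbitrarily small error. *)
Lemma normc_eq (y z : R[i]) : (forall e, 0 < e -> normc (y - z) <= e) -> y = z.
Proof.
move=> yz; apply/eqP; rewrite -subr_eq0; apply/eqP/eq0_normc/le_anti.
rewrite Defs.normc_ge0 andbT; apply/ler_addgt0Pr => e e0.
by rewrite add0r yz.
Qed.

End ComplexModulus.

Section Expi.
Context {R : realType}.
Implicit Types s t : R.

Lemma expiD s t : expi (s + t) = expi s * expi t.
Proof.
by rewrite /expi cosD sinD /GRing.mul/= [X in _ +i* X]addrC [X in X + _]mulrC.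
Qed.

Lemma expi0 : expi 0 = 1 :> R[i].
Proof. by rewrite /expi cos0 sin0. Qed.

Lemma normc_expi t : normc (expi t) = 1.
Proof. by rewrite /= cos2Dsin2 sqrtr1. Qed.

Lemma expiNr t : expi t * expi (- t) = 1.
Proof. by rewrite -expiD subrr expi0. Qed.

Lemma expi_int (z : int) : expi (2 * pi * z%:~R) = 1 :> R[i].
Proof.
have nat_case (p : nat) : expi (2 * pi * p%:R) = 1 :> R[i].
  elim: p => [|p IH]; first by rewrite mulr0 expi0.
  rewrite -[p.+1%:R]natr1 mulrDr expiD IH mul1r mulr1 /expi mulr_natl.
  by rewrite cos2pi sin2pi.
case: z => p; first exact: nat_case.
rewrite NegzE mulrNz mulrN.
by have := expiNr (2 * pi * p.+1%:R); rewrite nat_case mul1r.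
Qed.

Lemma normc_expiB1 t : normc (expi t - 1) ^+ 2 = 2 - 2 * cos t.
Proof.
rewrite normcE /= subr0; have := cos2Dsin2 t => h.
have -> : (cos t - 1) ^+ 2 + sin t ^+ 2 = cos t ^+ 2 + sin t ^+ 2 + 1 - 2 * cos t by ring.
by rewrite h.
Qed.

Lemma lip_of_deriv (f f' : R -> R) (C : R) :
  (forall t, is_derive t 1 f (f' t)) -> (forall t, `|f' t| <= C) ->
  forall s t, `|f s - f t| <= C * `|s - t|.
Proof.
move=> fd fC s t; wlog st : s t / s <= t.
  by move=> H; case: (leP s t) => [|/ltW] /H//; rewrite distrC (distrC t).
have cf x : {for x, continuous f}.
  by apply: differentiable_continuous; apply/derivable1_diffP; have := fd x => -[].
have [|c _ fst] := @MVT_segment _ f f' s t st (fun x _ => fd x).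
  exact: continuous_subspaceT.
by rewrite distrC fst (distrC s) normrM ler_wpM2r.
Qed.

Lemma expi_lip s t : normc (expi s - expi t) <= 2 * `|s - t|.
Proof.
apply: le_trans (normc_ReIm _) _ => /=.
rewrite (_ : 2 * _ = 1 * `|s - t| + 1 * `|s - t|); last by ring.
apply: lerD.
- apply: (@lip_of_deriv _ (fun t => - sin t)) => x; rewrite normrN.
  by rewrite ler_norml sin_geN1 sin_le1.
- apply: (@lip_of_deriv _ cos) => x.
  by rewrite ler_norml cos_geN1 cos_le1.
Qed.

(** A phase between a quarter turn and a half turn keeps [expi t] away from 1;
   dividing by this difference is what gains decay of Fourier coefficients. *)
Lemma expi_far t : pi / 2 <= `|t| <= pi -> 2 <= normc (expi t - 1) ^+ 2.
Proof.
move=> /andP[t1 t2]; rewrite normc_expiB1.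
suff : cos t <= 0 by lra.
have -> : cos t = cos `|t| 
    by case: (ler0P t) => _; rewrite ?cosN.
rewrite -[X in cos X](subrK (pi / 2)) cosDpihalf oppr_le0 sin_ge0_pi//.
by apply/andP; split; lra.
Qed.

End Expi.

Section Dot.
Context {R : realType} {n : nat}.
Implicit Types (k l : 'rV[int]_n) (x y : 'rV[R]_n).

Lemma dotZRDl k l x : dotZR (k + l) x = dotZR k x + dotZR l x.
Proof.
by rewrite -big_split; apply: eq_bigr => j _; rewrite mxE intrD mulrDl.
Qed.

Lemma dotZRNl k x : dotZR (- k) x = - dotZR k x.
Proof. by rewrite -sumrN; apply: eq_bigr => j _; rewrite mxE mulrNz mulNr. Qed.

Lemma dotZRDr k x y : dotZR k (x + y) = dotZR k x + dotZR k y.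
Proof. by rewrite -big_split; apply: eq_bigr => j _; rewrite mxE mulrDr. Qed.

Lemma dotZR_delta k (s : R) j : dotZR k (s *: delta_mx 0 j) = (k 0 j)%:~R * s.
Proof.
rewrite /dotZR (bigD1 j)//= big1 ?addr0 => [|i ij].
  by rewrite !mxE !eqxx mulr1.
by rewrite !mxE (negPf ij) andbF !mulr0.
Qed.

Lemma dotZR_int k (z : 'rV[int]_n) :
  dotZR k (map_mx intr z : 'rV[R]_n) = (\sum_j k 0 j * z 0 j)%:~R.
Proof. by rewrite rmorph_sum; apply: eq_bigr => j _; rewrite mxE -intrM. Qed.

Definition echar k x : R[i] := expi (2 * pi * dotZR k x).

Lemma echarDl k l x : echar (k + l) x = echar k x * echar l x.
Proof. by rewrite /echar dotZRDl mulrDr expiD. Qed.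

Lemma echarDr k x y : echar k (x + y) = echar k x * echar k y.
Proof. by rewrite /echar dotZRDr mulrDr expiD. Qed.

Lemma echar0l x : echar 0 x = 1.
Proof.
rewrite /echar (_ : dotZR 0 x = 0) ?mulr0 ?expi0//.
by apply: big1 => j _; rewrite mxE mul0r.
Qed.

Lemma echarNl k x : echar (- k) x * echar k x = 1.
Proof. by rewrite -echarDl addNr echar0l. Qed.

Lemma normc_echar k x : normc (echar k x) = 1.
Proof. exact: normc_expi. Qed.

Lemma echar_periodic k : lattice_periodic (echar k).
Proof.
by move=> x z; rewrite echarDr /echar dotZR_int expi_int mulr1.
Qed.

Lemma echar_prod k x :
  echar k x = \prod_j expi (2 * pi * ((k 0 j)%:~R * x 0 j)).
Proof.
by rewrite /echar /dotZR mulr_sumr (big_morph expi expiD expi0).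
Qed.

End Dot.

Section Boxes.
Context {n : nat}.
Implicit Types (M D : nat) (m k : 'rV[int]_n).

(* Locked, as unification would otherwise try to enumerate the finite functions. *)
Definition box M : {fset 'rV[int]_n} :=
  locked [fset \row_j ((F j : nat)%:Z - M%:Z) | F : {ffun 'I_n -> 'I_(M.*2.+1)} in predT]%fset.

Lemma in_box M m : (m \in box M) = [forall j, (`|m 0%R j| <= M)%N].
Proof.
rewrite /box -lock; apply/imfsetP/forallP => [[F _ ->] j|mM].
  rewrite mxE; move: (F j) => [i /= iM]; lia.
have lt j : (`|(m 0%R j + M%:Z)%R| < M.*2.+1)%N by have := mM j; lia.
exists [ffun j => Ordinal (lt j)] => //.
by apply/rowP => j; rewrite mxE ffunE /=; have := mM j; lia.
Qed.

Lemma boxP M m : reflect (forall j, (`|m 0%R j| <= M)%N) (m \in box M).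
Proof. by rewrite in_box; apply: forallP. Qed.

Lemma box0 M : 0 \in box M.
Proof. by apply/boxP => j; rewrite mxE. Qed.

Lemma boxN M m : (- m \in box M) = (m \in box M).
Proof.
by apply/boxP/boxP => mM j; have := mM j; rewrite mxE abszN.
Qed.

Lemma boxD M D m k : m \in box M -> k \in box D -> m + k \in box (M + D).
Proof.
by move=> /boxP mM /boxP kD; apply/boxP => j; rewrite mxE; move: (mM j) (kD j);
  move: (m _ _) (k _ _) => a b; lia.
Qed.

Lemma box_le M D : (M <= D)%N -> (box M `<=` box D)%fset.
Proof.
by move=> MD; apply/fsubsetP => m /boxP mM; apply/boxP => j; apply: leq_trans (mM j) MD.
Qed.

(** Leaving a large box is how a lattice point tends to infinity, and this is
   unaffected by bounded translations. *)
Lemma notin_boxD M D m k : k \notin box (M + D) -> m \in box D -> k + m \notin box M.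
Proof.
move=> kMD mD; apply: contra kMD => kmM.
by rewrite -[k](addrK m); apply: boxD => //; rewrite boxN.
Qed.

Lemma fset_in_box (A : {fset 'rV[int]_n}) : exists M, (A `<=` box M)%fset.
Proof.
exists (\max_(m <- A) \max_j `|m 0%R j|)%N; apply/fsubsetP => m mA.
apply/boxP => j; apply: leq_trans (leq_bigmax_seq _ mA isT).
exact: (leq_bigmax (F := fun j => `|m 0%R j|%N) j).
Qed.

Lemma in_some_box m : exists M, m \in box M.
Proof.
by have [M /fsubsetP H] := fset_in_box [fset m]%fset; exists M; apply: H; rewrite inE.
Qed.

Lemma sum_box (V : nmodType) M (F : 'rV[int]_n -> V) :
  \sum_(m <- box M) F m =
  \sum_(f : {ffun 'I_n -> 'I_(M.*2.+1)}) F (\row_j ((f j : nat)%:Z - M%:Z)).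
Proof.
rewrite /box -lock big_imfset/=; last first.
  move=> f g _ _ /rowP fg; apply/ffunP => j; apply/val_inj => /=.
  by have := fg j; rewrite !mxE; lia.
by rewrite big_enum.
Qed.

Lemma sum_box_prod (K : comPzRingType) M (f : 'I_n -> int -> K) :
  \sum_(m <- box M) \prod_j f j (m 0 j) =
  \prod_j \sum_(i < M.*2.+1) f j ((i : nat)%:Z - M%:Z).
Proof.
rewrite sum_box bigA_distr_bigA/=; apply: eq_bigr => g _.
by apply: eq_bigr => j _; rewrite mxE.
Qed.

Lemma card_box M : #|` box M| = (M.*2.+1 ^ n)%N.
Proof.
have : (#|` box M|)%:Z = (M.*2.+1 ^ n)%N%:Z.
  rewrite -[LHS](_ : \sum_(m <- box M) 1 = _); last first.
    by rewrite big_const_seq count_predT iter_addr_0 natz.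
  rewrite sum_box sumr_const card_ffun !card_ord natz //.
by case.
Qed.

End Boxes.

Lemma ler_sum_seq (R : numDomainType) (I : eqType) (r : seq I) (F G : I -> R) :
  (forall i, i \in r -> F i <= G i) -> \sum_(i <- r) F i <= \sum_(i <- r) G i.
Proof. by move=> FG; rewrite big_seq [leRHS]big_seq; apply: ler_sum. Qed.

Lemma sum_fsetU_disjoint (I : choiceType) (V : nmodType) (A B : {fset I}) (F : I -> V) :
  [disjoint A & B]%fset ->
  \sum_(i <- (A `|` B)%fset) F i = \sum_(i <- A) F i + \sum_(i <- B) F i.
Proof.
move=> AB; rewrite (big_fsetID _ (mem A) (A `|` B)%fset)/=; congr (_ + _).
  apply: eq_fbigl => i; rewrite !inE/=.
  by case: (i \in A); rewrite ?andbT ?andbF.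
apply: eq_fbigl => i; rewrite !inE/= andb_orl andbN orFb andb_idr// => iB.
by apply/negP => iA; have := fdisjointP AB _ iA; rewrite iB.
Qed.

Lemma sum_imfset (I J : choiceType) (V : nmodType) (A : {fset I}) (f : I -> J) (F : J -> V) :
  injective f -> \sum_(j <- [fset f i | i in A]%fset) F j = \sum_(i <- A) F (f i).
Proof. by move=> fI; rewrite big_imfset//= => i j _ _ /fI. Qed.

Lemma eq_sum_cond (I : choiceType) (V : nmodType) (A B : {fset I}) (P Q : pred I) (F : I -> V) :
  (forall i, (i \in A) && P i = (i \in B) && Q i) ->
  \sum_(i <- A | P i) F i = \sum_(i <- B | Q i) F i.
Proof.
move=> PQ; rewrite big_fset_condE/= [RHS]big_fset_condE/=; apply: eq_fbigl => i.
by rewrite !inE/= PQ.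
Qed.

(** The weight [decay m] bounds the Fourier coefficients of a function whose
   mixed second differences are bounded. It factors over the coordinates, so
   its sums over boxes do too. *)
Section Weights.
Context {R : realType} {n : nat}.
Implicit Types (M D : nat) (m k : 'rV[int]_n).

Definition decay1 (z : int) : R := if z == 0 then 1 else (z%:~R ^+ 2)^-1.

Definition decay m : R := \prod_j decay1 (m 0 j).

Definition decay_sum M : R := \sum_(m <- box M) decay m.

Lemma decay1_gt0 z : 0 < decay1 z.
Proof.
rewrite /decay1; case: eqP => [//|/eqP z0].
by rewrite invr_gt0 exprn_even_gt0//= intr_eq0.
Qed.

Lemma decay_gt0 m : 0 < decay m.
Proof. by apply: prodr_gt0 => j _; apply: decay1_gt0. Qed.

Lemma decay_ge0 m : 0 <= decay m.
Proof. exact/ltW/decay_gt0. Qed.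

(** The bound is a telescoping majorant: 1/a^2 <= 2/a - 2/(a+1) for a >= 1, and
   each modulus a occurs twice. *)
Lemma decay1_sum M : \sum_(i < M.*2.+1) decay1 ((i : nat)%:Z - M%:Z) <= 7 - 4 / M.+1%:R.
Proof.
elim: M => [|M IH].
  by rewrite big_ord_recl big_ord0 /decay1/= addr0; lra.
rewrite doubleS big_ord_recl big_ord_recr/=.
rewrite (eq_bigr (fun i : 'I_(M.*2.+1) => decay1 ((i : nat)%:Z - M%:Z))); last first.
  by move=> i _; congr decay1; rewrite /bump/=; lia.
have -> : decay1 (0%:Z - M.+1%:Z) = (M.+1%:R ^+ 2)^-1.
  by rewrite /decay1 sub0r oppr_eq0/= mulrNz sqrrN.
have -> : decay1 ((bump 0 M.*2.+1)%:Z - M.+1%:Z) = (M.+1%:R ^+ 2)^-1.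
  rewrite (_ : _ - _ = M.+1%:Z); last by rewrite /bump/=; lia.
  by rewrite /decay1.
have a1 : 1 <= M.+1%:R :> R by rewrite ler1n.
move: IH a1; rewrite -[M.+2%:R]natr1.
move: (\sum_(i < _) _) (M.+1%:R) => S a IH a1.
suff : (a ^+ 2)^-1 <= 2 / a - 2 / (a + 1).
  move: IH; move: (a ^+ 2)^-1 a^-1 (a + 1)^-1 => x y z; lra.
have -> : 2 / a - 2 / (a + 1) = 2 / (a * (a + 1)) by field; apply/andP; split; lra.
by rewrite ler_pdivlMr ?ler_pdivrMl; nra.
Qed.

Lemma decay_sum_bounded M : decay_sum M <= 7 ^+ n.
Proof.
rewrite /decay_sum (sum_box_prod M (fun=> decay1)) -[n in 7 ^+ n]card_ord -prodr_const.
apply: ler_prod => j _; apply/andP; split.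
  by apply: sumr_ge0 => i _; apply/ltW/decay1_gt0.
apply: le_trans (decay1_sum M) _; rewrite gerBl divr_ge0//.
Qed.

Lemma le_sum_fset (A B : {fset 'rV[int]_n}) (F : 'rV[int]_n -> R) :
  (A `<=` B)%fset -> (forall m, 0 <= F m) ->
  \sum_(m <- A) F m <= \sum_(m <- B) F m.
Proof.
move=> AB F0; rewrite [leRHS](big_fsetID _ (mem A))/=.
rewrite (_ : [fset x in B | x \in A]%fset = A) ?lerDl ?sumr_ge0//.
by apply/fsetP => m; rewrite !inE/= andb_idl// => /(fsubsetP AB).
Qed.

Lemma decay_sum_le M D : (M <= D)%N -> decay_sum M <= decay_sum D.
Proof. by move=> /(box_le (n := n)) MD; apply: le_sum_fset => // m; apply: decay_ge0. Qed.

Definition decay_total : R := sup (range decay_sum).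

Lemma has_sup_decay_sum : has_sup (range decay_sum).
Proof.
split; first by exists (decay_sum 0), 0%N.
by exists (7 ^+ n) => _ [M _ <-]; apply: decay_sum_bounded.
Qed.

(** The remainder of the convergent sum of the weight; all truncation errors
   below are multiples of it. *)
Definition tail D : R := decay_total - decay_sum D.

Lemma tail_ge0 D : 0 <= tail D.
Proof.
rewrite subr_ge0; apply: sup_upper_bound; first exact: has_sup_decay_sum.
by exists D.
Qed.

Lemma tail_small e : 0 < e -> exists D0, forall D, (D0 <= D)%N -> tail D <= e.
Proof.
move=> e0; have [_ [D0 _ <-] h] := sup_adherent e0 has_sup_decay_sum.
exists D0 => D /decay_sum_le D0D; rewrite /tail /decay_total; lra.
Qed.

Lemma sum_decay (A : {fset 'rV[int]_n}) : \sum_(m <- A) decay m <= decay_total.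
Proof.
have [M AM] := fset_in_box A; apply: le_trans (le_sum_fset AM decay_ge0) _.
by rewrite -subr_ge0 tail_ge0.
Qed.

Lemma sum_decay_tail (A : {fset 'rV[int]_n}) D :
  [disjoint A & box D]%fset -> \sum_(m <- A) decay m <= tail D.
Proof.
move=> AD; rewrite lerBrDr; apply: le_trans (sum_decay (A `|` box D)%fset).
rewrite (big_fsetID _ (mem A) (A `|` box D)%fset)/=.
apply: lerD; apply: le_sum_fset; try exact: decay_ge0.
  by apply/fsubsetP => m mA; rewrite !inE/= mA.
apply/fsubsetP => m mD; rewrite !inE/= mD orbT/=.
by apply/negP => mA; have := fdisjointP AD _ mA; rewrite mD.
Qed.

Lemma decay_total_ge0 : 0 <= decay_total.
Proof. by have := sum_decay fset0; rewrite big_seq_fset0. Qed.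

End Weights.
Arguments decay R {n} m.
Arguments tail R n D : clear implicits.
Arguments decay_total R n : clear implicits.

(** * Averages and integrals over the torus *)

Section UnitIntervalIntegral.
Context {R : realType}.
Implicit Types (g h : R -> R) (a b c e L : R).
Local Notation mu := (@lebesgue_measure R).

(** Lipschitz continuity is all the regularity that the integrals need: it is
   preserved by integration in one variable and gives Riemann sums with an
   explicit error, uniform in the remaining variables. *)
Definition lipschitz1 L g := forall s t, `|g s - g t| <= L * `|s - t|.

Lemma lipschitz1_continuous L g : lipschitz1 L g -> continuous g.
Proof.
move=> gL x; apply/cvgrPdist_le => e e0; near=> y.
apply: le_trans (gL x y) _; have L1 : 0 < `|L| + 1 by rewrite ltr_wpDl.
apply: (@le_trans _ _ ((`|L| + 1) * `|x - y|)).
  by apply: ler_wpM2r => //; apply: le_trans (ler_norm L) _; rewrite lerDl.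
rewrite mulrC -ler_pdivlMr//; near: y.
by apply: cvgr_dist_le; [exact: cvg_id|rewrite divr_gt0].
Unshelve. all: by end_near. Qed.

Lemma lipschitz1_integrable L g a b :
  lipschitz1 L g -> mu.-integrable `[a, b] (EFin \o g).
Proof.
move=> gL; apply: continuous_compact_integrable; first exact: segment_compact.
exact/continuous_subspaceT/(lipschitz1_continuous gL).
Qed.

Lemma le_Rintegral_dist (E : set R) g c e : measurable E ->
  mu.-integrable E (EFin \o g) -> (mu E < +oo)%E ->
  (forall t, E t -> `|g t - c| <= e) ->
  `|\int[mu]_(t in E) g t - c * fine (mu E)| <= e * fine (mu E).
Proof.
move=> mE gi Ey ge.
have ic (r : R) : mu.-integrable E (EFin \o cst r).
  apply: measurable_bounded_integrable => //.
  by exists `|r|; split; [exact: num_real|move=> x rx t _; exact: ltW].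
have gb t : E t -> c - e <= g t <= c + e.
  by move=> /ge; rewrite ler_distl.
have := @le_Rintegral _ _ _ mu E (cst (c - e)) g mE (ic _) gi
  (fun t Et => (andP (gb t Et)).1).
have := @le_Rintegral _ _ _ mu E g (cst (c + e)) mE gi (ic _)
  (fun t Et => (andP (gb t Et)).2).
rewrite !Rintegral_cst// ler_distl mulrBl mulrDl => -> ->.
by [].
Qed.

Lemma le_unit_integral_dist L g h e : lipschitz1 L g -> lipschitz1 L h ->
  (forall t, `|g t - h t| <= e) ->
  `|\int[mu]_(t in `[0, 1]) g t - \int[mu]_(t in `[0, 1]) h t| <= e.
Proof.
move=> gL hL gh; rewrite -RintegralB//; try exact: lipschitz1_integrable.
have ghL : lipschitz1 (L + L) (fun t => g t - h t).
  move=> s t; rewrite (_ : _ - _ = (g s - g t) - (h s - h t)); last by ring.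
  by rewrite mulrDl; apply: le_trans (ler_normB _ _) (lerD (gL s t) (hL s t)).
have mu01 : mu `[0, 1] = 1%E.
  by rewrite lebesgue_measure_itv/= lte_fin ltr01 -EFinB subr0.
have := @le_Rintegral_dist `[0, 1] (fun t => g t - h t) 0 e.
rewrite mu01/= mul0r subr0 mulr1; apply => //.
- exact: lipschitz1_integrable ghL.
- by rewrite ltry.
by move=> t _; rewrite subr0.
Qed.

Lemma riemann_step L g a b : lipschitz1 L g -> 0 <= L -> 0 <= a -> a <= b ->
  `|\int[mu]_(t in `[0, b]) g t - \int[mu]_(t in `[0, a]) g t - (b - a) * g a|
    <= L * (b - a) ^+ 2.
Proof.
move=> gL L0 a0 ab; rewrite Rintegral_itvB//; last first.
  exact: lipschitz1_integrable gL.
have muE : fine (mu `]a, b]) = b - a.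
  rewrite lebesgue_measure_itv/= lte_fin; case: ltP => [//|ba].
  by apply/esym/eqP; rewrite subr_eq0 eq_le ab ba.
have := @le_Rintegral_dist `]a, b] g (g a) (L * (b - a)).
rewrite muE [g a * _]mulrC expr2 [L * (_ * _)]mulrA; apply => //.
- apply: (integrableS _ _ _ (lipschitz1_integrable a b gL)) => //.
  by apply: subset_itvr; rewrite bnd_simp.
- by rewrite lebesgue_measure_itv/=; case: ifP => _; rewrite ?ltry.
move=> t; rewrite /= in_itv/= => /andP[ta tb].
apply: le_trans (gL t a) _; apply: ler_wpM2l => //.
by rewrite ger0_norm ?subr_ge0 ?(ltW ta)// lerD2r.
Qed.

Lemma le_riemann_sum_dist L g N : lipschitz1 L g -> 0 <= L ->
  `|\int[mu]_(t in `[0, 1]) g t - N.+1%:R^-1 * \sum_(i < N.+1) g (i%:R / N.+1%:R)|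
    <= L / N.+1%:R.
Proof.
move=> gL L0; set d := N.+1%:R^-1 : R.
have d0 : 0 <= d by rewrite invr_ge0.
suff H (k : nat) : `|\int[mu]_(t in `[0, k%:R * d]) g t
    - d * \sum_(i < k) g (i%:R * d)| <= k%:R * (L * d ^+ 2).
  have := H N.+1; rewrite mulfV ?pnatr_eq0//; congr (_ <= _).
  by rewrite mulrCA expr2 [_ * (d * d)]mulrA mulfV ?pnatr_eq0// mul1r.
elim: k => [|k IH].
  by rewrite mul0r set_itv1 Rintegral_set1 big_ord0 mulr0 subr0 normr0 mul0r.
have kd : 0 <= k%:R * d by rewrite mulr_ge0.
have kSd : k.+1%:R * d = k%:R * d + d by rewrite -natr1 mulrDl mul1r.
have kdS : k%:R * d <= k.+1%:R * d by rewrite kSd lerDl.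
have := riemann_step gL L0 kd kdS.
rewrite big_ord_recr/= kSd [_ + d - _]addrAC subrr add0r.
move: (\int[mu]_(t in `[0, k%:R * d + d]) g t) => J1.
move: (\int[mu]_(t in `[0, k%:R * d]) g t) IH => J0 IH step.
rewrite (_ : _ - _ = (J0 - d * \sum_(i < k) g (i%:R * d)) +
  (J1 - J0 - d * g (k%:R * d))); last by ring.
apply: le_trans (ler_normD _ _) _; rewrite -natr1 mulrDl mul1r; exact: lerD.
Qed.

End UnitIntervalIntegral.

Section SetCoord.
Context {R : realType} {n : nat}.
Implicit Types (x : 'rV[R]_n) (i j : 'I_n) (s t : R).

Lemma set_coordK x j s t : set_coord (set_coord x j s) j t = set_coord x j t.
Proof. by apply/rowP => i; rewrite !mxE; case: eqP. Qed.

Lemma set_coordC x i j s t : i != j ->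
  set_coord (set_coord x i s) j t = set_coord (set_coord x j t) i s.
Proof.
move=> ij; apply/rowP => l; rewrite !mxE; case: (eqVneq l j) => // ->.
by rewrite eq_sym (negPf ij).
Qed.

Lemma set_coordE x j t : set_coord x j t = x + (t - x 0 j) *: delta_mx 0 j.
Proof.
apply/rowP => i; rewrite !mxE eqxx/=; case: eqVneq => [->|_].
  by rewrite mulr1 addrC subrK.
by rewrite mulr0 addr0.
Qed.

Lemma set_coord_shift x j s t :
  set_coord x j s + t *: delta_mx 0 j = set_coord x j (s + t).
Proof. by rewrite !set_coordE -addrA -scalerDl addrAC. Qed.

Lemma set_coord_shiftC x i j s t : i != j ->
  set_coord x j s + t *: delta_mx 0 i = set_coord (x + t *: delta_mx 0 i) j s.
Proof.
move=> ij; rewrite !set_coordE !mxE eqxx (eq_sym j) (negPf ij) mulr0 addr0.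
by rewrite addrAC.
Qed.

Lemma set_coord_id x j : set_coord x j (x 0 j) = x.
Proof. by rewrite set_coordE subrr scale0r addr0. Qed.

End SetCoord.

(** The Riemann sums over a grid of step 1/N. All of Fourier analysis on the
   torus is carried out for these finite averages, where it is elementary
   algebra; the integral enters only as their limit. *)
Section Averages.
Context {R : realType} {n : nat}.
Implicit Types (K : numFieldType) (N : nat) (js : seq 'I_n) (x : 'rV[R]_n) (i j : 'I_n).

Definition avg1 K N j (f : 'rV[R]_n -> K) x : K :=
  N%:R^-1 * \sum_(i < N) f (set_coord x j (i%:R / N%:R)).

Definition avg K N js (f : 'rV[R]_n -> K) : 'rV[R]_n -> K := foldr (avg1 N) f js.

Definition lipR (L : R) (f : 'rV[R]_n -> R) := forall x j,
  lipschitz1 L (fun t => f (set_coord x j t)).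

Lemma int_coord_lip L f j : 0 <= L -> lipR L f -> lipR L (int_coord j f).
Proof.
move=> L0 fL x i s t; rewrite /int_coord.
have [<-|ij] := eqVneq i j.
  by under eq_Rintegral do rewrite set_coordK;
     under [X in _ - X]eq_Rintegral do rewrite set_coordK;
     rewrite subrr normr0 mulr_ge0.
apply: (@le_unit_integral_dist _ L); [exact: fL|exact: fL|].
by move=> r; rewrite !(set_coordC _ _ _ ij); apply: fL.
Qed.

Lemma int_coords_lip L f js : 0 <= L -> lipR L f -> lipR L (foldr int_coord f js).
Proof. by move=> L0 fL; elim: js => //= j js; apply: int_coord_lip. Qed.

Lemma le_avg1_norm N j (f : 'rV[R]_n -> R) x e :
  (forall x, `|f x| <= e) -> `|avg1 N.+1 j f x| <= e.
Proof.
move=> fe; rewrite /avg1 normrM ger0_norm ?invr_ge0// ler_pdivrMl//.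
apply: le_trans (ler_norm_sum _ _ _) _.
have -> : N.+1%:R * e = \sum_(i < N.+1) e by rewrite sumr_const card_ord mulr_natl.
exact: ler_sum.
Qed.

Lemma int_coords_avg L f js N : 0 <= L -> lipR L f -> forall x,
  `|foldr int_coord f js x - avg N.+1 js f x| <= (size js)%:R * (L / N.+1%:R).
Proof.
move=> L0 fL; elim: js => [|j js IH] x; first by rewrite subrr normr0 mul0r.
rewrite -[(size _)%:R]natr1 mulrDl mul1r [leRHS]addrC /=.
set F := foldr int_coord f js; set G := avg _ js f.
apply: le_trans (ler_distD (avg1 N.+1 j F x) _ _) _.
apply: lerD.
  exact: (le_riemann_sum_dist N (int_coords_lip js L0 fL x j) L0).
rewrite /avg1 -mulrBr -sumrB.
exact: (@le_avg1_norm N j (fun x => F x - G x)).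
Qed.

(** A translation by a grid step permutes the grid cyclically, up to a period. *)
Lemma avg1_shift K N i (f : 'rV[R]_n -> K) x r :
  (forall y, f (y + delta_mx 0 i) = f y) ->
  avg1 N.+1 i (fun y => f (y + (r%:R / N.+1%:R) *: delta_mx 0 i)) x = avg1 N.+1 i f x.
Proof.
move=> fp; rewrite /avg1; congr (_ * _).
under eq_bigr do rewrite set_coord_shift -mulrDl -natrD.
elim: r => [|r IH]; first by under eq_bigr do rewrite addn0.
rewrite -{}IH big_ord_recr [RHS]big_ord_recl/= addrC; congr (_ + _).
  rewrite addnS -addSn natrD mulrDl mulfV ?pnatr_eq0// add0n [1 + _]addrC.
  by rewrite -set_coord_shift scale1r fp.
by apply: eq_bigr => q _; rewrite /bump/= add1n addnS.
Qed.

Lemma avg_shiftC K N js i (f : 'rV[R]_n -> K) x t : i \notin js ->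
  avg N js (fun y => f (y + t *: delta_mx 0 i)) x = avg N js f (x + t *: delta_mx 0 i).
Proof.
elim: js x => //= j js IH x; rewrite inE negb_or => /andP[ij ijs].
rewrite /avg1; congr (_ * _); apply: eq_bigr => q _.
by rewrite IH// set_coord_shiftC.
Qed.

Lemma avg_shift K N js i (f : 'rV[R]_n -> K) x r : uniq js -> i \in js ->
  (forall y, f (y + delta_mx 0 i) = f y) ->
  avg N.+1 js (fun y => f (y + (r%:R / N.+1%:R) *: delta_mx 0 i)) x = avg N.+1 js f x.
Proof.
move=> + + fp; elim: js x => //= j js IH x /andP[jjs ujs].
rewrite inE; case: (eqVneq i j) => /= [ij _|ij ijs].
  rewrite -ij in jjs *.
  rewrite -[RHS](@avg1_shift _ _ _ _ _ r); last first.
    move=> y; have := avg_shiftC N.+1 f y 1 jjs; rewrite scale1r => <-.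
    by congr (avg _ _ _ _); apply/funext => z; rewrite fp.
  by rewrite /avg1; congr (_ * _); apply: eq_bigr => q _; rewrite -avg_shiftC.
by rewrite /avg1; congr (_ * _); apply: eq_bigr => q _; rewrite IH.
Qed.

Lemma avgD K N js (f g : 'rV[R]_n -> K) x :
  avg N js (fun y => f y + g y) x = avg N js f x + avg N js g x.
Proof.
elim: js x => //= j js IH x; rewrite /avg1 -mulrDr -big_split/=.
by congr (_ * _); apply: eq_bigr => q _; rewrite IH.
Qed.

Lemma avgZ K N js (c : K) (f : 'rV[R]_n -> K) x :
  avg N js (fun y => c * f y) x = c * avg N js f x.
Proof.
elim: js x => //= j js IH x; rewrite /avg1 mulrCA; congr (_ * _); rewrite mulr_sumr.
by apply: eq_bigr => q _; rewrite IH.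
Qed.

(** The mechanism of discrete Fourier inversion: on the grid, the Dirichlet kernel
   in each variable is N times the indicator of the point 0. *)
Lemma avg_kernel K N js (d : R -> K) (g : 'rV[R]_n -> K) x : uniq js ->
  (forall q : 'I_N.+1, d (q%:R / N.+1%:R) = if q == ord0 then N.+1%:R else 0) ->
  (forall j, j \in js -> x 0 j = 0) ->
  avg N.+1 js (fun y => (\prod_(j <- js) d (y 0 j)) * g y) x = g x.
Proof.
move=> + dE; elim: js x g => [|j js IH] x g /=; first by rewrite big_nil mul1r.
move=> /andP[jjs ujs] x0.
have xj : x 0 j = 0 by apply: x0; rewrite inE eqxx.
have sx (q : 'I_N.+1) : avg N.+1 js
   (fun y => (\prod_(j0 <- j :: js) d (y 0 j0)) * g y) (set_coord x j (q%:R / N.+1%:R)) =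
   (if q == ord0 then N.+1%:R else 0) * g (set_coord x j (q%:R / N.+1%:R)).
  under eq_fun do rewrite big_cons mulrAC mulrC.
  rewrite (IH _ (fun y => d (y 0 j) * g y))//; first by rewrite mxE eqxx dE.
  move=> l ljs; rewrite mxE; case: eqVneq => [lj|_]; first by rewrite lj (negPf jjs) in ljs.
  by apply: x0; rewrite inE ljs orbT.
rewrite /avg1 (eq_bigr _ (fun q _ => sx q)) (bigD1 ord0)//= big1 ?addr0.
  by rewrite mul0r mulKf ?pnatr_eq0// -xj set_coord_id.
by move=> q /negPf ->; rewrite mul0r.
Qed.

End Averages.

Section Mean.
Context {R : realType} {n : nat}.
Implicit Types (f g : 'rV[R]_n -> R[i]) (N M : nat) (m : 'rV[int]_n) (x y : 'rV[R]_n).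

Definition mean N g : R[i] := avg N (enum 'I_n) g 0.

Definition lip (L : R) g := forall x j s t,
  normc (g (set_coord x j s) - g (set_coord x j t)) <= L * `|s - t|.

Lemma meanD N f g : mean N (fun y => f y + g y) = mean N f + mean N g.
Proof. exact: avgD. Qed.

Lemma meanZ N c g : mean N (fun y => c * g y) = c * mean N g.
Proof. exact: avgZ. Qed.

Lemma mean0 N : mean N (fun=> 0) = 0.
Proof.
by have := meanZ N 0 (fun=> 0); rewrite !mul0r.
Qed.

Lemma meanB N f g : mean N (fun y => f y - g y) = mean N f - mean N g.
Proof.
rewrite -[in RHS]mulN1r -meanZ -meanD; congr (mean N _).
by apply/funext => y; rewrite mulN1r.
Qed.

Lemma mean_sum (I : Type) (r : seq I) N (F : I -> 'rV[R]_n -> R[i]) :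
  mean N (fun y => \sum_(i <- r) F i y) = \sum_(i <- r) mean N (F i).
Proof.
elim: r => [|i r IH]; first by under eq_fun do rewrite big_nil; rewrite big_nil mean0.
by under eq_fun do rewrite big_cons; rewrite big_cons meanD IH.
Qed.

Lemma le_normc_mean N g e : (forall x, normc (g x) <= e) -> normc (mean N.+1 g) <= e.
Proof.
move=> ge; rewrite /mean; elim: (enum 'I_n) (0 : 'rV_n) => //= j js IH x.
rewrite /avg1 normcM; rewrite invr_natC normc_real ger0_norm ?invr_ge0// ler_pdivrMl//.
apply: le_trans (le_normc_sum _ _ _) _.
have -> : N.+1%:R * e = \sum_(i < N.+1) e by rewrite sumr_const card_ord mulr_natl.
exact: ler_sum.
Qed.

Lemma mean_shift N i g r : lattice_periodic g ->
  mean N.+1 (fun y => g (y + (r%:R / N.+1%:R) *: delta_mx 0 i)) = mean N.+1 g.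
Proof.
move=> gp; apply: avg_shift => [||y]; rewrite ?enum_uniq ?mem_enum//.
rewrite -[RHS](gp y (delta_mx 0 i)); congr (g (_ + _)).
by apply/matrixP => a b; rewrite !mxE; case: (_ && _).
Qed.

Lemma Re_mean N g : complex.Re (mean N g) = avg N (enum 'I_n) (fun x => complex.Re (g x)) 0.
Proof.
rewrite /mean; elim: (enum 'I_n) (0 : 'rV_n) => //= j js IH x; rewrite /avg1.
rewrite invr_natC Re_realM raddf_sum; congr (_ * _).
by apply: eq_bigr => q _; apply: IH.
Qed.

Lemma Im_mean N g : complex.Im (mean N g) = avg N (enum 'I_n) (fun x => complex.Im (g x)) 0.
Proof.
rewrite /mean; elim: (enum 'I_n) (0 : 'rV_n) => //= j js IH x; rewrite /avg1.
rewrite invr_natC Im_realM raddf_sum; congr (_ * _).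
by apply: eq_bigr => q _; apply: IH.
Qed.

Lemma lip_Re L g : lip L g -> lipR L (fun x => complex.Re (g x)).
Proof.
by move=> gL x j s t; apply: le_trans (gL x j s t); rewrite -raddfB normc_Re.
Qed.

Lemma lip_Im L g : lip L g -> lipR L (fun x => complex.Im (g x)).
Proof.
by move=> gL x j s t; apply: le_trans (gL x j s t); rewrite -raddfB normc_Im.
Qed.

Lemma torus_int_mean L g N : 0 <= L -> lip L g ->
  normc (torus_int g - mean N.+1 g) <= 2 * n%:R * (L / N.+1%:R).
Proof.
move=> L0 gL; apply: le_trans (normc_ReIm _) _.
rewrite !raddfB /= Re_mean Im_mean -mulrA [2 * _]mulr_natl mulr2n.
have sn : size (enum 'I_n) = n by rewrite size_enum_ord.
have := int_coords_avg (enum 'I_n) N L0 (lip_Re gL) 0.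
have := int_coords_avg (enum 'I_n) N L0 (lip_Im gL) 0.
by rewrite sn => hI hR; apply: lerD.
Qed.

(** The grid averages determine the integral; equalities and estimates for
   the latter are read off from the former. *)
Lemma torus_int_lim L g e : 0 <= L -> lip L g -> 0 < e ->
  exists N0, forall N, (N0 <= N)%N -> normc (torus_int g - mean N.+1 g) <= e.
Proof.
move=> L0 gL e0; pose c := 2 * n%:R * L.
have c0 : 0 <= c by rewrite !mulr_ge0.
exists (Num.truncn (c / e)) => N cN; apply: le_trans (torus_int_mean N L0 gL) _.
rewrite mulrA ler_pdivrMr// -ler_pdivrMl// mulrC.
by apply/ltW/(lt_le_trans (truncnS_gt _)); rewrite ler_nat.
Qed.

Lemma expi_geom N (q : 'I_N.+1) :
  \sum_(i < N.+1) expi (- (2 * pi * (i%:R * (q%:R / N.+1%:R)))) =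
  (if q == ord0 then N.+1%:R else 0) :> R[i].
Proof.
case: eqVneq => [->|q0].
  under eq_bigr do rewrite mul0r mulr0 mulr0 oppr0 expi0.
  by rewrite sumr_const card_ord.
pose w : R[i] := expi (- (2 * pi * (q%:R / N.+1%:R))).
have wX (i : nat) : expi (- (2 * pi * (i%:R * (q%:R / N.+1%:R)))) = w ^+ i.
  elim: i => [|i IH]; first by rewrite mul0r mulr0 oppr0 expi0.
  by rewrite exprS -IH -expiD; congr expi; rewrite -[i.+1%:R]natr1; ring.
under eq_bigr do rewrite wX.
have wN : w ^+ N.+1 = 1.
  rewrite -wX [_ * (_ / _)]mulrC divfK ?pnatr_eq0//.
  have := expiNr (2 * pi * q%:R : R); have := @expi_int R q => /= ->.
  by rewrite mul1r.
have w1 : w != 1.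
  apply/eqP => w1; have : normc (w - 1) ^+ 2 = 0 by rewrite w1 subrr normc0 expr0n.
  rewrite /w normc_expiB1 cosN; set a : R := q%:R / N.+1%:R.
  rewrite (_ : 2 * pi * a = (pi * a) *+ 2); last by rewrite mulr2n; ring.
  rewrite cos_mulr2n cos2sin2.
  have : 0 < sin (pi * a).
    apply: sin_gt0_pi; rewrite mulr_gt0 ?pi_gt0//=; last first.
      by rewrite divr_gt0// ltr0n lt0n.
    by rewrite gtr_pMr ?pi_gt0// ltr_pdivrMr// mul1r ltr_nat.
  by move: (sin _) => u u0; rewrite mulr2n; nra.
have := subrX1 w N.+1; rewrite wN subrr => /esym/eqP.
by rewrite mulf_eq0 subr_eq0 (negPf w1) => /eqP.
Qed.

(** With as many frequencies as grid points in each direction, Fourier inversion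
   is an exact identity: the sum of the characters in the box is a product of
   Dirichlet kernels, which concentrate at the grid point 0. *)
Lemma mean_inversion M g x :
  \sum_(m <- box M) mean M.*2.+1 (fun y => echar (- m) y * g (x + y)) = g x.
Proof.
rewrite -mean_sum; set N := M.*2.+1.
pose d (t : R) : R[i] := \sum_(i < N) expi (- (2 * pi * (((i : nat)%:Z - M%:Z)%:~R * t))).
have kerE (y : 'rV[R]_n) : \sum_(m <- box M) echar (- m) y = \prod_(j <- enum 'I_n) d (y 0 j).
  rewrite big_enum/= -(sum_box_prod M (fun j z => expi (- (2 * pi * (z%:~R * y 0 j))))).
  apply: eq_bigr => m _; rewrite echar_prod; apply: eq_bigr => j _.
  by rewrite mxE mulrNz mulNr mulrN.
rewrite -[RHS](_ : g (x + 0) = _) ?addr0//.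
transitivity (mean N (fun y => (\prod_(j <- enum 'I_n) d (y 0 j)) * g (x + y))).
  by congr mean; apply/funext => y; rewrite -kerE mulr_suml.
rewrite -[X in _ = g X](addr0 x); apply: (@avg_kernel _ _ _ _ _ d (fun y => g (x + y))) => [|q|j _].
- exact: enum_uniq.
- rewrite /d.
  case: eqVneq => [->|q0].
    by under eq_bigr do rewrite mul0r !mulr0 oppr0 expi0; rewrite sumr_const card_ord.
  transitivity (expi (2 * pi * (M%:R * (q%:R / N%:R))) *
     \sum_(i < N) expi (- (2 * pi * (i%:R * (q%:R / N%:R)))) : R[i]).
    rewrite mulr_sumr; apply: eq_bigr => i _; rewrite -expiD; congr expi.
    by rewrite intrD mulrNz; ring.
  by rewrite (expi_geom q) (negPf q0) mulr0.
- by rewrite mxE.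
Qed.

End Mean.

(** * Functions with bounded mixed difference quotients *)

Local Arguments normc : simpl never.

Section DifferenceQuotients.
Context {R : realType} {n : nat}.
Implicit Types (f g : 'rV[R]_n -> R[i]) (L : seq ('I_n * R)) (C : R) (x y : 'rV[R]_n).

Definition dq (j : 'I_n) (s : R) f : 'rV[R]_n -> R[i] :=
  fun x => (s^-1)%:C * (f (x + s *: delta_mx 0 j) - f x).

(** All the iterated difference quotients of [f] along sublists of [L] are
   bounded by [C]. Difference quotients replace derivatives because they commute
   with everything in sight, and because the product and quotient rules for
   them are identities. *)
Fixpoint dq_bounded L C f : Prop :=
  if L is (j, s) :: L' then dq_bounded L' C f /\ dq_bounded L' C (dq j s f)
  else forall x, normc (f x) <= C.

Lemma dq_bounded_norm L C f : dq_bounded L C f -> forall x, normc (f x) <= C.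
Proof. by elim: L => [|[j s] L IH] //= [/IH]. Qed.

Lemma dq_bounded_ge0 L C f : dq_bounded L C f -> 0 <= C.
Proof. by move=> /dq_bounded_norm /(_ 0); apply: le_trans; apply: Defs.normc_ge0. Qed.

Lemma dq_bounded_le L C C' f : C <= C' -> dq_bounded L C f -> dq_bounded L C' f.
Proof.
move=> CC'; elim: L f => [|[j s] L IH] f /=; first by move=> fC x; apply: le_trans CC'.
by case=> /IH ? /IH ?.
Qed.

Lemma dq_bounded_in L C f j s : dq_bounded L C f -> (j, s) \in L ->
  forall x, normc (dq j s f x) <= C.
Proof.
elim: L f => [|[i t] L IH] f //= [fL fL']; rewrite inE => /orP[/eqP[-> ->]|jL].
  exact: dq_bounded_norm fL'.
exact: IH fL jL.
Qed.

Lemma dq_bounded_shift L C f y :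
  dq_bounded L C f -> dq_bounded L C (fun x => f (x + y)).
Proof.
elim: L f => [|[j s] L IH] f /=; first by move=> fC x; apply: fC.
case=> /IH fL /IH fL'; split=> //.
rewrite (_ : dq j s _ = fun x => dq j s f (x + y))//.
by apply/funext => x; rewrite /dq addrAC.
Qed.

Lemma dq_bounded_add L C C' f g : dq_bounded L C f -> dq_bounded L C' g ->
  dq_bounded L (C + C') (fun x => f x + g x).
Proof.
elim: L f g => [|[j s] L IH] f g /=.
  by move=> fC gC x; apply: le_trans (le_normcD _ _) (lerD _ _).
case=> fL fL' [gL gL']; split; first exact: IH.
rewrite (_ : dq j s _ = fun x => dq j s f x + dq j s g x); first exact: IH.
by apply/funext => x; rewrite /dq -mulrDr opprD addrACA.
Qed.

Lemma dq_bounded_opp L C f : dq_bounded L C f -> dq_bounded L C (fun x => - f x).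
Proof.
elim: L f => [|[j s] L IH] f /=; first by move=> fC x; rewrite normcN.
case=> fL fL'; split; first exact: IH.
rewrite (_ : dq j s _ = fun x => - dq j s f x); first exact: IH.
by apply/funext => x; rewrite /dq -opprD mulrN.
Qed.

Lemma dq_bounded_mul L C C' f g : dq_bounded L C f -> dq_bounded L C' g ->
  dq_bounded L (2 ^+ size L * (C * C')) (fun x => f x * g x).
Proof.
elim: L f g => [|[j s] L IH] f g /=.
  by move=> fC gC x; rewrite mul1r normcM ler_pM ?Defs.normc_ge0.
case=> fL fL' [gL gL'].
have C0 := dq_bounded_ge0 fL; have C'0 := dq_bounded_ge0 gL.
have CC0 : 0 <= 2 ^+ size L * (C * C') by rewrite !mulr_ge0// exprn_ge0.
rewrite exprS -mulrA [2 * _]mulr_natl mulr2n; split.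
  by apply: dq_bounded_le (IH _ _ fL gL); rewrite lerDl.
rewrite (_ : dq j s _ = fun x => dq j s f x * g (x + s *: delta_mx 0 j) + f x * dq j s g x).
  by apply: dq_bounded_add; apply: IH => //; apply: dq_bounded_shift.
by apply/funext => x; rewrite /dq; ring.
Qed.

(** The difference quotient of 1/f at x is minus that of f, divided by the
   values of f at the two ends of the step; so the bounds for 1/f follow from
   those for f by induction on the length of the list. *)
Lemma dq_bounded_inv (l : nat) C c : 0 < c -> exists2 K, 0 <= K &
  forall L f, size L = l -> dq_bounded L C f -> (forall x, c <= normc (f x)) ->
    dq_bounded L K (fun x => (f x)^-1).
Proof.
move=> c0; elim: l => [|l [K K0 IH]].
  exists c^-1; first by rewrite invr_ge0 ltW.
  move=> L f /size0nil -> _ fc x; rewrite normcV lef_pV2 ?posrE//.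
  exact: lt_le_trans (fc x).
exists (Num.max K (2 ^+ l * (2 ^+ l * (C * K) * K))); first by rewrite le_max K0.
case=> [|[j s] L] f //= [Ll] [fL fL'] fc; split.
  by apply: dq_bounded_le (IH _ _ Ll fL fc); rewrite le_max lexx.
have f0 x : f x != 0.
  apply/eqP => fx; have := lt_le_trans c0 (fc x).
  by rewrite fx normc0 ltxx.
rewrite (_ : dq j s _ = fun x => - dq j s f x * (f x)^-1 * (f (x + s *: delta_mx 0 j))^-1).
  apply: (@dq_bounded_le _ (2 ^+ l * (2 ^+ l * (C * K) * K))).
    by rewrite le_max lexx orbT.
  rewrite -Ll; apply: dq_bounded_mul.
    by apply: dq_bounded_mul; [apply: dq_bounded_opp|exact: IH].
  exact: (dq_bounded_shift (s *: delta_mx 0 j) (IH _ _ Ll fL fc)).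
apply/funext => x; rewrite /dq.
rewrite -[X in _ * X = _](_ : (f x - f (x + s *: delta_mx 0 j)) * (f x)^-1 * (f (x + s *: delta_mx 0 j))^-1 = _).
  by ring.
by field; rewrite !f0.
Qed.

(** Two steps in each coordinate: this is what summability of the Fourier
   coefficients takes. *)
Definition steps (js : seq 'I_n) (s : 'I_n -> R) : seq ('I_n * R) :=
  flatten [seq [:: (j, s j); (j, s j)] | j <- js].

Lemma size_steps js s : size (steps js s) = (size js).*2.
Proof. by elim: js => //= j js ->; rewrite doubleS. Qed.

Lemma mem_steps js s j : j \in js -> (j, s j) \in steps js s.
Proof.
elim: js => //= i js IH; rewrite !inE => /orP[/eqP ->|/IH ->]; rewrite ?eqxx ?orbT//.
Qed.

(** The regularity of symbols that the proof uses. It passes to reciprocals by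
   algebra, with a bound depending only on the given ones. *)
Definition tame C f : Prop := lattice_periodic f /\
  forall s : 'I_n -> R, (forall j, 0 < s j) -> dq_bounded (steps (enum 'I_n) s) C f.

Lemma tame_norm C f : tame C f -> forall x, normc (f x) <= C.
Proof. by case=> _ /(_ (fun=> 1) (fun=> ltr01)) /dq_bounded_norm. Qed.

Lemma tame_ge0 C f : tame C f -> 0 <= C.
Proof. by case=> _ /(_ (fun=> 1) (fun=> ltr01)) /dq_bounded_ge0. Qed.

Lemma tame_shift C f y : tame C f -> tame C (fun x => f (x + y)).
Proof.
case=> fp fC; split=> [x z|s s0]; first by rewrite addrAC fp.
exact: dq_bounded_shift (fC s s0).
Qed.

Lemma tame0 C : 0 <= C -> tame C (fun=> 0).
Proof.
move=> C0; split=> // s _; elim: (steps _ _) => [x|[j t] L IH] /=; first by rewrite normc0.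
split=> //; rewrite (_ : dq _ _ _ = fun=> 0)//.
by apply/funext => x; rewrite /dq subrr mulr0.
Qed.

Lemma tame_inv C c : 0 < c -> exists2 K, 0 <= K &
  forall f, tame C f -> (forall x, c <= normc (f x)) -> tame K (fun x => (f x)^-1).
Proof.
move=> c0; have [K K0 KP] := dq_bounded_inv (size (enum 'I_n)).*2 C c0.
exists K => // f [fp fC] fc; split=> [x z|s s0]; first by rewrite fp.
by apply: KP (fC s s0) fc; rewrite size_steps.
Qed.

Lemma tame_lip C f : tame C f -> lip C f.
Proof.
move=> fC x j s t; wlog ts : s t / t <= s.
  by move=> H; case: (leP t s) => [|/ltW] /H//; rewrite normc_distC distrC.
have C0 := tame_ge0 fC.
move: ts; rewrite le_eqVlt => /predU1P[->|ts].
  by rewrite subrr normc0 mulr_ge0.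
have st0 : 0 < s - t by rewrite subr_gt0.
have := dq_bounded_in (fC.2 (fun=> s - t) (fun=> st0)) (mem_steps (fun=> s - t) (mem_enum 'I_n j)) (set_coord x j t).
rewrite /dq set_coord_shift [t + _]addrC subrK normcM normc_real ger0_norm ?invr_ge0 ?(ltW st0)//.
by rewrite ler_pdivrMl// mulrC gtr0_norm.
Qed.

End DifferenceQuotients.

(** * Fourier coefficients *)

Section FourierCoefficients.
Context {R : realType} {n : nat}.
Implicit Types (f g h : 'rV[R]_n -> R[i]) (C : R) (x y : 'rV[R]_n) (m : 'rV[int]_n).

Lemma lip_echar m : lip (4 * pi * \sum_j `|(m 0 j)%:~R|) (echar m : 'rV[R]_n -> R[i]).
Proof.
move=> x j s t; apply: le_trans (expi_lip _ _) _.
have -> : 2 * pi * dotZR m (set_coord x j s) - 2 * pi * dotZR m (set_coord x j t)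
    = 2 * pi * ((m 0 j)%:~R * (s - t)).
  have -> : set_coord x j s = set_coord x j t + (s - t) *: delta_mx 0 j.
    by rewrite set_coord_shift [t + _]addrC subrK.
  by rewrite dotZRDr dotZR_delta; ring.
rewrite !normrM (ger0_norm (_ : 0 <= 2))// (ger0_norm (pi_ge0 _)).
have -> : 2 * (2 * pi * (`|(m 0 j)%:~R| * `|s - t|)) = 4 * pi * `|(m 0 j)%:~R| * `|s - t| by ring.
apply: ler_wpM2r => //; apply: ler_wpM2l; first by rewrite mulr_ge0 ?pi_ge0.
by rewrite (bigD1 j)//= lerDl sumr_ge0.
Qed.

Lemma lip_mul A B L L' f g : (forall x, normc (f x) <= A) -> (forall x, normc (g x) <= B) ->
  0 <= L -> 0 <= L' -> lip L f -> lip L' g -> lip (L * B + A * L') (fun x => f x * g x).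
Proof.
move=> fA gB L0 L'0 fL gL x j s t.
set a := f _; set b := g _; set c := f _; set d := g _.
have -> : a * b - c * d = (a - c) * b + c * (b - d) by ring.
rewrite [leRHS]mulrDl [leRHS](_ : _ = L * `|s - t| * B + A * (L' * `|s - t|)); last by ring.
apply: le_trans (le_normcD _ _) (lerD _ _); rewrite normcM.
  by apply: ler_pM; rewrite ?Defs.normc_ge0 ?gB ?fL.
by apply: ler_pM; rewrite ?Defs.normc_ge0 ?fA ?gL.
Qed.

Lemma lip_twist L B m g : 0 <= L -> (forall x, normc (g x) <= B) -> lip L g ->
  exists2 L', 0 <= L' & lip L' (fun x => echar m x * g x).
Proof.
move=> L0 gB gL.
have B0 : 0 <= B by apply: le_trans (gB 0); apply: Defs.normc_ge0.
have E0 : 0 <= 4 * pi * \sum_j `|(m 0 j)%:~R| :> R.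
  by rewrite !mulr_ge0 ?pi_ge0 ?sumr_ge0.
exists (4 * pi * (\sum_j `|(m 0 j)%:~R|) * B + 1 * L).
  by apply: addr_ge0; [exact: mulr_ge0 E0 B0|rewrite mul1r].
by apply: lip_mul => // [x|]; [rewrite normc_echar|exact: lip_echar].
Qed.

Definition fcoef g m : R[i] := torus_int (fun y => echar (- m) y * g y).

Lemma torus_int_eq L f g : 0 <= L -> lip L f -> lip L g ->
  (forall e, 0 < e -> exists N0, forall N, (N0 <= N)%N -> normc (mean N.+1 f - mean N.+1 g) <= e) ->
  torus_int f = torus_int g.
Proof.
move=> L0 fL gL fg; apply: normc_eq => e e0; have e30 : 0 < e / 3 by rewrite divr_gt0.
have [N1 H1] := torus_int_lim L0 fL e30; have [N2 H2] := torus_int_lim L0 gL e30.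
have [N3 H3] := fg _ e30; set N := maxn N1 (maxn N2 N3).
have {}H1 := H1 N (leq_maxl _ _).
have {}H2 := H2 N (leq_trans (leq_maxl _ _) (leq_maxr _ _)).
have {}H3 := H3 N (leq_trans (leq_maxr _ _) (leq_maxr _ _)).
apply: le_trans (le_normc_dist _ _ (mean N.+1 f)) _.
have := le_normc_dist (mean N.+1 f) (torus_int g) (mean N.+1 g).
by rewrite normc_distC in H2 => h; lra.
Qed.

Lemma torus_int_dist L f g e : 0 <= L -> lip L f -> lip L g ->
  (forall x, normc (f x - g x) <= e) -> normc (torus_int f - torus_int g) <= e.
Proof.
move=> L0 fL gL fg; apply/ler_addgt0Pr => e' e'0; have e20 : 0 < e' / 2 by rewrite divr_gt0.
have [N1 H1] := torus_int_lim L0 fL e20; have [N2 H2] := torus_int_lim L0 gL e20.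
set N := maxn N1 N2.
have {}H1 := H1 N (leq_maxl _ _); have {}H2 := H2 N (leq_maxr _ _).
have H3 : normc (mean N.+1 f - mean N.+1 g) <= e by rewrite -meanB; apply: le_normc_mean.
apply: le_trans (le_normc_dist _ _ (mean N.+1 f)) _.
have := le_normc_dist (mean N.+1 f) (torus_int g) (mean N.+1 g).
by rewrite normc_distC in H2 => h; lra.
Qed.

Lemma torus_int_norm L f e : 0 <= L -> lip L f ->
  (forall x, normc (f x) <= e) -> normc (torus_int f) <= e.
Proof.
move=> L0 fL fe; apply/ler_addgt0Pr => e' e'0.
have [N1 /(_ N1 (leqnn _)) H1] := torus_int_lim L0 fL e'0.
have := le_normc_mean N1 fe; have := le_normcD (torus_int f - mean N1.+1 f) (mean N1.+1 f).
by rewrite subrK => h1 h2; lra.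
Qed.

(** Moving by s along the j-th axis multiplies the m-th coefficient by
   expi (2 pi m_j s); on the grid this holds for steps in the grid. *)
Lemma mean_dq (N : nat) m g j (r : nat) : lattice_periodic g ->
  mean N.+1 (fun y => echar (- m) y * dq j (r%:R / N.+1%:R) g y) =
  ((r%:R / N.+1%:R)^-1)%:C * (expi (2 * pi * ((m 0 j)%:~R * (r%:R / N.+1%:R))) - 1) *
    mean N.+1 (fun y => echar (- m) y * g y).
Proof.
move=> gp; set s := r%:R / N.+1%:R; set w := expi _.
pose h y := echar (- m) y * g y.
have hp : lattice_periodic h by move=> y z; rewrite /h echar_periodic gp.
have wE : w * echar (- m) (s *: delta_mx 0 j) = 1.
  by rewrite /w /echar dotZR_delta mxE mulrNz mulNr mulrN expiNr.
have -> : (fun y => echar (- m) y * dq j s g y) =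
    (fun y => (s^-1)%:C * (w * h (y + s *: delta_mx 0 j) - h y)).
  apply/funext => y; rewrite /h /dq echarDr; set G := g (_ + _).
  rewrite (_ : w * _ = w * echar (- m) (s *: delta_mx 0 j) * (echar (- m) y * G)); last by ring.
  by rewrite wE; ring.
rewrite meanZ meanB meanZ (mean_shift _ _ _ hp) -/h; ring.
Qed.

Lemma dq_periodic j s g : lattice_periodic g -> lattice_periodic (dq j s g).
Proof. by move=> gp y z; rewrite /dq addrAC !gp. Qed.

(** Summation by parts on the grid. In a coordinate with m_j <> 0 the grid step s
   is chosen with 1/4 <= |m_j| s <= 1/2, so that the factor expi (2 pi m_j s) - 1
   is bounded below; two difference quotients then gain s^2, which is of the
   order of 1/m_j^2. *)
Lemma mean_decay (M : nat) m g C js : m \in box M -> uniq js -> lattice_periodic g ->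
  (forall s : 'I_n -> R, (forall j, 0 < s j) -> dq_bounded (steps js s) C g) ->
  normc (mean M.*2.+1 (fun y => echar (- m) y * g y)) <= C * \prod_(j <- js) decay1 (m 0 j).
Proof.
move=> mM; set N := M.*2; elim: js g C => [|j js IH] g C /= + gp gC.
  move=> _; rewrite big_nil mulr1; apply: le_normc_mean => y.
  by rewrite normcM normc_echar mul1r; apply: (gC (fun=> 1)).
move=> /andP[jjs ujs].
rewrite big_cons [decay1 (m 0 j)]/decay1; case: eqVneq => [mj0|mj0].
  by rewrite mul1r; apply: IH => // s /gC [[]].
pose a := `|m 0%R j|%N; have a0 : (0 < a)%N by rewrite absz_gt0.
have aM : (a <= M)%N by move/boxP: mM; apply.
pose r := (N.+1 %/ a.*2)%N.
have r0 : (0 < r)%N by rewrite divn_gt0 ?double_gt0// /N; lia.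
have r_up : (r * a.*2 <= N.+1)%N by apply: leq_trunc_div.
have r_lo : (N.+1 < r.+1 * a.*2)%N by apply: ltn_ceil; rewrite double_gt0.
pose s : R := r%:R / N.+1%:R.
have s0 : 0 < s by rewrite divr_gt0 ?ltr0n.
have amE : `|(m 0 j)%:~R| = a%:R :> R by rewrite -intr_norm -abszE.
have as_up : a%:R * s * 2 <= 1.
  rewrite /s !mulrA mulrAC ler_pdivrMr ?ltr0n// mul1r -!natrM ler_nat.
  by rewrite (leq_trans _ r_up)// -muln2; lia.
have as_lo : 1 <= a%:R * s * 4.
  rewrite /s !mulrA mulrAC ler_pdivlMr ?ltr0n// mul1r -!natrM ler_nat.
  rewrite (leq_trans (ltnW r_lo))// -muln2; nia.
have far : 2 <= normc (expi (2 * pi * ((m 0 j)%:~R * s)) - 1) ^+ 2.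
  apply: expi_far; move: s0 as_up as_lo; move: s => u u0 as_up as_lo.
  rewrite !normrM amE (ger0_norm (pi_ge0 _)) (ger0_norm (ltW u0)) (ger0_norm (_ : 0 <= 2))//.
  have p0 : 0 < pi :> R := pi_gt0 _; move: as_up as_lo; move: (a%:R * u) => v ? ?.
  by apply/andP; split; nra.
have := IH (dq j s (dq j s g)) C; rewrite !mean_dq//; last first.
  exact: dq_periodic.
set F := mean _ _; set w := expi _ - 1 in far *.
rewrite !normcM normc_real ger0_norm ?invr_ge0 ?(ltW s0)//.
set P := \prod_(_ <- _) _ => IHF.
have {}IHF : s^-1 * normc w * (s^-1 * normc w * normc F) <= C * P.
  apply: IHF => [//||t t0]; first by do 2 apply: dq_periodic.
  pose t' i := if i == j then s else t i.
  have -> : steps js t = steps js t'.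
    congr flatten; apply/eq_in_map => i ijs; rewrite /t'.
    by case: eqVneq => // ij; rewrite -ij ijs in jjs.
  have t'j : t' j = s by rewrite /t' eqxx.
  have /gC : forall i, 0 < t' i by move=> i; rewrite /t'; case: eqP.
  by rewrite t'j => -[_ []].
have P0 : 0 <= P by apply: prodr_ge0 => i _; apply/ltW/decay1_gt0.
rewrite mulrCA; set q : R := (m 0 j)%:~R; rewrite -/q in amE.
have q2 : q ^+ 2 = a%:R ^+ 2 by rewrite -amE real_normK ?num_real.
rewrite q2 ler_pdivlMl ?exprn_gt0 ?ltr0n//.
apply: le_trans IHF.
have -> : s^-1 * normc w * (s^-1 * normc w * normc F) = (s^-1) ^+ 2 * normc w ^+ 2 * normc F by ring.
apply: ler_wpM2r; first exact: Defs.normc_ge0.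
have sa : a%:R <= s^-1 :> R.
  rewrite -[s^-1]mul1r ler_pdivlMr//; have : 0 < a%:R * s by rewrite mulr_gt0 ?ltr0n.
  by lra.
have sa2 : a%:R ^+ 2 <= s^-1 ^+ 2 by rewrite ler_pXn2r ?nnegrE ?invr_ge0 ?(ltW s0).
have : 0 <= a%:R ^+ 2 :> R by rewrite sqr_ge0.
by nra.
Qed.

Lemma mean_translate (N : nat) L h : 0 <= L -> lip L h -> lattice_periodic h ->
  forall j t, normc (mean N.+1 (fun x => h (x + t *: delta_mx 0 j)) - mean N.+1 h) <= L / N.+1%:R.
Proof.
move=> L0 hL hp j t.
have hpj (p : nat) x : h (x + p%:R *: delta_mx 0 j) = h x.
  rewrite -[RHS](hp x (p%:Z *: delta_mx 0 j)); congr (h (_ + _)).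
  by apply/matrixP => a b; rewrite !mxE intrM; case: (_ && _); rewrite ?mulr0.
pose p := (Num.truncn `|t|).+1; have tp0 : 0 <= t + p%:R.
  have : `|t| < p%:R by apply: truncnS_gt.
  by rewrite ltr_norml => /andP[]; lra.
pose r := Num.truncn ((t + p%:R) * N.+1%:R).
have N0 : 0 < N.+1%:R :> R by rewrite ltr0n.
have /andP[r1 r2] : r%:R <= (t + p%:R) * N.+1%:R < r.+1%:R.
  by apply: truncn_itv; rewrite mulr_ge0.
rewrite -(mean_shift N j r hp) -meanB; apply: le_normc_mean => x.
rewrite -(hpj p (x + _)) -addrA -scalerDl.
have xE u : x + u *: delta_mx 0 j = set_coord x j (x 0 j + u).
  by rewrite -set_coord_shift set_coord_id.
rewrite !xE.
apply: le_trans (hL _ _ _ _) _; apply: ler_wpM2l => //.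
rewrite opprD addrACA subrr add0r ger0_norm; last by rewrite subr_ge0 ler_pdivrMr.
rewrite lerBlDl -[X in _ <= _ + X]mul1r -mulrDl ler_pdivlMr// natr1; exact: ltW.
Qed.

Lemma lip_shift L g x : lip L g -> lip L (fun y => g (y + x)).
Proof.
move=> gL y j s t; have E u : set_coord y j u + x = set_coord (y + x) j (u + x 0 j).
  by rewrite !set_coordE mxE addrAC opprD addrACA subrr addr0.
by rewrite !E; apply: le_trans (gL _ _ _ _) _; rewrite opprD addrACA subrr addr0.
Qed.

Lemma torus_int_translate L h x : 0 <= L -> lip L h -> lattice_periodic h ->
  torus_int (fun y => h (y + x)) = torus_int h.
Proof.
move=> L0 hL hp.
have step (g : 'rV[R]_n -> R[i]) j t : lip L g -> lattice_periodic g ->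
    torus_int (fun y => g (y + t *: delta_mx 0 j)) = torus_int g.
  move=> gL gp; apply: (torus_int_eq L0) => //; first exact: lip_shift.
  move=> e e0; exists (Num.truncn (L / e)) => N LN.
  apply: le_trans (mean_translate _ L0 gL gp _ _) _.
  rewrite ler_pdivrMr ?ltr0n// -ler_pdivrMl// mulrC.
  by apply/ltW/(lt_le_trans (truncnS_gt _)); rewrite ler_nat.
rewrite (_ : x = \sum_(j <- enum 'I_n) x 0 j *: delta_mx 0 j); last first.
  by rewrite big_enum/= [LHS]row_sum_delta.
elim: (enum 'I_n) => [|j js IH].
  by congr torus_int; apply/funext => y; rewrite big_nil addr0.
rewrite -IH -(step (fun y => h (y + \sum_(i <- js) x 0 i *: delta_mx 0 i)) j (x 0 j)).
- by congr torus_int; apply/funext => y; rewrite big_cons addrA.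
- exact: lip_shift.
- by move=> y z; rewrite addrAC hp.
Qed.

Lemma eventually_all (I : eqType) (A : seq I) (P : I -> nat -> Prop) :
  (forall i, i \in A -> exists N0, forall N, (N0 <= N)%N -> P i N) ->
  exists N0, forall N, (N0 <= N)%N -> forall i, i \in A -> P i N.
Proof.
elim: A => [|i A IH] AP; first by exists 0%N.
have [N1 H1] := AP i (mem_head _ _).
have [N2 H2] : exists N0, forall N, (N0 <= N)%N -> forall j, j \in A -> P j N.
  by apply: IH => j jA; apply: AP; rewrite inE jA orbT.
exists (maxn N1 N2) => N; rewrite geq_max => /andP[N1N N2N] j.
by rewrite inE => /predU1P[->|jA]; [exact: H1|exact: H2].
Qed.

Lemma tame_twist C g m : tame C g -> exists2 L, 0 <= L & lip L (fun y => echar m y * g y).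
Proof.
by move=> gC; apply: lip_twist (tame_ge0 gC) (tame_norm gC) (tame_lip gC).
Qed.

Lemma fcoef_decay C g m : tame C g -> normc (fcoef g m) <= C * decay R m.
Proof.
move=> gC; have [L L0 gL] := tame_twist (- m) gC.
apply/ler_addgt0Pr => e e0; have [N0 H] := torus_int_lim L0 gL e0.
have [M0 mM0] := in_some_box m; pose M := maxn N0 M0.
have mM : m \in box M by apply: fsubsetP mM0; apply: box_le; rewrite leq_maxr.
have {}H : normc (fcoef g m - mean M.*2.+1 (fun y => echar (- m) y * g y)) <= e.
  by apply: H; rewrite -muln2 /M; lia.
have := mean_decay mM (enum_uniq 'I_n) gC.1 gC.2; rewrite big_enum/= -/(decay R m) => H2.
have := le_normcD (fcoef g m - mean M.*2.+1 (fun y => echar (- m) y * g y))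
  (mean M.*2.+1 (fun y => echar (- m) y * g y)).
by rewrite subrK => H3; lra.
Qed.

Lemma fcoef_translate C g m x : tame C g ->
  torus_int (fun y => echar (- m) y * g (x + y)) = echar m x * fcoef g m.
Proof.
move=> gC; have [L L0 gL] := tame_twist (- m) gC.
have hp : lattice_periodic (fun y => echar (- m) y * g y).
  by move=> y z; rewrite echar_periodic gC.1.
have [L' L'0 hL] := tame_twist (- m) (tame_shift x gC).
rewrite /fcoef -(torus_int_translate x L0 gL hp).
have shL := lip_shift x gL.
apply: normc_eq => d d0; have d20 : 0 < d / 2 by rewrite divr_gt0.
have [N2 H2] := torus_int_lim L0 shL d20.
have [N3 H3] := torus_int_lim L'0 hL d20.
pose N := maxn N2 N3.
have {}H2 := H2 N (leq_maxl _ _); have {}H3 := H3 N (leq_maxr _ _).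
have E : mean N.+1 (fun y => echar (- m) y * g (y + x)) =
   echar m x * mean N.+1 (fun y => echar (- m) (y + x) * g (y + x)).
  rewrite -meanZ; congr mean; apply/funext => y.
  have := echarNl m x; rewrite echarDr => ex.
  by rewrite [RHS](_ : _ = (echar (- m) x * echar m x) * (echar (- m) y * g (y + x))); [rewrite ex mul1r|ring].
have E2 : (fun y => echar (- m) y * g (x + y)) = (fun y => echar (- m) y * g (y + x)).
  by apply/funext => y; rewrite addrC.
rewrite E2; apply: le_trans (le_normc_dist _ _ (mean N.+1 (fun y => echar (- m) y * g (y + x)))) _.
rewrite {2}E -mulrBr normcM normc_echar mul1r [X in _ + X]normc_distC.
by lra.
Qed.

(** Fourier inversion with an explicit error: the discrete inversion formula
   holds at every scale, its terms converge to those of the Fourier series, and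
   they are dominated by the weight uniformly in the scale. *)
Lemma fourier_inversion C g D x : tame C g ->
  normc (g x - \sum_(m <- box D) fcoef g m * echar m x) <= C * tail R n D.
Proof.
move=> gC; apply/ler_addgt0Pr => e e0.
pose gx y := g (x + y).
have gxC : tame C gx.
  by have := tame_shift x gC; rewrite (_ : (fun y => g (y + x)) = gx)//; apply/funext => y; rewrite /gx addrC.
pose a M m := mean M.*2.+1 (fun y => echar (- m) y * gx y).
pose d := e / (#|` @box n D|).+1%:R.
have d0 : 0 < d by rewrite divr_gt0.
have [N0 H] : exists N0, forall N, (N0 <= N)%N -> forall m, m \in enum_fset (box D) ->
    normc (echar m x * fcoef g m - a N m) <= d.
  apply: eventually_all => m _; rewrite -(fcoef_translate _ _ gC).
  have [L L0 hL] := tame_twist (- m) gxC.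
  have [N0 HN] := torus_int_lim L0 hL d0.
  by exists N0 => N N0N; apply: HN; rewrite -muln2; lia.
pose M := maxn N0 D; have {}H := H M (leq_maxl _ _).
have DM : (box D `<=` @box n M)%fset by apply: box_le; rewrite leq_maxr.
rewrite -[g x](mean_inversion M) (big_fsetID _ (mem (box D)) (box M))/=.
have -> : [fset m in @box n M | m \in @box n D]%fset = box D.
  by apply/fsetP => m; rewrite !inE/= andb_idl// => /(fsubsetP DM).
rewrite addrAC -sumrB addrC; apply: le_trans (le_normcD _ _) _; apply: lerD.
  apply: le_trans (le_normc_sum _ _ _) _.
  apply: (@le_trans _ _ (\sum_(m <- [fset m in box M | m \notin box D]%fset) C * decay R m)).
    apply: ler_sum_seq => m; rewrite !inE/= => /andP[mM _].
    apply: le_trans (mean_decay mM (enum_uniq 'I_n) gxC.1 gxC.2) _.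
    by rewrite big_enum.
  rewrite -mulr_sumr; apply: ler_wpM2l; first exact: tame_ge0 gC.
  apply: sum_decay_tail; apply/fdisjointP => m; rewrite !inE/= => /andP[_].
  by [].
apply: le_trans (le_normc_sum _ _ _) _.
apply: (@le_trans _ _ (\sum_(m <- box D) d)).
  apply: ler_sum_seq => m mD; rewrite normc_distC [_ * echar m x]mulrC.
  exact: H.
rewrite big_const_seq count_predT iter_addr_0 -mulr_natr /d mulrAC ler_pdivrMr ?ltr0n//.
by apply: ler_wpM2l; [exact: ltW|rewrite ler_nat leqnSn].
Qed.

End FourierCoefficients.

(** * From derivative bounds to difference quotient bounds *)

Section Smooth.
Context {R : realType} {n : nat}.
Implicit Types (g h : 'rV[R]_n -> R[i]) (j : 'I_n) (x y : 'rV[R]_n) (C B : R).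

(** What the mean value theorem along the coordinate lines takes, in a form stable
   under linear combinations, translations and partial derivatives. *)
Record derivables g : Prop := Derivables {
  derivablesP : forall (s : seq 'I_n) j x,
    derivable (fun y => complex.Re (foldr pd g s y)) x (delta_mx 0 j) /\
    derivable (fun y => complex.Im (foldr pd g s y)) x (delta_mx 0 j) }.

Lemma smooth_derivables g : smooth g -> derivables g.
Proof. by move=> gs; split=> s j x; have [_ _] := gs s; apply. Qed.

Lemma derivables_pd g j : derivables g -> derivables (pd j g).
Proof. by move=> gs; split=> s; have := derivablesP gs (rcons s j); rewrite foldr_rcons. Qed.

Lemma Re_lin_fun g h (a b : R) : (fun y => complex.Re ((a +i* b) * g y + h y)) =
  a *: (fun y => complex.Re (g y)) + (- b) *: (fun y => complex.Im (g y))
  + (fun y => complex.Re (h y)).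
Proof.
apply/funext => y; transitivity (a * complex.Re (g y) + - b * complex.Im (g y) + complex.Re (h y)) => //.
by case: (g y) (h y) => ? ? [] ? ? /=; rewrite mulNr.
Qed.

Lemma Im_lin_fun g h (a b : R) : (fun y => complex.Im ((a +i* b) * g y + h y)) =
  a *: (fun y => complex.Im (g y)) + b *: (fun y => complex.Re (g y))
  + (fun y => complex.Im (h y)).
Proof.
apply/funext => y; transitivity (a * complex.Im (g y) + b * complex.Re (g y) + complex.Im (h y)) => //.
by case: (g y) (h y) => ? ? [].
Qed.

Lemma is_derive_lin (f1 f2 f3 : 'rV[R]_n -> R) (a b : R) x v :
  derivable f1 x v -> derivable f2 x v -> derivable f3 x v ->
  is_derive x v (a *: f1 + b *: f2 + f3) (a * 'D_v f1 x + b * 'D_v f2 x + 'D_v f3 x).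
Proof.
move=> /derivableP d1 /derivableP d2 /derivableP d3.
exact: (is_deriveD (is_deriveD (is_deriveZ a d1) (is_deriveZ b d2)) d3).
Qed.

Lemma pd_lin g h j (c : R[i]) : derivables g -> derivables h ->
  pd j (fun y => c * g y + h y) = fun y => c * pd j g y + pd j h y.
Proof.
move=> gs hs; apply/funext => x.
have [gR gI] := derivablesP gs [::] j x; have [hR hI] := derivablesP hs [::] j x.
case: c => a b; rewrite /pd Re_lin_fun Im_lin_fun.
rewrite (@derive_val _ _ _ _ _ _ _ (is_derive_lin a (- b) gR gI hR)).
rewrite (@derive_val _ _ _ _ _ _ _ (is_derive_lin a b gI gR hI)).
by apply/eqP; rewrite eq_complex/= mulNr !eqxx.
Qed.

Lemma derivables_lin g h (c : R[i]) : derivables g -> derivables h ->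
  derivables (fun y => c * g y + h y).
Proof.
move=> gs hs; split=> s j x.
have -> : foldr pd (fun y => c * g y + h y) s = fun y => c * foldr pd g s y + foldr pd h s y.
  have sm (f : 'rV[R]_n -> R[i]) r : derivables f -> derivables (foldr pd f r).
    by move=> fs; elim: r => [|i r IH]; [exact: fs|exact: derivables_pd IH].
  by elim: s => //= i s ->; rewrite pd_lin//; apply: sm.
have [gR gI] := derivablesP gs s j x; have [hR hI] := derivablesP hs s j x; case: c => a b.
rewrite Re_lin_fun Im_lin_fun; split.
  exact: (@ex_derive _ _ _ _ _ _ _ (is_derive_lin a (- b) gR gI hR)).
exact: (@ex_derive _ _ _ _ _ _ _ (is_derive_lin a b gI gR hI)).
Qed.

Lemma pd_shift g j y : pd j (fun x => g (x + y)) = fun x => pd j g (x + y).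
Proof.
have dE (f : 'rV[R]_n -> R) x : 'D_(delta_mx 0 j) (fun x => f (x + y)) x = 'D_(delta_mx 0 j) f (x + y).
  have E : (fun h : R => h^-1 *: (((fun x => f (x + y)) \o shift x) (h *: delta_mx 0 j) - f (x + y))) =
      (fun h : R => h^-1 *: ((f \o shift (x + y)) (h *: delta_mx 0 j) - f (x + y))).
    by apply/funext => t /=; rewrite addrA.
  by rewrite /derive E.
by apply/funext => x; rewrite /pd !(dE (fun z => _ (g z))).
Qed.

Lemma derivables_shift g y : derivables g -> derivables (fun x => g (x + y)).
Proof.
move=> gs; split=> s j x.
have -> : foldr pd (fun x => g (x + y)) s = fun x => foldr pd g s (x + y).
  by elim: s => //= i s ->; rewrite pd_shift.
have dsh (f : 'rV[R]_n -> R) : derivable f (x + y) (delta_mx 0 j) ->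
    derivable (fun x => f (x + y)) x (delta_mx 0 j).
  rewrite /derivable/= => H; rewrite (_ : (fun h : R => _) =
    (fun h : R => h^-1 *: (f (h *: delta_mx 0 j + (x + y)) - f (x + y))))//.
  by apply/funext => t; rewrite addrA.
by have [dR dI] := derivablesP gs s j (x + y); split; [exact: (dsh (fun z => complex.Re _))|exact: (dsh (fun z => complex.Im _))].
Qed.

Lemma dq_lin g j s : dq j s g = fun x => (s^-1)%:C * g (x + s *: delta_mx 0 j) + (- (s^-1)%:C * g x + 0).
Proof. by apply/funext => x; rewrite /dq addr0 mulNr mulrBr. Qed.

Lemma pd0 j : pd j (fun=> 0) = (fun=> 0 : R[i]) :> ('rV[R]_n -> R[i]).
Proof. by apply/funext => x; rewrite /pd/= !derive_cst. Qed.

Lemma derivables0 : derivables (fun=> 0).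
Proof.
split=> s j x; have -> : foldr pd (fun=> 0) s = (fun=> 0 : R[i]) :> ('rV[R]_n -> R[i]).
  by elim: s => //= i s ->; rewrite pd0.
by split; exact: derivable_cst.
Qed.

Lemma derivables_dq g j s : derivables g -> derivables (dq j s g).
Proof.
move=> gs; rewrite dq_lin; apply: derivables_lin; first exact: derivables_shift.
by apply: derivables_lin => //; exact: derivables0.
Qed.

Lemma pd_dq g i j s : derivables g -> pd i (dq j s g) = dq j s (pd i g).
Proof.
move=> gs; rewrite !dq_lin pd_lin; [|exact: derivables_shift|]; last first.
  by apply: derivables_lin => //; exact: derivables0.
rewrite pd_shift pd_lin//; last exact: derivables0.
by rewrite pd0.
Qed.

Lemma D1_lin g j l : D1 j l.+1 g = fun x =>
  (2 * pi *i)^-1 * pd j (D1 j l g) x + (- l%:R * D1 j l g x + 0).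
Proof. by apply/funext => x /=; rewrite addr0 mulNr. Qed.

Lemma derivables_D1 g j l : derivables g -> derivables (D1 j l g).
Proof.
move=> gs; elim: l => [//|l IH]; rewrite D1_lin.
apply: derivables_lin; first exact: derivables_pd.
by apply: derivables_lin => //; exact: derivables0.
Qed.

Lemma D1_dq g i j s l : derivables g -> D1 i l (dq j s g) = dq j s (D1 i l g).
Proof.
move=> gs; elim: l => [//|l /= ->].
rewrite pd_dq; last exact: derivables_D1.
by apply/funext => x; rewrite /dq; ring.
Qed.

Lemma is_derive_line (f : 'rV[R]_n -> R) x v (t : R) : derivable f (x + t *: v) v ->
  is_derive t 1 (fun u => f (x + u *: v)) ('D_v f (x + t *: v)).
Proof.
have E : (fun h : R => h^-1 *: (((fun u => f (x + u *: v)) \o shift t) (h *: (1 : R)) - f (x + t *: v))) =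
   (fun h : R => h^-1 *: ((f \o shift (x + t *: v)) (h *: v) - f (x + t *: v))).
  apply/funext => h /=; congr (_ *: (f _ - _)).
  by rewrite [h *: (1 : R)]mulr1 scalerDl addrCA.
move=> fd; apply: DeriveDef; first by rewrite /derivable E.
by rewrite /derive E.
Qed.

Lemma dq_le_pd g j s B : derivables g -> 0 < s -> (forall x, normc (pd j g x) <= B) ->
  forall x, normc (dq j s g x) <= 2 * B.
Proof.
move=> gs s0 gB x; rewrite /dq normcM normc_real ger0_norm ?invr_ge0 ?(ltW s0)//.
rewrite ler_pdivrMl//.
have lipB (p : R[i] -> R) : (forall y, derivable (fun z => p (g z)) y (delta_mx 0 j)) ->
    (forall y, `|'D_(delta_mx 0 j) (fun z => p (g z)) y| <= B) ->
    `|p (g (x + s *: delta_mx 0 j)) - p (g x)| <= B * s.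
  move=> pd pB.
  have := @lip_of_deriv R (fun u => p (g (x + u *: delta_mx 0 j)))
    (fun u => 'D_(delta_mx 0 j) (fun z => p (g z)) (x + u *: delta_mx 0 j)) B
    (fun t => is_derive_line (pd _)) (fun t => pB _) s 0.
  by rewrite scale0r addr0 subr0 (ger0_norm (ltW s0)).
apply: le_trans (normc_ReIm _) _; rewrite !raddfB/=.
rewrite (_ : s * (2 * B) = B * s + B * s); last by ring.
apply: lerD; apply: lipB => y; do ?[by have [] := derivablesP gs [::] j y].
  exact: le_trans (normc_Re (pd j g y)) (gB y).
exact: le_trans (normc_Im (pd j g y)) (gB y).
Qed.

(* The factors are 2 for each of the two difference quotients, whose real and
   imaginary parts are bounded separately, (2 pi)^2 for the normalization of the
   derivatives, and 2 for the lower order term. *)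
Definition dq_const : R := 32 * pi ^+ 2.

Lemma normc_2pii : normc (2 * pi *i : R[i]) = 2 * pi.
Proof.
rewrite normcM -[2 : R[i]](rmorph_nat (real_complex R) 2) normc_real ger0_norm//.
by congr (_ * _); rewrite /normc expr0n add0r sqrtr_sqr ger0_norm ?pi_ge0.
Qed.

(** The operators of order at most 2 in one variable control the first and the
   second derivative, hence the difference quotients of these orders. *)
Lemma dq_le_D1 g j s C : derivables g -> 0 < s ->
  (forall l, (l <= 2)%N -> forall x, normc (D1 j l g x) <= C) ->
  [/\ forall x, normc (g x) <= dq_const * C, forall x, normc (dq j s g x) <= dq_const * C &
      forall x, normc (dq j s (dq j s g) x) <= dq_const * C].
Proof.
move=> gs s0 gC; have C0 : 0 <= C by apply: le_trans (gC 0%N isT 0); apply: Defs.normc_ge0.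
have p2 : 2 <= pi :> R := pi_ge2 _.
have w0 : 2 * pi *i != 0 :> R[i].
  apply/eqP => /(congr1 (@normc R)); rewrite normc_2pii normc0 => H; nra.
have pd1 (f : 'rV[R]_n -> R[i]) l x : pd j (D1 j l f) x = 2 * pi *i * (D1 j l.+1 f x + l%:R * D1 j l f x).
  by rewrite /= subrK mulrA mulfV// mul1r.
have pdB x : normc (pd j g x) <= 2 * pi * C.
  rewrite (pd1 g 0%N) mul0r addr0 normcM normc_2pii.
  by apply: ler_wpM2l; [rewrite mulr_ge0 ?pi_ge0|apply: gC].
have pd2B x : normc (pd j (pd j g) x) <= 2 * pi * (2 * pi * (2 * C)).
  have -> : pd j g = fun y => (2 * pi *i) * D1 j 1 g y + 0.
    by apply/funext => y; rewrite (pd1 g 0%N) mul0r !addr0.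
  rewrite pd_lin; [|exact: derivables_D1|exact: derivables0].
  rewrite pd0 addr0 normcM normc_2pii; apply: ler_wpM2l; first by rewrite mulr_ge0 ?pi_ge0.
  rewrite pd1 normcM normc_2pii; apply: ler_wpM2l; first by rewrite mulr_ge0 ?pi_ge0.
  rewrite mul1r mulr_natl mulr2n; apply: le_trans (le_normcD _ _) (lerD _ _); exact: gC.
have piq : pi <= pi ^+ 2 :> R by nra.
have Cq : C <= pi ^+ 2 * C by nra.
have pCq : pi * C <= pi ^+ 2 * C by nra.
rewrite /dq_const; split=> x.
- by apply: le_trans (gC 0%N isT x) _; nra.
- by apply: le_trans (dq_le_pd gs s0 pdB x) _; nra.
apply: le_trans (dq_le_pd (derivables_dq j s gs) s0 (_ : forall y, _ <= 2 * (2 * pi * (2 * pi * (2 * C)))) x) _.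
  by move=> y; rewrite pd_dq//; apply: dq_le_pd => //; exact: derivables_pd.
rewrite le_eqVlt; apply/orP; left; apply/eqP; ring.
Qed.

Lemma dq_bounded_D1 js g C : uniq js -> derivables g ->
  (forall beta : 'I_n -> nat, (forall j, (beta j <= 2)%N) ->
     forall x, normc (foldr (fun j h => D1 j (beta j) h) g js x) <= C) ->
  forall s : 'I_n -> R, (forall j, 0 < s j) ->
    dq_bounded (steps js s) (dq_const ^+ size js * C) g.
Proof.
move=> + + + s s0; elim: js g C => [|j js IH] g C /=.
  by move=> _ _ gC x; rewrite mul1r; apply: (gC (fun=> 0%N)).
move=> /andP[jjs ujs] gs gC; rewrite exprSr -mulrA.
have sG beta : derivables (foldr (fun j h => D1 j (beta j) h) g js).
  by elim: (js) => [|i r IHr]; [exact: gs|exact: derivables_D1 IHr].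
have dqG beta (f : 'rV[R]_n -> R[i]) : derivables f ->
    foldr (fun j h => D1 j (beta j) h) (dq j (s j) f) js =
    dq j (s j) (foldr (fun j h => D1 j (beta j) h) f js).
  move=> fs; elim: (js) => //= i r ->; rewrite D1_dq//.
  by elim: (r) => [|a r' IHr]; [exact: fs|exact: derivables_D1 IHr].
have bd beta : (forall j, (beta j <= 2)%N) -> 
   [/\ forall x, normc (foldr (fun j h => D1 j (beta j) h) g js x) <= dq_const * C,
    forall x, normc (dq j (s j) (foldr (fun j h => D1 j (beta j) h) g js) x) <= dq_const * C &
    forall x, normc (dq j (s j) (dq j (s j) (foldr (fun j h => D1 j (beta j) h) g js)) x) <= dq_const * C].
  move=> beta2; apply: dq_le_D1 => // l l2 x.
  have := gC (fun i => if i == j then l else beta i) _ x; rewrite eqxx.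
  rewrite (_ : foldr _ _ _ = foldr (fun j h => D1 j (beta j) h) g js); last first.
    elim: (js) jjs => //= i r IHr; rewrite inE negb_or => /andP[ji jr].
    by rewrite IHr// eq_sym (negPf ji).
  by apply=> i; case: ifP.
have H0 : dq_bounded (steps js s) (dq_const ^+ size js * (dq_const * C)) g.
  by apply: IH => // beta /bd[].
have H1 : dq_bounded (steps js s) (dq_const ^+ size js * (dq_const * C)) (dq j (s j) g).
  by apply: IH => // [|beta /bd[]]; [exact: derivables_dq|rewrite dqG].
have H2 : dq_bounded (steps js s) (dq_const ^+ size js * (dq_const * C)) (dq j (s j) (dq j (s j) g)).
  apply: IH => // [|beta /bd[]]; first by do 2 apply: derivables_dq.
  by rewrite dqG ?dqG//; exact: derivables_dq.
by [].
Qed.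

(** The derivatives of order at most 2 in each variable involve finitely many of the
   constants in the symbol estimates, so they have a common bound; the weight
   disappears as the order of the class is 0. *)
Lemma S_class_tame (Lambda : 'rV[int]_n -> R) (rho : R) sigma :
  S_class Lambda rho 0 sigma -> (forall k, 0 < Lambda k) ->
  exists2 C, 0 <= C & forall k, tame C (sigma k).
Proof.
move=> [sm bd] L0.
have [Cb CbP] : exists Cb, forall beta : {ffun 'I_n -> 'I_3}, forall k x,
    normc (Dx (fun j => beta j : nat) (sigma k) x) <= Cb.
  have /boolp.choice[c cP] : forall beta : {ffun 'I_n -> 'I_3}, exists C, forall k x,
      normc (Dx (fun j => beta j : nat) (sigma k) x) <= C.
    move=> beta; have [C C0 H] := bd (fun=> 0%N) (fun j => beta j : nat).
    exists C => k x; have := H k x.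
    have -> : (fun y => Delta (fun=> 0%N) (fun l => sigma l y) k) = sigma k.
      by apply/funext => y; rewrite /Delta; elim: (enum _).
    by rewrite /mi_abs big1// mulr0 subr0 powRr0 mulr1.
  exists (\sum_beta `|c beta|) => beta k x; apply: le_trans (cP beta k x) _.
  apply: le_trans (ler_norm _) _; rewrite (bigD1 beta)//= lerDl sumr_ge0//.
have Cb0 : 0 <= Cb.
  by apply: le_trans (CbP [ffun=> ord0] 0 0); apply: Defs.normc_ge0.
exists (dq_const ^+ size (enum 'I_n) * Cb).
  by rewrite mulr_ge0// exprn_ge0// /dq_const mulr_ge0 ?sqr_ge0.
move=> k; split; first exact: (sm k).1.
move=> s s0; apply: dq_bounded_D1 => //; [exact: enum_uniq|exact/smooth_derivables/(sm k).2|].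
move=> beta beta2 x; have := CbP [ffun j => Ordinal (beta2 j : (beta j < 3)%N)] k x.
rewrite /Dx (_ : foldr _ _ _ = foldr (fun j h => D1 j (beta j) h) (sigma k) (enum 'I_n))//.
by congr foldr; apply/funext => j; rewrite ffunE.
Qed.

End Smooth.

(** * Operators on the space of square summable families *)

Section Ell2Norm.
Context {R : realType} {I : choiceType}.
Local Notation H := (ell2 R I).
Implicit Types (u v w : H) (e : R).

Lemma ell2_ext u v : (forall i, u i = v i) -> u = v.
Proof. by move=> uv; apply/val_inj/funext. Qed.

Lemma coordD u v i : (u + v : H) i = u i + v i. Proof. by []. Qed.
Lemma coordN u i : (- u : H) i = - u i. Proof. by []. Qed.
Lemma coordZ (c : R[i]) u i : (c *: u : H) i = c * u i. Proof. by []. Qed.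
Definition coordE := (coordD, coordN, coordZ).

Lemma nm_ge0 u : 0 <= ell2_norm u.
Proof. exact: sqrtr_ge0. Qed.

Lemma nmD u v : ell2_norm (u + v : H) <= ell2_norm u + ell2_norm v.
Proof. exact: (ell2_normD (ell2P u) (ell2P v)).2. Qed.

Lemma nmZ (c : R[i]) u : ell2_norm (c *: u : H) = normc c * ell2_norm u.
Proof. by have := ell2_normC_Z c u; rewrite normc_normE -rmorphM => /(@complexI R). Qed.

Lemma nm0 : ell2_norm (0 : H) = 0.
Proof. by rewrite -(scale0r (0 : H)) nmZ normc0 mul0r. Qed.

Lemma nmN u : ell2_norm (- u : H) = ell2_norm u.
Proof. by rewrite -scaleN1r nmZ normcN normc1 mul1r. Qed.

Lemma nmB u v : ell2_norm (u - v : H) <= ell2_norm u + ell2_norm v.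
Proof. by rewrite -(nmN v); exact: nmD. Qed.

Lemma nm_distC u v : ell2_norm (u - v : H) = ell2_norm (v - u : H).
Proof. by rewrite -nmN opprB. Qed.

Lemma nm_dist u v w : ell2_norm (u - v : H) <= ell2_norm (u - w : H) + ell2_norm (w - v : H).
Proof. by apply: le_trans (nmD _ _); rewrite addrA subrK. Qed.

Lemma nm_le_add u v : ell2_norm u <= ell2_norm (u - v : H) + ell2_norm v.
Proof. by apply: le_trans (nmD _ _); rewrite subrK. Qed.

Lemma nm_eq0 u : ell2_norm u = 0 -> u = 0.
Proof. by move=> u0; apply: ell2_normC_eq0; rewrite u0. Qed.

Lemma nm_eq u v : (forall e, 0 < e -> ell2_norm (u - v : H) <= e) -> u = v.
Proof.
move=> uv; apply/eqP; rewrite -subr_eq0; apply/eqP/nm_eq0/le_anti.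
rewrite nm_ge0 andbT; apply/ler_addgt0Pr => e e0.
by rewrite add0r uv.
Qed.

Lemma nm_coord u i : normc (u i) <= ell2_norm u.
Proof. exact: ell2_norm_coord (ell2P u). Qed.

Lemma nm_sum (J : Type) (r : seq J) (F : J -> H) :
  ell2_norm (\sum_(j <- r) F j : H) <= \sum_(j <- r) ell2_norm (F j).
Proof.
elim: r => [|j r IH]; first by rewrite !big_nil nm0.
by rewrite !big_cons; apply: le_trans (nmD _ _) (lerD _ _).
Qed.

Lemma half_pow_small e : 0 < e -> exists N, 2^-1 ^+ N <= e.
Proof.
move=> e0; have : (fun N => 2^-1 ^+ N : R) @ \oo --> (0 : R).
  by apply: cvg_expr; rewrite ger0_norm ?invr_ge0// invf_lt1// ltr1n.
move=> /cvgr0_norm_le/(_ _ e0)[N _ /(_ N (leqnn N))] /= h.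
by exists N; apply: le_trans h; exact: ler_norm.
Qed.

Lemma ell2_cauchy (u : nat -> H) (t : nat -> R) :
  (forall i j, (i <= j)%N -> ell2_norm (u j - u i : H) <= t i) ->
  (forall e, 0 < e -> exists i, t i <= e) ->
  exists v, forall i, ell2_norm (v - u i : H) <= t i.
Proof.
move=> ut t0.
have /ell2_complete/cvg_ex[v uv] : cauchy (u @ \oo).
  apply/cauchyP => -[e e'] /=; rewrite ltcE/= => /andP[/eqP -> e0].
  have e20 : 0 < e / 2 by rewrite divr_gt0.
  have [i ti] := t0 _ e20; exists (u i); near=> j; rewrite /= ell2_ballE nm_distC.
  apply: le_lt_trans (ut i j _) _; first by near: j; exact: nbhs_infty_ge.
  by apply: le_lt_trans ti _; rewrite ltr_pdivrMr// ltr_pMr// ltr1n.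
exists v => i; apply/ler_addgt0Pr => e e0.
have : \forall j \near \oo, ell2_norm (v - u j : H) < e.
  have /cvgrPdist_lt/(_ (e%:C)) := uv; rewrite ltcR => /(_ e0).
  by apply: filterS => j; rewrite ell2_normE ltcR.
move=> [N _ vN]; have := vN (maxn N i) (leq_maxl _ _) => /= vj.
apply: le_trans (nm_dist _ _ (u (maxn N i))) _; rewrite addrC; apply: lerD; last exact: ltW.
by apply: ut; rewrite leq_maxr.
Unshelve. all: by end_near. Qed.

(** Closedness in terms of the real-valued norm, avoiding filters and the
   complex-valued norm of the normed module structure. *)
Definition approx_closed (A : set H) := forall y,
  (forall e, 0 < e -> exists2 a, A a & ell2_norm (y - a : H) <= e) -> A y.

Lemma approx_closedP (A : set H) : closed A <-> approx_closed A.
Proof.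
have nbE y (B : set H) : nbhs y B -> exists2 e, 0 < e & forall a, ell2_norm (y - a : H) <= e -> B a.
  move=> /nbhs_ballP[[e e'] /=]; rewrite ltcE/= => /andP[/eqP -> e0] eB.
  exists (e / 2); first by rewrite divr_gt0.
  move=> a ya; apply: eB; rewrite ell2_ballE; apply: le_lt_trans ya _.
  by rewrite ltr_pdivrMr// ltr_pMr// ltr1n.
have nbI y e : 0 < e -> nbhs y [set a | ell2_norm (y - a : H) < e].
  move=> e0; apply/nbhs_ballP; exists (e%:C); first by rewrite /= ltcR.
  by move=> a; rewrite ell2_ballE.
split=> cA y yA.
  apply: cA => B /nbE[e e0 eB]; have [a Aa ya] := yA e e0.
  by exists a; split=> //; apply: eB.
apply: cA => e e0; have [a [Aa /= ya]] := yA _ (nbI y e e0).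
by exists a => //; apply: ltW.
Qed.

End Ell2Norm.

Section FiniteDimension.
Context {R : realType}.

(** A subspace on which finitely many linear functionals separate the points
   is finite dimensional: split off one vector for each functional that does
   not vanish on what is left. *)
Lemma finite_dim_separated (V : lmodType R[i]) (J : Type) (ks : seq J) (f : J -> V -> R[i])
    (A : set V) :
  (forall a u v, A u -> A v -> A (a *: u + v)) ->
  (forall k a u v, f k (a *: u + v) = a * f k u + f k v) ->
  (forall v, A v -> foldr (fun k P => f k v = 0 /\ P) True ks -> v = 0) ->
  finite_dim A.
Proof.
move=> + fl; elim: ks A => [|k ks IH] A Al A0 /=.
  by exists [::] => v Av; exists (fun=> 0); rewrite big_ord0; apply: A0.
have [[v0 [Av0 fv0]]|nA] := pselect (exists v0, A v0 /\ f k v0 != 0).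
  have [s sP] : finite_dim [set v | A v /\ f k v = 0].
    apply: IH => [a u v [Au fu] [Av fv]|v [Av fv] fvs].
      by split; [exact: Al|rewrite fl fu fv mulr0 addr0].
    exact: A0.
  exists (v0 :: s) => v Av; pose a := - (f k v / f k v0).
  have [|c cP] := sP (a *: v0 + v).
    by split; [exact: Al|rewrite fl mulNr divfK// addNr].
  exists (fun i => if unlift ord0 i is Some j then c j else - a).
  rewrite /= big_ord_recl unlift_none/=; under eq_bigr do rewrite liftK.
  by rewrite -cP addrA -scalerDl addNr scale0r add0r.
apply: IH => // v Av fvs; apply: A0 => //; split=> //.
by apply/eqP; apply/negPn/negP => fv; apply: nA; exists v.
Qed.

Lemma finite_dim_dependent (V : lmodType R[i]) (A : set V) : finite_dim A ->
  exists d, forall w : 'I_d.+1 -> V, (forall i, A (w i)) ->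
    exists2 c : 'I_d.+1 -> R[i], exists i, c i != 0 & \sum_i c i *: w i = 0.
Proof.
move=> [s sP]; exists (size s) => w Aw.
have /boolp.choice[c cP] : forall i, exists c : 'I_(size s) -> R[i], w i = \sum_j c j *: s`_j.
  by move=> i; apply: sP.
pose M : 'M[R[i]]_((size s).+1, size s) := \matrix_(i, j) c i j.
have /rowV0Pn[v vM v0] : kermx M != 0.
  rewrite -mxrank_eq0 mxrank_ker -lt0n subn_gt0 ltnS; exact: rank_leq_col.
exists (fun i => v 0 i); first by move: v0 => /rV0Pn.
have vM0 : v *m M = 0 by apply/sub_kermxP.
under eq_bigr do rewrite cP scaler_sumr; rewrite exchange_big/= big1// => j _.
under eq_bigr do rewrite scalerA; rewrite -scaler_suml.
have /(congr1 (fun B : 'rV_(size s) => B 0 j)) := vM0; rewrite !mxE => vj.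
by rewrite (eq_bigr (fun i => v 0 i * M i j)) ?vj ?scale0r// => i _; rewrite mxE.
Qed.

End FiniteDimension.

Section BoundedOperator.
Context {R : realType} {I : choiceType}.
Local Notation H := (ell2 R I).
Implicit Types (u v w : H) (e : R).
Variables (T : H -> H) (M : R).
Hypothesis T_linear : linear T.
Hypothesis T_bounded : forall u, ell2_norm (T u) <= M * ell2_norm u.

Lemma lin0 : T 0 = 0.
Proof. by have := T_linear (-1) 0 0; rewrite scaleN1r oppr0 addr0 scaleN1r addNr. Qed.

Lemma linD u v : T (u + v) = T u + T v.
Proof. by have := T_linear 1 u v; rewrite !scale1r. Qed.

Lemma linZ (c : R[i]) u : T (c *: u) = c *: T u.
Proof. by have := T_linear c u 0; rewrite !addr0 lin0 addr0. Qed.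

Lemma linB u v : T (u - v) = T u - T v.
Proof. by rewrite linD -scaleN1r linZ scaleN1r. Qed.

Let T_bounded' u : ell2_norm (T u) <= `|M| * ell2_norm u.
Proof. by apply: le_trans (T_bounded u) _; apply: ler_wpM2r; [exact: nm_ge0|exact: ler_norm]. Qed.

(** The Baire step of the open mapping theorem, carried out by hand in the range
   of T: if the images of no ball were somewhere dense in the range, one could
   nest balls whose intersection avoids the image of every ball. *)
Lemma range_not_meager : approx_closed (range T) ->
  exists J : nat, exists u0, exists2 r, 0 < r &
    forall u, ell2_norm (T u - T u0 : H) <= r ->
      forall e, 0 < e -> exists2 v : H, ell2_norm v <= J%:R & ell2_norm (T u - T v : H) <= e.
Proof.
move=> cT; apply: contrapT => nJ.
have step (J : nat) (s : H * R) : exists s' : H * R, 0 < s.2 ->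
    [/\ 0 < s'.2, s'.2 <= s.2 / 2, ell2_norm (T s'.1 - T s.1 : H) <= s.2 / 2 &
       forall v, ell2_norm v <= J%:R -> s'.2 < ell2_norm (T s'.1 - T v : H)].
  have [s0|s0] := ltP 0 s.2; last by exists s; rewrite ltNge s0.
  have s20 : 0 < s.2 / 2 by rewrite divr_gt0.
  apply: contrapT => ns; apply: nJ; exists J, s.1, (s.2 / 2) => // u us e e0.
  apply: contrapT => nv; apply: ns; exists (u, Num.min (s.2 / 2) e) => _; split=> //=.
  - by rewrite lt_min s20.
  - by rewrite ge_min lexx.
  move=> v vJ; rewrite gt_min; apply/orP; right; rewrite ltNge; apply/negP => uv.
  by apply: nv; exists v.
have /boolp.choice[F FP] : forall x : nat * (H * R), exists s' : H * R, 0 < x.2.2 ->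
    [/\ 0 < s'.2, s'.2 <= x.2.2 / 2, ell2_norm (T s'.1 - T x.2.1 : H) <= x.2.2 / 2 &
       forall v, ell2_norm v <= x.1%:R -> s'.2 < ell2_norm (T s'.1 - T v : H)].
  by move=> [J s]; exact: step.
pose fix s (J : nat) : H * R := if J is J'.+1 then F (J', s J') else (0, 1).
have s0 J : 0 < (s J).2 by elim: J => [|J IH] /=; [exact: ltr01|have [] := FP (J, s J) IH].
have sP J := FP (J, s J) (s0 J).
have s_half J : (s J).2 <= 2^-1 ^+ J.
  elim: J => [|J IH]; first by rewrite expr0.
  have [_ h _ _] := sP J; apply: le_trans h _ => /=.
  by rewrite exprS mulrC; apply: ler_wpM2l; rewrite ?invr_ge0.
have s_near i j : (i <= j)%N -> ell2_norm (T (s j).1 - T (s i).1 : H) <= (s i).2.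
  move=> ij; suff : ell2_norm (T (s j).1 - T (s i).1 : H) <= (s i).2 - (s j).2.
    by move=> h; apply: le_trans h _; rewrite gerBl ltW.
  move: ij => /subnK <-; elim: (j - i)%N => [|d IH]; first by rewrite add0n !subrr nm0.
  rewrite addSn; have [_ h1 h2 _] := sP (d + i)%N.
  apply: le_trans (nm_dist _ _ (T (s (d + i)%N).1)) _.
  by move: IH h1 h2; rewrite /=; lra.
have [z zP] : exists z : H, forall i, ell2_norm (z - T (s i).1 : H) <= (s i).2.
  apply: ell2_cauchy s_near _ => e e0.
  have [N NP] := half_pow_small e0.
  by exists N; apply: le_trans (s_half N) NP.
have [w _ wz] : range T z.
  apply: cT => e e0.
  have [N NP] := half_pow_small e0.
  exists (T (s N).1); first by exists (s N).1.
  by apply: le_trans (zP N) _; apply: le_trans (s_half N) NP.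
pose J := (Num.truncn (ell2_norm w)).+1.
have [_ _ _ /(_ w)] := sP J; have := zP J.+1; rewrite wz nm_distC => h1 h2.
have : ell2_norm w <= J%:R by apply/ltW/truncnS_gt.
by move=> /h2 /lt_le_trans /(_ h1); rewrite ltxx.
Qed.

Lemma bounded_approx_preimage : approx_closed (range T) ->
  exists2 K, 0 <= K & forall u e, 0 < e ->
    exists2 v : H, ell2_norm v <= K * ell2_norm (T u) & ell2_norm (T u - T v : H) <= e.
Proof.
move=> /range_not_meager[J [u0 [r r0 rP]]].
exists (2 * J%:R / r); first by rewrite divr_ge0 ?mulr_ge0// ltW.
move=> u e e0; have [y0|y0] := eqVneq (ell2_norm (T u)) 0.
  by exists 0; rewrite ?nm0 ?y0 ?mulr0// lin0 subr0 y0 ltW.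
have y_gt0 : 0 < ell2_norm (T u) by rewrite lt_def y0 nm_ge0.
pose t := r / ell2_norm (T u); have t0 : 0 < t by rewrite divr_gt0.
have d0 : 0 < e * t / 2 by apply: divr_gt0 => //; apply: mulr_gt0.
have [|v1 v1J v1P] := rP (u0 + t%:C *: u) _ _ d0.
  rewrite linD linZ addrAC subrr add0r nmZ normc_real ger0_norm ?(ltW t0)//.
  by rewrite divfK.
have [|v2 v2J v2P] := rP u0 _ _ d0; first by rewrite subrr nm0 ltW.
exists ((t^-1)%:C *: (v1 - v2)).
  rewrite nmZ normc_real ger0_norm ?invr_ge0 ?(ltW t0)// invf_div.
  rewrite [leRHS](_ : _ = ell2_norm (T u) / r * (J%:R + J%:R)); last by ring.
  apply: ler_wpM2l; first by rewrite divr_ge0 ?nm_ge0 ?ltW.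
  by apply: le_trans (nmB _ _) (lerD _ _).
rewrite linZ linB.
have -> : T u - (t^-1)%:C *: (T v1 - T v2) =
    (t^-1)%:C *: ((T (u0 + t%:C *: u) - T v1) - (T u0 - T v2)).
  rewrite linD linZ (_ : T u0 + t%:C *: T u - T v1 - (T u0 - T v2) = t%:C *: T u - (T v1 - T v2)).
    have tt : (t^-1)%:C * t%:C = 1 :> R[i] by rewrite -rmorphM mulVf ?gt_eqF.
    by apply: ell2_ext => i; rewrite !coordE [RHS]mulrDr mulrA tt mul1r mulrN.
  by apply: ell2_ext => i; rewrite !coordE; ring.
rewrite nmZ normc_real ger0_norm ?invr_ge0 ?(ltW t0)// ler_pdivrMl// mulrC.
rewrite [leRHS](_ : _ = e * t / 2 + e * t / 2); last by field.
by apply: le_trans (nmB _ _) (lerD _ _).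
Qed.

(** An operator with closed range is open onto its range: a preimage of
   controlled norm is the sum of a series of approximate preimages. *)
Lemma bounded_preimage : approx_closed (range T) ->
  exists2 K, 0 <= K & forall u, exists2 v : H, T v = T u & ell2_norm v <= K * ell2_norm (T u).
Proof.
move=> /bounded_approx_preimage[K K0 KP].
exists (2 * K); first by rewrite mulr_ge0.
move=> u; set Y := ell2_norm (T u).
have [y0|y0] := eqVneq Y 0.
  by exists 0; rewrite ?nm0 ?y0 ?mulr0// lin0 (nm_eq0 y0).
have Y0 : 0 < Y by rewrite lt_def y0 nm_ge0.
have h0 (i : nat) : 0 < 2^-1 ^+ i :> R by rewrite exprn_gt0.
have /boolp.choice[F FP] : forall x : nat * H, exists v : H,
    ell2_norm v <= K * ell2_norm (T x.2) /\ ell2_norm (T x.2 - T v : H) <= Y * 2^-1 ^+ x.1.+1.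
  move=> [i x]; have [|v v1 v2] := KP x (Y * 2^-1 ^+ i.+1); last by exists v.
  by rewrite mulr_gt0.
pose fix rest (i : nat) : H := if i is i'.+1 then rest i' - F (i', rest i') else u.
have restP i : ell2_norm (T (rest i)) <= Y * 2^-1 ^+ i.
  case: i => [|i] /=; first by rewrite expr0 mulr1.
  by rewrite linB; have [] := FP (i, rest i).
have near i j : (i <= j)%N -> ell2_norm ((u - rest j) - (u - rest i) : H) <= 2 * K * (Y * 2^-1 ^+ i).
  move=> ij; have -> : (u - rest j) - (u - rest i) = rest i - rest j.
    by rewrite opprB addrC addrA subrK.
  suff : ell2_norm (rest i - rest j : H) <= 2 * K * Y * (2^-1 ^+ i - 2^-1 ^+ j).
    move=> h; apply: le_trans h _; rewrite mulrA; apply: ler_wpM2l; last by rewrite gerBl ltW.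
    by rewrite !mulr_ge0// ltW.
  move: ij => /subnK <-; elim: (j - i)%N => [|d IH]; first by rewrite add0n !subrr nm0 mulr0.
  rewrite addSn; have [h1 _] := FP ((d + i)%N, rest (d + i)%N); rewrite /= in h1.
  apply: le_trans (nm_dist _ _ (rest (d + i)%N)) _.
  have -> : rest (d + i)%N - rest (d + i).+1 = F ((d + i)%N, rest (d + i)%N).
    by rewrite /= subKr.
  have h2 : K * ell2_norm (T (rest (d + i)%N)) <= K * (Y * 2^-1 ^+ (d + i)%N).
    exact: ler_wpM2l.
  rewrite exprS; move: IH h1 h2; move: (2^-1 ^+ (d + i)%N) (2^-1 ^+ i) => p q.
  move: (ell2_norm _) (ell2_norm _) (K * ell2_norm _) => a b c; lra.
have [v vP] : exists v : H, forall i, ell2_norm (v - (u - rest i) : H) <= 2 * K * (Y * 2^-1 ^+ i).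
  apply: ell2_cauchy near _ => e e0.
  have c0 : 0 < 2 * K * Y + 1 by rewrite ltr_wpDl// !mulr_ge0// ltW.
  have [N NP] := half_pow_small (divr_gt0 e0 c0).
  exists N; rewrite mulrA; move: NP; rewrite ler_pdivlMr// => NP.
  apply: le_trans NP; rewrite mulrC; apply: ler_wpM2l; first exact: ltW.
  by rewrite lerDl.
exists v; last by have := vP 0%N; rewrite /= subrr subr0 expr0 mulr1.
apply: nm_eq => e e0.
pose c := `|M| * (2 * K * Y) + Y + 1.
have c0 : 0 < c by rewrite ltr_wpDl// addr_ge0 ?(ltW Y0)// !mulr_ge0// ltW.
have [N NP] := half_pow_small (divr_gt0 e0 c0).
move: NP; rewrite ler_pdivlMr// => NP; apply: le_trans NP.
apply: le_trans (nm_dist _ _ (T (u - rest N))) _.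
rewrite -linB (linB u) [X in _ + ell2_norm X]addrAC subrr add0r nmN.
apply: le_trans (lerD (T_bounded' _) (restP N)) _.
have h : `|M| * ell2_norm (v - (u - rest N) : H) <= `|M| * (2 * K * (Y * 2^-1 ^+ N)).
  exact: ler_wpM2l.
apply: le_trans (lerD h (lexx _)) _; rewrite /c; have := ltW (h0 N); nra.
Qed.

End BoundedOperator.

Section ClosedSum.
Context {R : realType} {I : choiceType}.
Local Notation H := (ell2 R I).
Implicit Types (u v w y : H) (e : R) (A : set H).

Lemma archi_inv e : 0 < e -> exists i : nat, i.+1%:R^-1 <= e.
Proof.
move=> e0; exists (Num.truncn e^-1); rewrite -[leRHS]invrK lef_pV2 ?posrE ?invr_gt0//.
exact/ltW/truncnS_gt.
Qed.

(** If w is not in A, it is at positive distance from A, so that the coefficient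
   of w is controlled by the norm of a + c w and converges along approximations. *)
Lemma approx_closed_add_line A w :
  (forall a u v, A u -> A v -> A (a *: u + v)) -> A 0 -> approx_closed A ->
  approx_closed [set y | exists2 a, A a & exists c : R[i], y = a + c *: w].
Proof.
move=> Al A0 cA y yA.
have [Aw|nAw] := pselect (A w).
  exists y; last by exists 0; rewrite scale0r addr0.
  apply: cA => e e0; have [_ [a Aa [c ->]] ya] := yA e e0.
  by exists (a + c *: w) => //; rewrite addrC; apply: Al.
have [d d0 dP] : exists2 d, 0 < d & forall a, A a -> d <= ell2_norm (w - a : H).
  apply: contrapT => nd; apply: nAw; apply: cA => e e0.
  apply: contrapT => na; apply: nd; exists e => // a Aa.
  by rewrite leNgt; apply/negP => wa; apply: na; exists a => //; apply: ltW.
have lowb a (c : R[i]) : A a -> normc c * d <= ell2_norm (a + c *: w : H).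
  move=> Aa; have [->|c0] := eqVneq c 0; first by rewrite normc0 mul0r nm_ge0.
  have -> : a + c *: w = c *: (w - (- c^-1) *: a).
    by rewrite scalerBr scalerA mulrN divff// scaleN1r opprK addrC.
  rewrite nmZ; apply: ler_wpM2l; first exact: Defs.normc_ge0.
  by apply: dP; rewrite -[_ *: a]addr0; apply: Al.
have /boolp.choice[F FP] : forall i : nat, exists x : H * R[i], A x.1 /\ ell2_norm (y - (x.1 + x.2 *: w) : H) <= i.+1%:R^-1.
  move=> i; have [|_ [a Aa [c ->]] ya] := yA i.+1%:R^-1; first by rewrite invr_gt0.
  by exists (a, c).
pose t (i : nat) : R := 2 / d * i.+1%:R^-1.
have cc i j : (i <= j)%N -> normc ((F j).2 - (F i).2) <= t i.
  move=> ij; rewrite /t mulrAC ler_pdivlMr//.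
  apply: le_trans (lowb ((F j).1 - (F i).1) _ _) _.
    by rewrite addrC -scaleN1r; apply: Al; [exact: (FP i).1|exact: (FP j).1].
  have -> : (F j).1 - (F i).1 + ((F j).2 - (F i).2) *: w =
      (y - ((F i).1 + (F i).2 *: w)) - (y - ((F j).1 + (F j).2 *: w)).
    by apply: ell2_ext => k; rewrite !coordE; ring.
  apply: le_trans (nmB _ _) _; rewrite mulr_natl mulr2n.
  apply: lerD; first exact: (FP i).2.
  by apply: le_trans (FP j).2 _; rewrite lef_pV2 ?posrE// ler_nat.
have t_small e : 0 < e -> exists i, t i <= e.
  move=> e0; have [i ie] := archi_inv (divr_gt0 (mulr_gt0 e0 d0) (ltr0Sn R 1)).
  exists i; rewrite /t mulrC; apply: le_trans (ler_wpM2r _ ie) _.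
    by rewrite divr_ge0// ltW.
  by rewrite le_eqVlt; apply/orP; left; apply/eqP; field; rewrite gt_eqF.
have w0 : w != 0 by apply/eqP => w0; apply: nAw; rewrite w0.
have nw0 : 0 < ell2_norm w.
  by rewrite lt_def nm_ge0 andbT; apply: contra w0 => /eqP/nm_eq0 ->.
have [z zP] : exists z : H, forall i, ell2_norm (z - (F i).2 *: w : H) <= t i * ell2_norm w.
  apply: ell2_cauchy => [i j ij|e e0].
    by rewrite -scalerBl nmZ; apply: ler_wpM2r; [exact: nm_ge0|exact: cc].
  have [i it] := t_small _ (divr_gt0 e0 nw0).
  by exists i; rewrite -ler_pdivlMr.
have [i0 wi0] : exists i0, w i0 != 0.
  apply: contrapT => nw; move/eqP: w0; apply; apply/val_inj/funext => i.
  by apply/eqP/negPn/negP => wi; apply: nw; exists i.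
have nwi0 : 0 < normc (w i0).
  by rewrite lt_def Defs.normc_ge0 andbT; apply: contra wi0 => /eqP/eq0_normc ->.
pose c := z i0 / w i0.
have cP i : normc (c - (F i).2) <= t i * ell2_norm w / normc (w i0).
  rewrite ler_pdivlMr// -normcM mulrBl divfK//.
  exact: le_trans (nm_coord (z - (F i).2 *: w) i0) (zP i).
exists (y - c *: w); last by exists c; rewrite subrK.
apply: cA => e e0; pose K := 1 + 2 / d * (ell2_norm w / normc (w i0) * ell2_norm w).
have K0 : 0 < K.
  apply: ltr_pwDl => //; apply: mulr_ge0; first by rewrite divr_ge0 ?(ltW d0).
  by rewrite mulr_ge0 ?divr_ge0 ?nm_ge0 ?(ltW nwi0).
have [i ie] := archi_inv (divr_gt0 e0 K0).
exists (F i).1; first exact: (FP i).1.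
have -> : y - c *: w - (F i).1 = (y - ((F i).1 + (F i).2 *: w)) - (c - (F i).2) *: w.
  by apply: ell2_ext => k; rewrite !coordE; ring.
apply: le_trans (nmB _ _) _; rewrite nmZ.
move: ie; rewrite ler_pdivlMr// /K mulrDr mulr1 => ie; apply: le_trans ie; apply: lerD; first exact: (FP i).2.
apply: le_trans (ler_wpM2r (nm_ge0 w) (cP i)) _.
by rewrite le_eqVlt; apply/orP; left; apply/eqP; rewrite /t; ring.
Qed.

End ClosedSum.

(** * Banded operators on the lattice *)

Section Restriction.
Context {R : realType} {I : choiceType}.
Local Notation H := (ell2 R I).
Implicit Types (u v w : H) (f g : I -> R[i]) (A F : {fset I}) (c : I -> R[i]) (b : R).

Lemma square_summable_mul c b f : 0 <= b -> (forall i, normc (c i) <= b) ->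
  f \in square_summable ->
  (fun i => c i * f i) \in square_summable /\ ell2_norm (fun i => c i * f i) <= b * ell2_norm f.
Proof.
move=> b0 cb fs; apply/ell2_norm_le; first by rewrite mulr_ge0 ?sqrtr_ge0.
move=> A; rewrite exprMn; apply: le_trans (ler_wpM2l (sqr_ge0 _) (ell2_norm_sum A fs)).
rewrite mulr_sumr; apply: ler_sum => i _; rewrite normcM exprMn.
by apply: ler_wpM2r; rewrite ?sqr_ge0// ler_pXn2r ?nnegrE ?Defs.normc_ge0.
Qed.

Definition mulop c (u : H) : H := insubd (0 : H) (fun i => c i * u i).

Lemma mulopE c b u i : (forall i, normc (c i) <= b) -> mulop c u i = c i * u i.
Proof.
move=> cb; have b0 : 0 <= b by apply: le_trans (cb i); apply: Defs.normc_ge0.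
rewrite /mulop; have := @val_insubd _ _ H 0 (fun i => c i * u i).
by rewrite (square_summable_mul b0 cb (ell2P u)).1 => /(congr1 (fun f => f i)).
Qed.

Lemma nm_mulop c b u : (forall i, normc (c i) <= b) -> 0 <= b ->
  ell2_norm (mulop c u) <= b * ell2_norm u.
Proof.
move=> cb b0; have [_] := square_summable_mul b0 cb (ell2P u).
by rewrite (_ : ell2_fun (mulop c u) = (fun i => c i * u i))//; apply/funext => i; rewrite (mulopE _ _ cb).
Qed.

Definition indicator (P : pred I) : I -> R[i] := fun i => (P i)%:R.

Lemma normc_indicator P i : normc (indicator P i) <= 1.
Proof. by rewrite /indicator; case: (P i); rewrite ?normc1 ?normc0. Qed.

Definition restrict (P : pred I) (u : H) : H := mulop (indicator P) u.

Lemma restrictE P u i : restrict P u i = if P i then u i else 0.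
Proof.
rewrite /restrict (mulopE _ _ (normc_indicator P)) /indicator.
by case: (P i); rewrite ?mul1r ?mul0r.
Qed.

Lemma nm_restrict P u : ell2_norm (restrict P u) <= ell2_norm u.
Proof. by have := nm_mulop u (normc_indicator P) ler01; rewrite mul1r. Qed.

Lemma nm_le_sums u b : 0 <= b ->
  (forall A, \sum_(i <- A) normc (u i) ^+ 2 <= b ^+ 2) -> ell2_norm u <= b.
Proof. by move=> b0 /(ell2_norm_le u b0)[]. Qed.

Lemma finite_support_dense u e : 0 < e -> exists F : {fset I},
  ell2_norm (u - restrict (mem F) u : H) <= e.
Proof.
move=> e0; have [F FP] : exists F : {fset I}, ell2_norm u ^+ 2 - e ^+ 2 <= \sum_(i <- F) normc (u i) ^+ 2.
  have [ue|eu] := leP (ell2_norm u) e.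
    by exists fset0; rewrite big_seq_fset0 subr_le0 ler_pXn2r ?nnegrE ?nm_ge0 ?(ltW e0).
  apply: contrapT => nF; pose M := Num.sqrt (ell2_norm u ^+ 2 - e ^+ 2).
  have M2 : M ^+ 2 = ell2_norm u ^+ 2 - e ^+ 2.
    by rewrite sqr_sqrtr// subr_ge0 ler_pXn2r ?nnegrE ?nm_ge0 ?(ltW e0) ?(ltW eu).
  have uM : ell2_norm u <= M.
    apply: nm_le_sums => [|A]; first exact: sqrtr_ge0.
    by rewrite M2 leNgt; apply/negP => h; apply: nF; exists A; apply: ltW.
  have : ell2_norm u ^+ 2 <= M ^+ 2 by rewrite ler_pXn2r ?nnegrE ?nm_ge0 ?sqrtr_ge0.
  by rewrite M2; have := exprn_gt0 2 e0; lra.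
exists F; apply: nm_le_sums; first exact: ltW.
move=> A; pose B := [fset i in A | i \notin F]%fset.
have rE i : (u - restrict (mem F) u : H) i = if i \in F then 0 else u i.
  transitivity (u i - restrict (mem F) u i) => //.
  by rewrite restrictE /=; case: ifP => _; rewrite ?subrr ?subr0.
have -> : \sum_(i <- A) normc ((u - restrict (mem F) u : H) i) ^+ 2 = \sum_(i <- B) normc (u i) ^+ 2.
  rewrite (big_fsetID _ (mem F) A)/= big_seq big1 ?add0r.
    apply: eq_big_seq => i; rewrite !inE/= => /andP[_ /negPf iF]; congr (normc _ ^+ 2).
    by have := rE i; rewrite iF.
  move=> i; rewrite !inE/= => /andP[_ iF]; transitivity (normc (0 : R[i]) ^+ 2).
    by congr (normc _ ^+ 2); have := rE i; rewrite iF.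
  by rewrite normc0 expr0n.
have BF : [disjoint B & F]%fset.
  by apply/fdisjointP => i; rewrite !inE/= => /andP[].
have := ell2_norm_sum (B `|` F)%fset (ell2P u); rewrite sum_fsetU_disjoint//.
by move: FP; move: (\sum_(i <- F) _) (\sum_(i <- B) _) (_ ^+ 2) (_ ^+ 2) => a b c d; lra.
Qed.

Definition unit_vector (i : I) : H := insubd (0 : H) (fun j => (j == i)%:R).

Lemma unit_vectorE i j : unit_vector i j = (j == i)%:R.
Proof.
rewrite /unit_vector; have := @val_insubd _ _ H 0 (fun j => (j == i)%:R).
have -> : (fun j => (j == i)%:R : R[i]) \in square_summable.
  apply: (proj1 ((ell2_norm_le _ (ler01 : 0 <= 1 :> R)).1 _)) => A.
  rewrite expr1n; have [iA|iA] := boolP (i \in A).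
    rewrite (big_fsetD1 i)//= eqxx normc1 expr1n big1_seq ?addr0// => l.
    by rewrite !inE => /andP[_ /andP[li _]]; rewrite (negPf li) normc0 expr0n.
  rewrite big1_seq ?ler01// => l /andP[_ lA].
  by case: eqVneq => [li|_]; [rewrite -li lA in iA|rewrite normc0 expr0n].
by move=> /(congr1 (fun f => f j)).
Qed.

Lemma sum_unit_vectorE F (f : I -> R[i]) j :
  (\sum_(i <- F) f i *: unit_vector i : H) j = if j \in F then f j else 0.
Proof.
have -> : (\sum_(i <- F) f i *: unit_vector i : H) j = \sum_(i <- F) f i * (j == i)%:R.
  elim: (enum_fset F) => [|i r IH]; first by rewrite !big_nil.
  by rewrite !big_cons coordD coordZ unit_vectorE IH.
case: ifP => jF.
  rewrite (big_fsetD1 j)//= eqxx mulr1 big1_seq ?addr0// => l.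
  by rewrite !inE => /andP[_ /andP[lj _]]; rewrite eq_sym (negPf lj) mulr0.
rewrite big1_seq// => l /andP[_ lF].
by case: eqVneq => [jl|_]; [rewrite /= jl lF in jF|rewrite mulr0].
Qed.

Lemma restrict_sum F u : restrict (mem F) u = \sum_(i <- F) u i *: unit_vector i.
Proof. by apply: ell2_ext => j; rewrite restrictE sum_unit_vectorE. Qed.

End Restriction.

Section Band.
Context {R : realType} {n : nat}.
Local Notation Z := ('rV[int]_n).
Local Notation H := (ell2 R Z).
Implicit Types (u v w : H) (a : Z -> Z -> R[i]) (k l m s : Z) (D : nat) (C : R).

Lemma square_summable_shift s (f : Z -> R[i]) : f \in square_summable ->
  (fun k => f (k + s)) \in square_summable /\ ell2_norm (fun k => f (k + s)) <= ell2_norm f.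
Proof.
move=> fs; apply/ell2_norm_le; first exact: sqrtr_ge0.
move=> A; have := ell2_norm_sum [fset (k + s)%R | k in A]%fset fs.
by rewrite big_imfset//= => k l _ _ /addIr.
Qed.

Definition shiftop s (u : H) : H := insubd (0 : H) (fun k => u (k + s)).

Lemma shiftopE s u k : shiftop s u k = u (k + s).
Proof.
rewrite /shiftop; have := @val_insubd _ _ H 0 (fun k => u (k + s)).
by rewrite (square_summable_shift s (ell2P u)).1 => /(congr1 (fun f => f k)).
Qed.

Lemma nm_shiftop s u : ell2_norm (shiftop s u) <= ell2_norm u.
Proof.
have [_] := square_summable_shift s (ell2P u).
by rewrite (_ : ell2_fun (shiftop s u) = (fun i => u (i + s)))//; apply/funext => i; rewrite shiftopE.
Qed.

(** The diagonals may repeat: the composition of two banded operators is naturally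
   a sum over pairs of diagonals. *)
Definition diags (J : Type) (r : seq J) (s : J -> Z) (c : J -> Z -> R[i]) u : H :=
  \sum_(j <- r) mulop (c j) (shiftop (s j) u).

Lemma diagsE (J : eqType) (r : seq J) (s : J -> Z) (c : J -> Z -> R[i]) (b : J -> R) u k :
  (forall j, j \in r -> forall k, normc (c j k) <= b j) ->
  diags r s c u k = \sum_(j <- r) c j k * u (k + s j).
Proof.
rewrite /diags; elim: r => [|j r IH] cb; first by rewrite !big_nil.
rewrite !big_cons coordD IH => [|i ir]; last by apply: cb; rewrite inE ir orbT.
by rewrite (mulopE _ _ (cb j (mem_head _ _))) shiftopE.
Qed.

Lemma nm_diags (J : eqType) (r : seq J) (s : J -> Z) (c : J -> Z -> R[i]) (b : J -> R) u :
  (forall j, j \in r -> forall k, normc (c j k) <= b j) ->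
  ell2_norm (diags r s c u) <= (\sum_(j <- r) b j) * ell2_norm u.
Proof.
move=> cb; apply: le_trans (nm_sum _ _) _; rewrite mulr_suml.
apply: ler_sum_seq => j jr; have b0 : 0 <= b j by apply: le_trans (cb j jr 0); apply: Defs.normc_ge0.
apply: le_trans (nm_mulop _ (cb j jr) b0) _.
by apply: ler_wpM2l => //; apply: nm_shiftop.
Qed.

Lemma diags_linear (J : eqType) (r : seq J) (s : J -> Z) (c : J -> Z -> R[i]) (b : J -> R) :
  (forall j, j \in r -> forall k, normc (c j k) <= b j) -> linear (diags r s c).
Proof.
move=> cb x u v; apply: ell2_ext => k.
rewrite coordD coordZ !(diagsE _ _ _ cb) mulr_sumr -big_split/=.
apply: eq_bigr => j _.
by transitivity (c j k * (x * u (k + s j) + v (k + s j))); [|ring].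
Qed.

Definition dominated C a := forall k m, normc (a k m) <= C * decay R m.

Definition band D a : H -> H := diags (box D) id (fun m k => a k m).

Lemma dominated_ge0 C a : dominated C a -> 0 <= C.
Proof.
move=> aC; have := le_trans (Defs.normc_ge0 _) (aC 0 0).
by rewrite pmulr_lge0// decay_gt0.
Qed.

Lemma bandE C a D u k : dominated C a ->
  band D a u k = \sum_(m <- box D) a k m * u (k + m).
Proof. by move=> aC; apply: (@diagsE _ _ _ _ (fun m => C * decay R m)) => m _ l; apply: aC. Qed.

Lemma band_linear C a D : dominated C a -> linear (band D a).
Proof. by move=> aC; apply: (@diags_linear _ _ _ _ (fun m => C * decay R m)) => m _ l; apply: aC. Qed.

Lemma nm_band C a D u : dominated C a ->
  ell2_norm (band D a u) <= C * decay_total R n * ell2_norm u.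
Proof.
move=> aC; have C0 := dominated_ge0 aC.
apply: le_trans (@nm_diags _ _ _ _ (fun m => C * decay R m) _ _) _.
  by move=> m _ l; apply: aC.
apply: ler_wpM2r; first exact: nm_ge0.
by rewrite -mulr_sumr; apply: ler_wpM2l => //; apply: sum_decay.
Qed.

Lemma nm_band_sub C a D D' u : dominated C a -> (D <= D')%N ->
  ell2_norm (band D' a u - band D a u : H) <= C * tail R n D * ell2_norm u.
Proof.
move=> aC DD'; have C0 := dominated_ge0 aC.
pose r : {fset Z} := [fset m in @box n D' | m \notin @box n D]%fset.
have aC' m : m \in enum_fset r -> forall k, normc (a k m) <= C * decay R m.
  by move=> _ k; apply: aC.
have -> : band D' a u - band D a u = diags r id (fun m k => a k m) u.
  apply: ell2_ext => k; rewrite coordD coordN !(bandE _ _ _ aC) (diagsE _ _ _ aC').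
  rewrite (big_fsetID _ (mem (box D)) (box D'))/=.
  have -> : [fset m in @box n D' | m \in @box n D]%fset = box D.
    by apply/fsetP => m; rewrite !inE/= andb_idl// => /(fsubsetP (box_le DD')).
  by rewrite addrAC subrr add0r.
apply: le_trans (nm_diags _ _ aC') _; apply: ler_wpM2r; first exact: nm_ge0.
rewrite -mulr_sumr; apply: ler_wpM2l => //; apply: sum_decay_tail.
by apply/fdisjointP => m; rewrite !inE/= => /andP[].
Qed.

(** A kernel dominated by the weight defines a bounded operator, the norm limit
   of its banded truncations. *)
Lemma band_limit C a : dominated C a -> exists2 T : H -> H, linear T &
  forall D u, ell2_norm (T u - band D a u : H) <= C * tail R n D * ell2_norm u.
Proof.
move=> aC; have C0 := dominated_ge0 aC.
have /boolp.choice[T TP] : forall u, exists v : H, forall D,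
    ell2_norm (v - band D a u : H) <= C * tail R n D * ell2_norm u.
  move=> u; apply: ell2_cauchy => [D D' DD'|e e0]; first exact: nm_band_sub.
  have c0 : 0 < C * ell2_norm u + 1 by rewrite ltr_wpDl// mulr_ge0// nm_ge0.
  have [D0 /(_ D0 (leqnn _)) DP] := @tail_small R n _ (divr_gt0 e0 c0).
  exists D0; move: DP; rewrite ler_pdivlMr// => DP; apply: le_trans DP.
  have := @tail_ge0 R n D0; move: (tail _ _ _) (ell2_norm u) C0 (nm_ge0 u) => t x; nra.
exists T => // x u v; apply: nm_eq => e e0.
pose c := C * (ell2_norm (x *: u + v : H) + normc x * ell2_norm u + ell2_norm v) + 1.
have c0 : 0 < c.
  by rewrite ltr_wpDl// mulr_ge0// !addr_ge0 ?mulr_ge0 ?nm_ge0 ?Defs.normc_ge0.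
have [D /(_ D (leqnn _)) DP] := @tail_small R n _ (divr_gt0 e0 c0).
move: DP; rewrite ler_pdivlMr// => DP; apply: le_trans DP.
have -> : T (x *: u + v) - (x *: T u + T v) = (T (x *: u + v) - band D a (x *: u + v)) -
    (x *: (T u - band D a u) + (T v - band D a v)).
  by rewrite (band_linear D aC); apply: ell2_ext => k; rewrite !coordE; ring.
apply: le_trans (nmB _ _) _; apply: le_trans (lerD (TP _ _) (nmD _ _)) _; rewrite nmZ.
have h1 : normc x * ell2_norm (T u - band D a u : H) <= normc x * (C * tail R n D * ell2_norm u).
  by apply: ler_wpM2l => //; apply: Defs.normc_ge0.
apply: le_trans (lerD (lexx _) (lerD h1 (TP v D))) _.
have t0 := @tail_ge0 R n D; rewrite /c; move: t0.
move: (tail R n D) (ell2_norm (x *: u + v : H)) (ell2_norm u) (ell2_norm v) (normc x) => t p q r s t0; lra.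
Qed.

End Band.

(** * The pseudo-difference operator as a limit of banded operators *)

Section Sums.
Context {R : realType}.

(** Unconditional summation is only used through this estimate of the remainder
   outside a finite set. *)
Lemma real_sum_approx (I : choiceType) (f : I -> R) (F : {fset I}) (t : R) :
  (forall A : {fset I}, [disjoint A & F]%fset -> \sum_(i <- A) `|f i| <= t) ->
  `|real_sum f - \sum_(i <- F) f i| <= t.
Proof.
move=> ft; rewrite /real_sum.
have split_sum (p : I -> \bar R) : (forall i, (0 <= p i)%E) -> (forall i, (p i <= `|f i|%:E)%E) ->
    exists2 r : R, 0 <= r <= t &
      \esum_(i in [set: I]) p i = ((\sum_(i <- F) fine (p i)) + r)%:E.
  move=> p0 pf; have pfin i : p i = (fine (p i))%:E.
    by rewrite fineK// ge0_fin_numE// (le_lt_trans (pf i))// ltry.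
  have fp i : fine (p i) <= `|f i| by rewrite -lee_fin -pfin.
  rewrite (esumID [set` F])// setTI setTI esum_fset//.
  rewrite fsbig_finite//= set_fsetK.
  have tail0 : (0 <= \esum_(i in ~` [set` F]) p i)%E by exact: esum_ge0.
  have tailt : (\esum_(i in ~` [set` F]) p i <= t%:E)%E.
    apply: ge_ereal_sup => _ [A [finA AF] <-].
    rewrite fsbig_finite//=; under eq_bigr do rewrite pfin.
    rewrite sumEFin lee_fin; apply: le_trans (ft (fset_set A) _).
      by apply: ler_sum => i _.
    apply/fdisjointP => i; rewrite in_fset_set// inE => /AF /= iF.
    exact/negP.
  exists (fine (\esum_(i in ~` [set` F]) p i)).
    by rewrite fine_ge0//= -lee_fin fineK// ge0_fin_numE// (le_lt_trans tailt)// ltry.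
  rewrite EFinD -sumEFin fineK; last by rewrite ge0_fin_numE// (le_lt_trans tailt)// ltry.
  by congr (_ + _)%E; apply: eq_bigr => i _; rewrite -pfin.
have [|i|r /andP[r0 rt] ->] := split_sum (fun i => (EFin \o f)^\+ i)%E.
- by move=> i; exact: funepos_ge0.
- rewrite funeposE/= -EFin_max lee_fin ge_max normr_ge0 andbT; exact: ler_norm.
have [|i|s /andP[s0 st] ->] := split_sum (fun i => (EFin \o f)^\- i)%E.
- by move=> i; exact: funeneg_ge0.
- rewrite funenegE/= -EFin_max lee_fin ge_max normr_ge0 andbT -normrN; exact: ler_norm.
rewrite -EFinB /= [X in `|X|](_ : _ = r - s); last first.
  rewrite (_ : \sum_(i <- F) f i = \sum_(i <- F) fine ((EFin \o f)^\+ i)%E - \sum_(i <- F) fine ((EFin \o f)^\- i)%E).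
    by ring.
  rewrite -sumrB; apply: eq_bigr => i _.
  rewrite funeposE funenegE/= -!EFin_max/= /Num.max.
  by case: (ltP (f i) 0); case: (ltP (- f i) 0) => ? ?; lra.
by rewrite ler_norml; apply/andP; split; lra.
Qed.

Lemma complex_sum_approx (I : choiceType) (f : I -> R[i]) (F : {fset I}) (t : R) :
  (forall A : {fset I}, [disjoint A & F]%fset -> \sum_(i <- A) normc (f i) <= t) ->
  normc (complex_sum f - \sum_(i <- F) f i) <= 2 * t.
Proof.
move=> ft; apply: le_trans (normc_ReIm _) _; rewrite !raddfB/= [complex.Re (\sum_(_ <- _) _)]raddf_sum [complex.Im (\sum_(_ <- _) _)]raddf_sum.
rewrite mulr_natl mulr2n; apply: lerD; apply: real_sum_approx => A AF;
  apply: le_trans (ft A AF); apply: ler_sum => i _; [exact: normc_Re|exact: normc_Im].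
Qed.

End Sums.

Section TorusIntLinear.
Context {R : realType} {n : nat}.
Implicit Types (f g : 'rV[R]_n -> R[i]).

Lemma lip_lin L L' (c : R[i]) f g : lip L f -> lip L' g ->
  lip (normc c * L + L') (fun x => c * f x + g x).
Proof.
move=> fL gL x j s t; rewrite opprD addrACA -mulrBr mulrDl -mulrA.
apply: le_trans (le_normcD _ _) (lerD _ (gL _ _ _ _)); rewrite normcM.
by apply: ler_wpM2l; [exact: Defs.normc_ge0|exact: fL].
Qed.

Lemma torus_int_lin L L' (c : R[i]) f g : 0 <= L -> 0 <= L' -> lip L f -> lip L' g ->
  torus_int (fun x => c * f x + g x) = c * torus_int f + torus_int g.
Proof.
move=> L0 L'0 fL gL; apply: normc_eq => e e0.
have M0 : 0 <= normc c * L + L' by rewrite addr_ge0// mulr_ge0 ?Defs.normc_ge0.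
pose d := e / (normc c + 2); have c2 : 0 < normc c + 2 by rewrite ltr_wpDl ?Defs.normc_ge0.
have d0 : 0 < d by rewrite divr_gt0.
have [N1 H1] := torus_int_lim M0 (lip_lin c fL gL) d0.
have [N2 H2] := torus_int_lim L0 fL d0; have [N3 H3] := torus_int_lim L'0 gL d0.
pose N := maxn N1 (maxn N2 N3).
have {}H1 := H1 N (leq_maxl _ _).
have {}H2 := H2 N (leq_trans (leq_maxl _ _) (leq_maxr _ _)).
have {}H3 := H3 N (leq_trans (leq_maxr _ _) (leq_maxr _ _)).
have {H2} H2 : normc (c * (torus_int f - mean N.+1 f)) <= normc c * d.
  by rewrite normcM ler_wpM2l ?Defs.normc_ge0.
rewrite meanD meanZ in H1.
have -> : torus_int (fun x => c * f x + g x) - (c * torus_int f + torus_int g) =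
   (torus_int (fun x => c * f x + g x) - (c * mean N.+1 f + mean N.+1 g)) -
   (c * (torus_int f - mean N.+1 f) + (torus_int g - mean N.+1 g)) by ring.
apply: le_trans (le_normcB _ _) _; apply: le_trans (lerD H1 (le_normcD _ _)) _.
apply: le_trans (lerD (lexx _) (lerD H2 H3)) _.
by rewrite /d le_eqVlt; apply/orP; left; apply/eqP; field; rewrite gt_eqF.
Qed.

Lemma torus_int0 : torus_int ((fun=> 0) : 'rV[R]_n -> R[i]) = 0.
Proof.
have l0 : lip 0 ((fun=> 0) : 'rV[R]_n -> R[i]) by move=> x j s t; rewrite subrr normc0 mul0r.
have := @torus_int_norm R n 0 (fun=> 0) 0 (lexx _) l0; rewrite normc0 => /(_ (fun=> lexx _)) h.
by apply/eq0_normc/le_anti; rewrite h Defs.normc_ge0.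
Qed.

Lemma torus_int_sum (I : Type) (r : seq I) (c : I -> R[i]) (f : I -> 'rV[R]_n -> R[i]) :
  (forall i, exists2 L, 0 <= L & lip L (f i)) ->
  (exists2 L, 0 <= L & lip L (fun x => \sum_(i <- r) c i * f i x)) /\
  torus_int (fun x => \sum_(i <- r) c i * f i x) = \sum_(i <- r) c i * torus_int (f i).
Proof.
move=> fL; elim: r => [|i r [[L L0 rL] IH]].
  rewrite big_nil (_ : (fun x => _) = fun=> 0); last by apply/funext => x; rewrite big_nil.
  by split; [exists 0 => // x j s t; rewrite subrr normc0 mul0r|exact: torus_int0].
have [L' L'0 iL] := fL i.
rewrite (_ : (fun x => _) = fun x => c i * f i x + \sum_(j <- r) c j * f j x); last first.
  by apply/funext => x; rewrite big_cons.
rewrite big_cons (torus_int_lin (c i) L'0 L0 iL rL) IH; split=> //.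
exists (normc (c i) * L' + L); last exact: lip_lin.
by rewrite addr_ge0// mulr_ge0 ?Defs.normc_ge0.
Qed.

End TorusIntLinear.

Section PdoBand.
Context {R : realType} {n : nat}.
Local Notation Z := ('rV[int]_n).
Local Notation H := (ell2 R Z).
Implicit Types (u v w : Z -> R[i]) (k l m : Z) (D : nat) (C B : R) (x : 'rV[R]_n).
Variables (sigma : Z -> 'rV[R]_n -> R[i]) (C : R).
Hypothesis sigma_tame : forall k, tame C (sigma k).

(** The coefficients of the operator: it maps u to the family of the sums over m
   of [kernel k m * u (k + m)]. *)
Definition kernel k m : R[i] := fcoef (sigma k) m.

Lemma kernel_dominated : dominated C kernel.
Proof. by move=> k m; apply: fcoef_decay. Qed.

Let C0 : 0 <= C := tame_ge0 (sigma_tame 0).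

Lemma decay1_le1 z : decay1 z <= 1 :> R.
Proof.
rewrite /decay1; case: eqP => // /eqP z0; rewrite invf_le1 ?exprn_even_gt0 ?intr_eq0//.
rewrite -[z%:~R ^+ 2]real_normK ?num_real// exprn_ege1// -intr_norm -abszE.
by rewrite -[1]/(1%:~R) ler_int lez_nat absz_gt0.
Qed.

Lemma decay_le1 m : decay R m <= 1.
Proof.
apply: (@le_trans _ _ (\prod_(j < n) (1 : R))); last by rewrite big1.
by apply: ler_prod => j _; rewrite ltW ?decay1_gt0// decay1_le1.
Qed.

Lemma coord_le_norm k j : `|(k 0 j)%:~R| <= euclid_norm k :> R.
Proof.
rewrite -sqrtr_sqr ler_wsqrtr// (bigD1 j)//= lerDl.
by apply: sumr_ge0 => i _; rewrite sqr_ge0.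
Qed.

Lemma decay_polynomial k : 1 <= (1 + euclid_norm k) ^+ n.*2 * decay R k.
Proof.
have N0 : 0 <= euclid_norm k :> R by exact: sqrtr_ge0.
rewrite -muln2 mulnC exprM -[X in _ ^+ X * _]card_ord -prodr_const -big_split/=.
rewrite -[leLHS](_ : \prod_(j < n) (1 : R) = 1); last by rewrite big1.
apply: ler_prod => j _; rewrite ler01/= /decay1; case: eqP => [_|/eqP z0].
  by rewrite mulr1 exprn_ege1// lerDl.
rewrite ler_pdivlMr ?exprn_even_gt0 ?intr_eq0// mul1r.
rewrite -[leLHS]real_normK ?num_real// ler_pXn2r ?nnegrE ?addr_ge0//.
by apply: le_trans (coord_le_norm k j) _; rewrite lerDr.
Qed.

(** A power 2n of the growth pays for the summable weight; the power p that is left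
   bounds the derivatives of the Fourier series. *)
Lemma rapid_decay u (p : nat) : rapidly_decreasing u ->
  exists2 B, 0 <= B & forall k, (1 + euclid_norm k) ^+ p * normc (u k) <= B * decay R k.
Proof.
move=> /(_ (n.*2 + p)%N)[B BP].
have N0 k : 0 <= 1 + euclid_norm k :> R by rewrite addr_ge0 ?sqrtr_ge0.
have B0 : 0 <= B.
  by apply: le_trans (BP 0); rewrite mulr_ge0 ?exprn_ge0 ?Defs.normc_ge0.
exists B => // k; apply: le_trans (ler_wpM2r (decay_ge0 k) (BP k)).
rewrite exprD -mulrA mulrAC ler_peMl ?decay_polynomial//.
by rewrite mulr_ge0 ?exprn_ge0 ?Defs.normc_ge0.
Qed.

Section RapidlyDecreasing.
Variables (u : Z -> R[i]) (B : R).
Hypotheses (B0 : 0 <= B) (uB : forall k, (1 + euclid_norm k) ^+ 1 * normc (u k) <= B * decay R k).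

Let u_le k : normc (u k) <= B * decay R k.
Proof.
apply: le_trans (uB k); rewrite expr1 ler_peMl ?Defs.normc_ge0// lerDl.
exact: sqrtr_ge0.
Qed.

Definition fourier_partial D x : R[i] := \sum_(l <- box D) u l * echar (- l) x.

Lemma fourier_approx D x : normc (fourier u x - fourier_partial D x) <= 2 * (B * tail R n D).
Proof.
rewrite /fourier /fourier_partial.
have -> : (fun k => expi (- (2 * pi * dotZR k x)) * u k) = (fun k => u k * echar (- k) x).
  by apply/funext => k; rewrite mulrC /echar dotZRNl mulrN.
apply: complex_sum_approx => A AD.
apply: (@le_trans _ _ (\sum_(l <- A) B * decay R l)).
  by apply: ler_sum => l _; rewrite normcM normc_echar mulr1.
by rewrite -mulr_sumr; apply: ler_wpM2l => //; apply: sum_decay_tail.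
Qed.

Let L : R := 4 * pi * (B * decay_total R n).

Let L0 : 0 <= L.
Proof. by rewrite !mulr_ge0 ?pi_ge0 ?decay_total_ge0. Qed.

Lemma fourier_partial_lip D : lip L (fourier_partial D).
Proof.
move=> x j s t; rewrite /fourier_partial -sumrB.
apply: le_trans (le_normc_sum _ _ _) _.
apply: (@le_trans _ _ (\sum_(l <- box D) 4 * pi * (B * decay R l) * `|s - t|)).
  apply: ler_sum => l _; rewrite -mulrBr normcM.
  apply: le_trans (ler_wpM2l (Defs.normc_ge0 _) (expi_lip _ _)) _.
  have -> : 2 * pi * dotZR (- l) (set_coord x j s) - 2 * pi * dotZR (- l) (set_coord x j t)
     = 2 * pi * (- (l 0 j)%:~R * (s - t)).
    have -> : set_coord x j s = set_coord x j t + (s - t) *: delta_mx 0 j.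
      by rewrite set_coord_shift [t + _]addrC subrK.
    by rewrite dotZRDr dotZR_delta mxE mulrNz; ring.
  rewrite !normrM normrN (ger0_norm (_ : 0 <= 2))// (ger0_norm (pi_ge0 _)).
  rewrite [leLHS](_ : _ = 4 * pi * (normc (u l) * `|(l 0 j)%:~R|) * `|s - t|); last by ring.
  apply: ler_wpM2r => //; apply: ler_wpM2l; first by rewrite mulr_ge0 ?pi_ge0.
  apply: le_trans (uB l); rewrite mulrC expr1; apply: ler_wpM2r; first exact: Defs.normc_ge0.
  by apply: le_trans (coord_le_norm l j) _; rewrite lerDr.
rewrite -mulr_suml -mulr_sumr -mulr_sumr; apply: ler_wpM2r => //.
apply: ler_wpM2l; first by rewrite mulr_ge0 ?pi_ge0.
by apply: ler_wpM2l => //; apply: sum_decay.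
Qed.

Lemma fourier_partial_norm D x : normc (fourier_partial D x) <= B * decay_total R n.
Proof.
apply: le_trans (le_normc_sum _ _ _) _.
apply: (@le_trans _ _ (\sum_(l <- box D) B * decay R l)).
  by apply: ler_sum => l _; rewrite normcM normc_echar mulr1.
by rewrite -mulr_sumr; apply: ler_wpM2l => //; apply: sum_decay.
Qed.

Let approx_small e : 0 < e -> exists D0, forall D, (D0 <= D)%N -> 2 * (B * tail R n D) <= e.
Proof.
move=> e0; have c0 : 0 < 2 * B + 1 by rewrite ltr_wpDl// mulr_ge0.
have [D0 DP] := @tail_small R n _ (divr_gt0 e0 c0); exists D0 => D /DP.
rewrite ler_pdivlMr// => h; apply: le_trans h; have := @tail_ge0 R n D; nra.
Qed.

Lemma fourier_lip : lip L (fourier u).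
Proof.
move=> x j s t; apply/ler_addgt0Pr => e e0; have e20 : 0 < e / 2 by rewrite divr_gt0.
have [D /(_ D (leqnn _)) DP] := approx_small e20.
have h1 := fourier_approx D (set_coord x j s); have h2 := fourier_approx D (set_coord x j t).
have h3 := fourier_partial_lip D x j s t.
apply: le_trans (le_normc_dist _ _ (fourier_partial D (set_coord x j s))) _.
have := le_normc_dist (fourier_partial D (set_coord x j s)) (fourier u (set_coord x j t))
  (fourier_partial D (set_coord x j t)).
by rewrite [X in _ <= _ + X]normc_distC => h4; lra.
Qed.

Lemma fourier_norm x : normc (fourier u x) <= B * decay_total R n.
Proof.
apply/ler_addgt0Pr => e e0; have [D /(_ D (leqnn _)) DP] := approx_small e0.
have h1 := fourier_approx D x; have h2 := fourier_partial_norm D x.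
have := le_normcD (fourier u x - fourier_partial D x) (fourier_partial D x).
by rewrite subrK => h3; lra.
Qed.

(** Integrating the Fourier series of [u] term by term. *)
Lemma pdo_approx D k :
  normc (pdo sigma u k - \sum_(l <- box D) u l * kernel k (l - k)) <= C * (2 * (B * tail R n D)).
Proof.
have [Ls Ls0 sL] := tame_twist k (sigma_tame k).
have sN x : normc (echar k x * sigma k x) <= C.
  by rewrite normcM normc_echar mul1r; apply: tame_norm (sigma_tame k) x.
have W0 : 0 <= B * decay_total R n by rewrite mulr_ge0 ?decay_total_ge0.
pose M := Ls * (B * decay_total R n) + C * L.
have M0 : 0 <= M by apply: addr_ge0; apply: mulr_ge0.
have pdoE : pdo sigma u k = torus_int (fun x => echar k x * sigma k x * fourier u x) by [].
have sumE : torus_int (fun x => echar k x * sigma k x * fourier_partial D x) =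
    \sum_(l <- box D) u l * kernel k (l - k).
  have fl l : exists2 L', 0 <= L' & lip L' (fun x => echar (- (l - k)) x * sigma k x).
    exact: tame_twist (sigma_tame k).
  have [_ <-] := torus_int_sum (box D) u fl.
  congr torus_int; apply/funext => x; rewrite /fourier_partial mulr_sumr.
  by apply: eq_bigr => l _; rewrite opprB echarDl; ring.
rewrite pdoE -sumE; apply: (@torus_int_dist _ _ M) => //.
- exact: lip_mul sN fourier_norm Ls0 L0 sL fourier_lip.
- exact: lip_mul sN (fourier_partial_norm D) Ls0 L0 sL (fourier_partial_lip D).
move=> x; rewrite -mulrBr normcM; apply: ler_pM; rewrite ?Defs.normc_ge0//.
exact: fourier_approx.
Qed.

End RapidlyDecreasing.

Lemma pdo_band_limit (T : H -> H) (u : H) :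
  (forall D (u : H), ell2_norm (T u - band D kernel u : H) <= C * tail R n D * ell2_norm u) ->
  rapidly_decreasing u -> T u = pdo sigma u :> (Z -> R[i]).
Proof.
move=> TP /(rapid_decay 1)[B B0 uB]; apply/funext => k; apply: normc_eq => e e0.
have u_le l : normc (u l) <= B * decay R l.
  apply: le_trans (uB l); rewrite expr1 ler_peMl ?Defs.normc_ge0// lerDl.
  exact: sqrtr_ge0.
pose c := C * ell2_norm u + C * B + C * (2 * B) + 1.
have c0 : 0 < c.
  by rewrite ltr_wpDl// !addr_ge0 ?mulr_ge0 ?nm_ge0.
have [D DP] := @tail_small R n _ (divr_gt0 e0 c0).
have [K kK] := in_some_box k; pose D' := (D + K)%N.
have h1 : normc (T u k - band D' kernel u k) <= C * tail R n D' * ell2_norm u.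
  exact: le_trans (nm_coord (T u - band D' kernel u) k) (TP D' u).
have h2 := pdo_approx B0 uB D k.
have h3 : normc (band D' kernel u k - \sum_(l <- box D) u l * kernel k (l - k)) <= C * (B * tail R n D).
  rewrite (bandE _ _ _ kernel_dominated).
  pose A := [fset (k + m)%R | m in @box n D']%fset.
  have -> : \sum_(m <- box D') kernel k m * u (k + m) = \sum_(l <- A) u l * kernel k (l - k).
    rewrite [RHS]big_imfset/=; last by move=> l m _ _ /= /addrI.
    by apply: eq_bigr => m _; rewrite mulrC addrAC subrr add0r.
  have DA : (box D `<=` A)%fset.
    apply/fsubsetP => l lD; apply/imfsetP; exists (l - k); last by rewrite addrC subrK.
    by apply: boxD => //; rewrite boxN.
  rewrite (big_fsetID _ (mem (box D)) A)/=.
  have -> : [fset m in A | m \in @box n D]%fset = box D.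
    by apply/fsetP => m; rewrite !inE/= andb_idl// => /(fsubsetP DA).
  rewrite addrAC subrr add0r; apply: le_trans (le_normc_sum _ _ _) _.
  apply: (@le_trans _ _ (\sum_(l <- [fset m in A | m \notin @box n D]%fset) C * (B * decay R l))).
    apply: ler_sum => l _; rewrite normcM mulrC; apply: ler_pM; rewrite ?Defs.normc_ge0//.
    by apply: le_trans (kernel_dominated k _) _; rewrite ler_piMr// decay_le1.
  rewrite -mulr_sumr -mulr_sumr; apply: ler_wpM2l => //; apply: ler_wpM2l => //.
  by apply: sum_decay_tail; apply/fdisjointP => m; rewrite !inE/= => /andP[].
have {}DP : tail R n D * c <= e by rewrite -ler_pdivlMr//; apply: DP.
have tD : tail R n D' <= tail R n D.
  by rewrite lerD2l lerN2; apply: decay_sum_le; rewrite leq_addr.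
have h1' : C * tail R n D' * ell2_norm u <= C * tail R n D * ell2_norm u.
  by apply: ler_wpM2r; [exact: nm_ge0|exact: ler_wpM2l].
apply: le_trans (le_normc_dist _ _ (band D' kernel u k)) _.
apply: le_trans (lerD (le_trans h1 h1') (le_normc_dist _ _ (\sum_(l <- box D) u l * kernel k (l - k)))) _.
rewrite [X in _ + (_ + X)]normc_distC; apply: le_trans (lerD (lexx _) (lerD h3 h2)) _.
apply: le_trans DP; rewrite /c; have := @tail_ge0 R n D.
move: (tail R n D) (ell2_norm u) => t p t0; nra.
Qed.

Lemma restrict_rapid (F : {fset Z}) (u : H) : rapidly_decreasing (restrict (mem F) u).
Proof.
move=> N; exists (\sum_(k <- F) (1 + euclid_norm k) ^+ N * normc (u k)) => k.
have t0 l : 0 <= (1 + euclid_norm l) ^+ N * normc (u l).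
  by rewrite mulr_ge0 ?Defs.normc_ge0// exprn_ge0// addr_ge0// sqrtr_ge0.
rewrite restrictE /=; case: ifP => kF; last by rewrite normc0 mulr0 sumr_ge0.
by rewrite (big_fsetD1 k)//= lerDl sumr_ge0.
Qed.

(** Finitely supported elements are rapidly decreasing, and they are dense. *)
Lemma bounded_extension_unique (S T : H -> H) :
  bounded_extension sigma S -> bounded_extension sigma T -> S = T.
Proof.
move=> [Sl [M SM] SE] [Tl [M' TM'] TE]; apply/funext => u; apply: nm_eq => e e0.
have bnd (V : H -> H) (K : R) (v : H) : `|V v| <= K%:C * `|v| -> ell2_norm (V v) <= K * ell2_norm v.
  by rewrite !ell2_normE -rmorphM lecR.
pose c := `|M| + `|M'| + 1; have c0 : 0 < c by rewrite ltr_wpDl// addr_ge0.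
have [F FP] := finite_support_dense u (divr_gt0 e0 c0).
pose v := restrict (mem F) u.
have -> : S u - T u = S (u - v) - T (u - v).
  have Sv : S v = T v by apply/val_inj; rewrite /= SE ?TE//; exact: restrict_rapid.
  by rewrite (linB Sl) (linB Tl) Sv opprB addrA subrK.
apply: le_trans (nmB _ _) _.
have hS := le_trans (bnd _ _ _ (SM (u - v))) (ler_wpM2r (nm_ge0 _) (ler_norm M)).
have hT := le_trans (bnd _ _ _ (TM' (u - v))) (ler_wpM2r (nm_ge0 _) (ler_norm M')).
apply: le_trans (lerD hS hT) _; move: FP; rewrite ler_pdivlMr// /c => FP; apply: le_trans FP.
have := nm_ge0 (u - v); rewrite -/v; move: (ell2_norm _) `|M| `|M'| => p q t p0; lra.
Qed.

(** The bounded extension is identified with the norm limit of the truncations to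
   finitely many diagonals. Everything that follows uses the operator through
   this approximation only. *)
Lemma pdo_ell2_band : linear (pdo_ell2 sigma) /\
  forall D (u : H), ell2_norm (pdo_ell2 sigma u - band D kernel u : H) <= C * tail R n D * ell2_norm u.
Proof.
have [T Tl TP] := band_limit kernel_dominated.
suff -> : pdo_ell2 sigma = T by [].
have Text : bounded_extension sigma T.
  split=> //; last by move=> u; apply: pdo_band_limit.
  exists (C * tail R n 0 + C * decay_total R n) => u; rewrite !ell2_normE -rmorphM lecR mulrDl.
  apply: le_trans (nm_le_add _ (band 0 kernel u)) _.
  by apply: lerD; [exact: TP|exact: nm_band kernel_dominated].
rewrite /pdo_ell2; case: xgetP => [S _ Sext|/(_ T) //].
exact: bounded_extension_unique.
Qed.

End PdoBand.

(** * Slowly oscillating symbols and the parametrix *)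

Section Oscillation.
Context {R : realType} {n : nat}.
Local Notation Z := ('rV[int]_n).
Implicit Types (k l m p q : Z) (D : nat) (x : 'rV[R]_n).

Lemma euclid_notin_box k D : k \notin box D -> D%:R <= euclid_norm k :> R.
Proof.
rewrite in_box negb_forall => /existsP[j]; rewrite -ltnNge => Dk.
apply: le_trans (coord_le_norm k j); rewrite -intr_norm -abszE.
by rewrite -[D%:R]/(D%:~R) ler_int lez_nat ltnW.
Qed.

Lemma euclid_box k D : k \in box D -> euclid_norm k <= (n * D)%:R :> R.
Proof.
move=> /boxP kD; rewrite -[leRHS]ger0_norm// -sqrtr_sqr ler_wsqrtr//.
apply: (@le_trans _ _ ((\sum_j `|(k 0 j)%:~R|) ^+ 2)).
  rewrite expr2 mulr_suml; apply: ler_sum => j _.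
  rewrite -[leLHS]real_normK ?num_real// expr2; apply: ler_wpM2l => //.
  by rewrite (bigD1 j)//= lerDl sumr_ge0.
rewrite ler_pXn2r ?nnegrE ?sumr_ge0//.
apply: (@le_trans _ _ (\sum_(j < n) D%:R)); last by rewrite sumr_const card_ord -[D%:R *+ n]mulr_natr -natrM mulnC.
apply: ler_sum => j _; rewrite -intr_norm -abszE -[D%:R]/(D%:~R) ler_int lez_nat.
exact: kD.
Qed.

(** A gain of [Lambda] in the difference estimates means that the symbol is almost
   constant on boxes of a fixed size that are far away. *)
Definition oscillates_slowly (sigma : Z -> 'rV[R]_n -> R[i]) := forall p e, 0 < e ->
  exists D, forall k, k \notin box D -> forall x, normc (sigma (k + p) x - sigma k x) <= e.

(** The directions of slow oscillation form a subgroup of the lattice. *)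
Lemma oscillates_slowly_generators (sigma : Z -> 'rV[R]_n -> R[i]) :
  (forall j e, 0 < e -> exists D, forall k, k \notin box D -> forall x,
     normc (sigma (k + delta_mx 0 j) x - sigma k x) <= e) ->
  oscillates_slowly sigma.
Proof.
move=> gen; pose P p := forall e, 0 < e ->
  exists D, forall k, k \notin box D -> forall x, normc (sigma (k + p) x - sigma k x) <= e.
have P0 : P 0 by move=> e e0; exists 0%N => k _ x; rewrite addr0 subrr normc0 ltW.
have PD p q : P p -> P q -> P (p + q).
  move=> Pp Pq e e0; have e20 : 0 < e / 2 by rewrite divr_gt0.
  have [D1 H1] := Pp _ e20; have [D2 H2] := Pq _ e20; have [K pK] := in_some_box p.
  exists (D1 + (D2 + K))%N => k kD x.
  apply: le_trans (le_normc_dist _ _ (sigma (k + p) x)) _; rewrite [leRHS]splitr addrA.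
  apply: lerD; [apply: H2|apply: H1].
    apply: notin_boxD pK; apply: contra kD; apply/fsubsetP/box_le; exact: leq_addl.
  by apply: contra kD; apply/fsubsetP/box_le; exact: leq_addr.
have PN p : P p -> P (- p).
  move=> Pp e e0; have [D H] := Pp _ e0; have [K pK] := in_some_box p.
  exists (D + K)%N => k kD x; rewrite normc_distC -{1}[k](subrK p).
  by apply: H; apply: notin_boxD kD _; rewrite boxN.
have Pn p (a : nat) : P p -> P (p *+ a).
  by move=> Pp; elim: a => [|a IH]; rewrite ?mulr0n// mulrS; apply: PD.
have Pz p (z : int) : P p -> P (z *: p).
  case: z => a Pp.
    by rewrite (_ : _ *: p = p *+ a); [exact: Pn|rewrite -scaler_nat natz].
  rewrite NegzE scaleNr; apply: PN.
  by rewrite (_ : _ *: p = p *+ a.+1); [exact: Pn|rewrite -scaler_nat natz].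
move=> p; rewrite [p]row_sum_delta; elim/big_ind: _ => // j _; apply: Pz; exact: gen.
Qed.

Lemma Delta_single (V : zmodType) j (f : Z -> V) :
  Delta (fun i => (i == j)%N : nat) f = Delta1 j f.
Proof.
rewrite /Delta; suff H js : uniq js ->
    foldr (fun i h => iter (i == j) (Delta1 i) h) f js = if j \in js then Delta1 j f else f.
  by rewrite H ?enum_uniq// mem_enum.
elim: js => //= i js IH /andP[ijs ujs]; rewrite IH// inE eq_sym.
by case: (eqVneq i j) ijs => [->|_] /=; [move=> /negPf ->|].
Qed.

(** The first differences are bounded by [Lambda k `^ (- rho)], which tends to zero
   because the weight grows at least like a power. *)
Lemma S_class_slow (Lambda : Z -> R) (mu0 mu1 mu rho : R) sigma :
  is_weight mu0 mu1 mu Lambda -> 0 < rho -> S_class Lambda rho 0 sigma ->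
  oscillates_slowly sigma.
Proof.
move=> [mu00 _ _ L0 [[C0 [C1 [C00 _ LC]]] _]] rho0 [_ bd].
apply: oscillates_slowly_generators => j e e0.
have [C CP0 CP] := bd (fun i => (i == j)%N : nat) (fun=> 0%N).
have mi1 : mi_abs (fun i => (i == j)%N : nat) = 1%N.
  by rewrite /mi_abs (bigD1 j)//= eqxx big1// => i /negPf ->.
pose a := C / (e * C0 `^ rho); pose b := a `^ (mu0 * rho)^-1.
exists (Num.truncn b).+1 => k kD x.
have DP : b <= 1 + euclid_norm k.
  apply: (@le_trans _ _ (euclid_norm k)); last by rewrite lerDr.
  by apply: le_trans (euclid_notin_box kD); apply/ltW/truncnS_gt.
have := CP k x; rewrite mi1 mulr1 sub0r powRN /Dx.
have -> : (fun y => Delta (fun i => (i == j)%N : nat) (sigma^~ y) k) = fun y => Delta1 j (sigma^~ y) k.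
  by apply/funext => y; rewrite Delta_single.
rewrite (_ : foldr _ _ _ = fun y => Delta1 j (fun l => sigma l y) k); last first.
  by elim: (enum 'I_n).
rewrite /Delta1 => h; apply: le_trans h _.
have C0r : 0 < C0 `^ rho by apply: powR_gt0.
have a0 : 0 < a by rewrite divr_gt0 ?mulr_gt0.
have Lr : 0 < Lambda k `^ rho by apply/powR_gt0/L0.
rewrite ler_pdivrMr// -ler_pdivrMl//.
suff : a * C0 `^ rho <= Lambda k `^ rho.
  by rewrite /a invfM mulrA divfK ?gt_eqF// mulrC.
have N0 : 0 <= 1 + euclid_norm k :> R by rewrite addr_ge0 ?sqrtr_ge0.
apply: (@le_trans _ _ ((C0 * (1 + euclid_norm k) `^ mu0) `^ rho)); last first.
  apply: ge0_ler_powR; rewrite ?nnegrE ?(ltW rho0) ?(ltW (L0 k))//.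
    by rewrite mulr_ge0 ?powR_ge0 ?ltW.
  by have /andP[] := LC k.
rewrite powRM ?powR_ge0 ?(ltW C00)// mulrC; apply: ler_wpM2l; first exact: ltW.
rewrite -powRrM -[a](_ : b `^ (mu0 * rho) = a); last first.
  by rewrite -powRrM mulVf ?powRr1 ?(ltW a0)// gt_eqF// mulr_gt0.
by apply: ge0_ler_powR => //; rewrite ?nnegrE ?powR_ge0// ltW// mulr_gt0.
Qed.

End Oscillation.

Section CoefficientIdentities.
Context {R : realType} {n : nat}.
Local Notation Z := ('rV[int]_n).
Implicit Types (f g : 'rV[R]_n -> R[i]) (m p : Z) (C : R) (D : nat).

Lemma lip_le L L' f : L <= L' -> lip L f -> lip L' f.
Proof. by move=> LL' fL x j s t; apply: le_trans (fL x j s t) _; apply: ler_wpM2r. Qed.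

Lemma fcoef_dist C C' f g m e : tame C f -> tame C' g ->
  (forall x, normc (f x - g x) <= e) -> normc (fcoef f m - fcoef g m) <= e.
Proof.
move=> fC gC fg; have [L L0 fL] := tame_twist (- m) fC; have [L' L'0 gL] := tame_twist (- m) gC.
have M0 : 0 <= L + L' by rewrite addr_ge0.
apply: (torus_int_dist M0); [apply: lip_le fL|apply: lip_le gL|]; rewrite ?lerDl ?lerDr//.
by move=> x; rewrite -mulrBr normcM normc_echar mul1r.
Qed.

Lemma torus_int1 : torus_int ((fun=> 1) : 'rV[R]_n -> R[i]) = 1.
Proof.
have l0 : lip 0 ((fun=> 1) : 'rV[R]_n -> R[i]) by move=> x j s t; rewrite subrr normc0 mul0r.
have m1 N : mean N.+1 ((fun=> 1) : 'rV[R]_n -> R[i]) = 1.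
  rewrite /mean; elim: (enum 'I_n) (0 : 'rV[R]_n) => //= j js IH x; rewrite /avg1.
  under eq_bigr do rewrite IH.
  by rewrite sumr_const card_ord mulVf ?pnatr_eq0.
apply: normc_eq => e e0; have [N /(_ N (leqnn _))] := torus_int_lim (lexx _) l0 e0.
by rewrite m1.
Qed.

Lemma torus_int_echar m : torus_int (echar m : 'rV[R]_n -> R[i]) = (m == 0)%:R.
Proof.
case: eqVneq => [->|m0].
  rewrite -[RHS]torus_int1; congr torus_int; apply/funext => x; exact: echar0l.
have [j mj] : exists j, m 0 j != 0 by apply/rV0Pn.
pose x : 'rV[R]_n := (2 * (m 0 j)%:~R)^-1 *: delta_mx 0 j.
have mjR : (m 0 j)%:~R != 0 :> R by rewrite intr_eq0.
have ex : echar m x = - 1.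
  rewrite /echar dotZR_delta /expi.
  have -> : 2 * pi * ((m 0 j)%:~R * (2 * (m 0 j)%:~R)^-1) = pi :> R by field.
  by rewrite cospi sinpi; apply/eqP; rewrite eq_complex/= oppr0 !eqxx.
have L0 : 0 <= 4 * pi * \sum_j `|(m 0 j)%:~R| :> R by rewrite !mulr_ge0 ?pi_ge0 ?sumr_ge0.
have := torus_int_translate x L0 (@lip_echar R n m) (@echar_periodic R n m).
under eq_fun do rewrite echarDr ex mulrN1 -mulN1r -[- 1 * _]addr0.
have l0 : lip 0 ((fun=> 0) : 'rV[R]_n -> R[i]) by move=> z i s t; rewrite subrr normc0 mul0r.
rewrite (torus_int_lin _ L0 (lexx _) (@lip_echar R n m) l0) torus_int0 addr0 mulN1r.
by move=> /eqP; rewrite eq_sym -addr_eq0 -mulr2n mulrn_eq0 /= => /eqP.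
Qed.

(** The Fourier coefficients of two inverse functions are inverse to each other
   for the convolution product: expand f in the coefficients of 1 = f g. *)
Lemma fcoef_inverse C C' f g D m : tame C f -> tame C' g -> (forall x, f x * g x = 1) ->
  normc ((m == 0)%:R - \sum_(p <- box D) fcoef f p * fcoef g (m - p)) <= C' * (C * tail R n D).
Proof.
move=> fC gC fg.
have gl p : exists2 L, 0 <= L & lip L (fun x => echar (- (m - p)) x * g x).
  exact: tame_twist gC.
have [[L L0 sL] <-] := torus_int_sum (box D) (fcoef f) gl.
rewrite -oppr_eq0 -torus_int_echar.
have M0 : 0 <= L + 4 * pi * \sum_j `|((- m) 0 j)%:~R| by rewrite addr_ge0// !mulr_ge0 ?pi_ge0 ?sumr_ge0.
apply: (torus_int_dist M0).
- apply: lip_le (lip_echar (- m)); by rewrite lerDr.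
- by apply: lip_le sL; rewrite lerDl !mulr_ge0 ?pi_ge0 ?sumr_ge0.
move=> x; have -> : echar (- m) x - \sum_(p <- box D) fcoef f p * (echar (- (m - p)) x * g x) =
    echar (- m) x * g x * (f x - \sum_(p <- box D) fcoef f p * echar p x).
  rewrite mulrBr -mulrA [g x * f x]mulrC fg mulr1 mulr_sumr; congr (_ - _).
  by apply: eq_bigr => p _; rewrite opprB [p - m]addrC echarDl; ring.
rewrite !normcM normc_echar mul1r; apply: ler_pM; rewrite ?Defs.normc_ge0//.
  exact: tame_norm gC x.
exact: fourier_inversion.
Qed.

End CoefficientIdentities.

Section Composition.
Context {R : realType} {n : nat}.
Local Notation Z := ('rV[int]_n).
Local Notation H := (ell2 R Z).
Implicit Types (u v w : H) (a b : Z -> Z -> R[i]) (k l m p q : Z) (D : nat) (C : R).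

Lemma sum_decay_shift (A : {fset Z}) p : \sum_(m <- A) decay R (m - p) <= decay_total R n.
Proof. by rewrite -(sum_imfset A (decay R) (@addIr _ (- p))) sum_decay. Qed.

Lemma sum_decay_shift_tail (A : {fset Z}) p D :
  \sum_(m <- A | m - p \notin box D) decay R (m - p) <= tail R n D.
Proof.
rewrite big_fset_condE/= -(sum_imfset _ (decay R) (@addIr _ (- p))).
apply: sum_decay_tail; apply/fdisjointP => _ /imfsetP[m + ->].
by rewrite !inE/= => /andP[].
Qed.

Lemma sum_box_shift (V : nmodType) D p (F : Z -> V) : p \in box D ->
  \sum_(m <- box (D + D) | m - p \in box D) F m = \sum_(q <- box D) F (p + q).
Proof.
move=> pD; rewrite big_fset_condE/= -(sum_imfset _ F (@addrI _ p)).
apply: eq_fbigl => m; rewrite !inE/=; apply/andP/imfsetP => [[_ mp]|[q qD ->]].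
  by exists (m - p) => //; rewrite addrC subrK.
by rewrite [p + q]addrC addrK; split=> //; apply: boxD.
Qed.

(** Far away, the composition of two banded operators whose kernels are inverse
   for the convolution in each row is close to the identity. There are two
   errors: freezing the row of the second kernel, which is small by slow
   oscillation, and truncating the convolution, small by domination. *)
Lemma band_inverse a b C C' K D1 : dominated C a -> dominated C' b -> 0 <= K ->
  (forall m p e, 0 < e -> exists D, forall k, k \notin box D -> normc (a (k + p) m - a k m) <= e) ->
  (forall k, k \notin box D1 -> forall D m,
     normc ((m == 0)%:R - \sum_(p <- box D) b k p * a k (m - p)) <= K * tail R n D) ->
  forall e, 0 < e -> exists D0, forall D, (D0 <= D)%N -> exists r, forall u,
    ell2_norm (restrict (fun k => k \notin box r) (band D b (band D a u) - u) : H) <= e * ell2_norm u.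
Proof.
move=> aC bC K0 slow conv e e0.
have C0 := dominated_ge0 aC; have C'0 := dominated_ge0 bC.
have W0 := @decay_total_ge0 R n.
pose CW := 2 * (C * C') * decay_total R n + 1.
have CW0 : 0 < CW by rewrite ltr_wpDl// !mulr_ge0.
have e40 : 0 < e / 4 by rewrite divr_gt0.
have [D0 D0P] := @tail_small R n _ (divr_gt0 e40 CW0).
exists D0 => D /D0P {}D0P.
pose c k m : R[i] := \sum_(p <- box D | m - p \in box D) b k p * a k (m - p).
(* the truncation error of the m-th diagonal, with a common D' for all of them *)
pose d D' m : R := \sum_(p <- box D' | ~~ ((p \in box D) && (m - p \in box D))) decay R p * decay R (m - p).
have d0 D' m : 0 <= d D' m.
  by apply: sumr_ge0 => p _; rewrite mulr_ge0 ?decay_ge0.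
have cd k m D' : k \notin box D1 -> (D <= D')%N ->
    normc (c k m - (m == 0)%:R) <= K * tail R n D' + C * C' * d D' m.
  move=> kD1 DD'; rewrite normc_distC.
  apply: le_trans (le_normc_dist _ _ (\sum_(p <- box D') b k p * a k (m - p))) _.
  apply: lerD; first exact: conv.
  rewrite (bigID (fun p => (p \in box D) && (m - p \in box D)))/=.
  have -> : \sum_(p <- box D' | (p \in box D) && (m - p \in box D)) b k p * a k (m - p) = c k m.
    apply: eq_sum_cond => p; case pD: (p \in box D); last by rewrite !andbF.
    by rewrite (fsubsetP (box_le DD') _ pD).
  rewrite addrAC subrr add0r; apply: le_trans (le_normc_sum _ _ _) _.
  rewrite /d mulr_sumr; apply: ler_sum => p _; rewrite normcM.
  rewrite [leRHS](_ : _ = C' * decay R p * (C * decay R (m - p))); last by ring.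
  by apply: ler_pM; rewrite ?Defs.normc_ge0.
have dsum D' : \sum_(m <- box (D + D)) d D' m <= 2 * decay_total R n * tail R n D.
  rewrite /d (exchange_big_dep predT)//=.
  apply: (@le_trans _ _ (\sum_(p <- box D') (if p \in box D then decay R p * tail R n D else decay R p * decay_total R n))).
    apply: ler_sum => p _; rewrite -mulr_sumr; case: ifP => pD; apply: ler_wpM2l; rewrite ?decay_ge0//.
      exact: sum_decay_shift_tail.
    exact: sum_decay_shift.
  rewrite (bigID (fun p => p \in box D))/=.
  rewrite (eq_bigr (fun p => decay R p * tail R n D)); last by move=> p ->.
  rewrite [X in _ + X](eq_bigr (fun p => decay R p * decay_total R n)); last by move=> p /negPf ->.
  rewrite -!mulr_suml -mulrA [2 * _]mulr_natl mulr2n; apply: lerD.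
    apply: ler_wpM2r; first exact: tail_ge0.
    by rewrite big_fset_condE; exact: sum_decay.
  rewrite mulrC; apply: ler_wpM2l => //; rewrite big_fset_condE; apply: sum_decay_tail.
  by apply/fdisjointP => m; rewrite !inE/= => /andP[].
have [D' [DD' D'P]] : exists D', (D <= D')%N /\
    (#|` @box n (D + D)|)%:R * (K * tail R n D') <= e / 4.
  pose N : R := (#|` @box n (D + D)|)%:R * K + 1.
  have N0 : 0 < N by rewrite ltr_wpDl// mulr_ge0.
  have [D2 D2P] := @tail_small R n _ (divr_gt0 e40 N0).
  exists (maxn D D2); split; first exact: leq_maxl.
  have := D2P _ (leq_maxr D D2); rewrite ler_pdivlMr// => h; apply: le_trans h.
  rewrite mulrA mulrC; apply: ler_wpM2l; first exact: tail_ge0.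
  by rewrite lerDl.
(* slow oscillation of the finitely many diagonals involved *)
pose J := [seq (p, q) | p <- enum_fset (@box n D), q <- enum_fset (@box n D)].
pose h := e / 2 / ((size J)%:R * C' + 1).
have h0 : 0 < h by rewrite !divr_gt0// ltr_wpDl// mulr_ge0.
have [r0 r0P] : exists r0, forall r, (r0 <= r)%N -> forall pq, pq \in J ->
    forall k, k \notin box r -> normc (a (k + pq.1) pq.2 - a k pq.2) <= h.
  apply: eventually_all => pq _; have [r0 r0P] := slow pq.2 pq.1 h h0.
  exists r0 => r rr k kr; apply: r0P; apply: contra kr; exact/fsubsetP/box_le.
pose r := maxn r0 D1; exists r => u.
have kr0 k : k \notin box r -> k \notin box r0.
  by apply: contra; apply/fsubsetP/box_le/leq_maxl.
have krD k : k \notin box r -> k \notin box D1.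
  by apply: contra; apply/fsubsetP/box_le/leq_maxr.
pose chi k : R[i] := indicator (fun k => k \notin box r) k.
pose c1 (pq : Z * Z) k := chi k * (b k pq.1 * (a (k + pq.1) pq.2 - a k pq.2)).
pose c2 m k := chi k * (c k m - (m == 0)%:R).
have c1b pq : pq \in J -> forall k, normc (c1 pq k) <= C' * h.
  move=> pqJ k; rewrite /c1 /chi /indicator; have [kr|kr] := boolP (k \in box r).
    by rewrite mul0r normc0 mulr_ge0 ?(ltW h0).
  rewrite mul1r normcM; apply: ler_pM; rewrite ?Defs.normc_ge0//.
    by apply: le_trans (bC _ _) _; rewrite ler_piMr// decay_le1.
  by apply: (r0P r0 (leqnn _)) => //; apply: kr0.
have c2b m : m \in enum_fset (@box n (D + D)) -> forall k, normc (c2 m k) <= K * tail R n D' + C * C' * d D' m.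
  move=> _ k; rewrite /c2 /chi /indicator; have [kr|kr] := boolP (k \in box r).
    by rewrite mul0r normc0 addr_ge0 ?mulr_ge0 ?tail_ge0.
  by rewrite mul1r; apply: cd => //; apply: krD.
have -> : restrict (fun k => k \notin box r) (band D b (band D a u) - u) =
    diags J (fun pq => pq.1 + pq.2) c1 u + diags (enum_fset (box (D + D))) id c2 u.
  apply: ell2_ext => k; rewrite restrictE [RHS]coordD (diagsE _ _ _ c1b) (diagsE _ _ _ c2b).
  rewrite /c1 /c2 /chi /indicator; case: ifP => kr; last first.
    by rewrite !big1 ?addr0// => *; rewrite !mul0r.
  under eq_bigr do rewrite mul1r; under [X in _ = _ + X]eq_bigr do rewrite mul1r.
  rewrite coordD coordN (bandE _ _ _ bC).
  rewrite [X in X - _](eq_bigr (fun p => b k p * \sum_(q <- box D) a (k + p) q * u (k + p + q))); last first.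
    by move=> p _; rewrite (bandE _ _ _ aC).
  rewrite big_allpairs_dep/=.
  under [X in _ = _ + X]eq_bigr do rewrite mulrBl.
  rewrite sumrB; have -> : \sum_(m <- box (D + D)) (m == 0)%:R * u (k + id m) = u k.
    rewrite (big_fsetD1 0) ?box0//= eqxx mul1r addr0 big1_seq ?addr0// => m.
    by rewrite !inE => /andP[_ /andP[/negPf -> _]]; rewrite mul0r.
  rewrite addrA; congr (_ - _).
  have -> : \sum_(m <- box (D + D)) c k m * u (k + id m) =
      \sum_(p <- box D) \sum_(q <- box D) b k p * a k q * u (k + (p + q)).
    rewrite /c; under eq_bigr do rewrite mulr_suml.
    rewrite (exchange_big_dep predT)//= big_seq [RHS]big_seq; apply: eq_bigr => p pD.
    rewrite (sum_box_shift (fun m => b k p * a k (m - p) * u (k + m)) pD).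
    by apply: eq_bigr => q _; rewrite [p + q]addrC addrK [q + p]addrC.
  rewrite -big_split; apply: eq_bigr => p _; rewrite mulr_sumr -big_split; apply: eq_bigr => q _ /=.
  by rewrite addrA; ring.
apply: le_trans (nmD _ _) _.
rewrite [e in leRHS]splitr mulrDl; apply: lerD.
  apply: le_trans (nm_diags _ _ c1b) _; apply: ler_wpM2r; first exact: nm_ge0.
  have hE : ((size J)%:R * C' + 1) * h = e / 2.
    by rewrite /h mulrC divfK// gt_eqF// ltr_wpDl// mulr_ge0.
  rewrite -hE big_const_seq count_predT iter_addr_0 -[C' * h *+ _]mulr_natl mulrA.
  by apply: ler_wpM2r; [exact: ltW|rewrite lerDl].
apply: le_trans (nm_diags _ _ c2b) _; apply: ler_wpM2r; first exact: nm_ge0.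
rewrite big_split/= big_const_seq count_predT iter_addr_0 -[K * _ *+ _]mulr_natl.
rewrite (_ : e / 2 = e / 4 + e / 4); last by field.
apply: lerD => //; rewrite -mulr_sumr.
apply: le_trans (ler_wpM2l _ (dsum D')) _; first by rewrite mulr_ge0.
move: D0P; rewrite ler_pdivlMr// => h1; apply: le_trans h1; rewrite /CW.
by have := @tail_ge0 R n D; move: (tail _ _ _) (decay_total _ _) => t w t0; lra.
Qed.

End Composition.

(** * Criteria for being Fredholm *)

Section FredholmCriterion.
Context {R : realType} {I : choiceType}.
Local Notation H := (ell2 R I).
Implicit Types (u v w : H) (F G : {fset I}).

Section Scalar.
Variable phi : H -> R[i].
Hypothesis phi_scalar : scalar phi.

Lemma scalar0 : phi 0 = 0.
Proof. by have := phi_scalar (-1) 0 0; rewrite scaler0 addr0 mulN1r addNr. Qed.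

Lemma scalarD u v : phi (u + v) = phi u + phi v.
Proof. by have := phi_scalar 1 u v; rewrite scale1r mul1r. Qed.

Lemma scalarB u v : phi (u - v) = phi u - phi v.
Proof. by have := phi_scalar (-1) v u; rewrite scaleN1r mulN1r ![- _ + _]addrC. Qed.

Lemma scalarZ c u : phi (c *: u) = c * phi u.
Proof. by have := phi_scalar c u 0; rewrite !addr0 scalar0 addr0. Qed.

End Scalar.

Lemma dual_bounded (phi : H -> R[i]) : dual_space phi ->
  exists2 M, 0 <= M & forall u, normc (phi u) <= M * ell2_norm u.
Proof.
move=> [phil phic]; have phi0 := scalar0 phil; have phiZ := scalarZ phil.
have /cvgrPdist_lt/(_ 1 ltr01)/nbhs_ballP[[e e'] /=] := phic 0.
rewrite ltcE/= => /andP[/eqP -> e0] eP.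
have e20 : 0 < e / 2 by rewrite divr_gt0.
exists (e / 2)^-1; first by rewrite invr_ge0 ltW.
move=> u; have [u0|u0] := eqVneq (ell2_norm u) 0.
  by rewrite (nm_eq0 u0) phi0 normc0 mulr_ge0 ?invr_ge0 ?nm_ge0 ?(ltW e20).
have up : 0 < ell2_norm u by rewrite lt_def u0 nm_ge0.
pose t := e / 2 / ell2_norm u; have t0 : 0 < t by rewrite divr_gt0.
have := eP (t%:C *: u); rewrite phi0 sub0r.
rewrite normrN normc_normE -[1 : R[i]]/(1%:C) ltcR phiZ normcM normc_real (ger0_norm (ltW t0)).
move=> h; have : t * normc (phi u) < 1.
  apply: h; rewrite ell2_ballE sub0r nmN nmZ normc_real (ger0_norm (ltW t0)) divfK//.
  by rewrite ltr_pdivrMr// ltr_pMr// ltr1n.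
rewrite -ltr_pdivlMl// mulr1 invf_div => /ltW h'; apply: le_trans h' _.
by rewrite mulrC.
Qed.

Lemma dual_of_bounded (phi : H -> R[i]) M : scalar phi ->
  (forall u, normc (phi u) <= M * ell2_norm u) -> dual_space phi.
Proof.
move=> phil phib; split=> // u B /nbhs_ballP[[e e'] /=].
rewrite ltcE/= => /andP[/eqP -> e0] eB.
have M1 : 0 < `|M| + 1 by rewrite ltr_wpDl.
apply/nbhs_ballP; exists (e / (`|M| + 1))%:C; first by rewrite /= ltcR divr_gt0.
move=> v; rewrite ell2_ballE ltr_pdivlMr// => uv.
apply: eB; rewrite -ball_normE /ball_ /= -(scalarB phil).
rewrite normc_normE ltcR; apply: le_lt_trans (phib _) _; apply: le_lt_trans uv.
rewrite mulrC; apply: ler_wpM2l; first exact: nm_ge0.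
by apply: le_trans (ler_norm _) _; rewrite lerDl.
Qed.

(** Unfolds the conjunctions in [finite_dim_separated]. *)
Lemma foldr_and_mem (J : eqType) (P : J -> Prop) (s : seq J) :
  foldr (fun k Q => P k /\ Q) True s -> forall k, k \in s -> P k.
Proof.
elim: s => //= j s IH [Pj /IH Ps] k; rewrite inE => /orP[/eqP ->|] //; exact: Ps.
Qed.

Variables (T : H -> H) (M : R).
Hypothesis T_linear : linear T.
Hypothesis T_bounded : forall u, ell2_norm (T u) <= M * ell2_norm u.

(** The families vanishing on F have a closed image by the lower bound, and the
   whole range is obtained from this image by adding finitely many lines. *)
Lemma closed_range_of_lower_bound F (K : R) :
  (forall u, (forall k, k \in F -> u k = 0) -> ell2_norm u <= K * ell2_norm (T u)) ->
  approx_closed (range T).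
Proof.
move=> lb.
pose A (s : seq I) : set H :=
  [set y | exists2 u : H, forall k, k \in F -> k \notin s -> u k = 0 & y = T u].
have Al s a u v : A s u -> A s v -> A s (a *: u + v).
  move=> [x xF ->] [y yF ->]; exists (a *: x + y); last by rewrite T_linear.
  by move=> k kF ks; rewrite coordD coordZ xF// yF// mulr0 addr0.
have A0 s : A s 0 by exists 0 => //; rewrite (lin0 T_linear).
have cA s : approx_closed (A s).
  elim: s => [|k s IH].
    move=> y yA; have h0 (i : nat) : 0 < 2^-1 ^+ i :> R by rewrite exprn_gt0.
    have /boolp.choice[u uP] : forall i : nat, exists u : H,
        (forall k, k \in F -> u k = 0) /\ ell2_norm (y - T u : H) <= 2^-1 ^+ i.
      move=> i; have [a [u uF ->] ya] := yA _ (h0 i); exists u; split=> // k kF.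
      exact: uF.
    have mono i j : (i <= j)%N -> 2^-1 ^+ j <= 2^-1 ^+ i :> R.
      by move=> ij; apply: ler_wiXn2l => //; rewrite ?invr_ge0// invf_le1// ler1n.
    have [v vP] : exists v : H, forall i, ell2_norm (v - u i : H) <= `|K| * (2 * 2^-1 ^+ i).
      apply: ell2_cauchy => [i j ij|e e0].
        apply: le_trans (lb _ _) _.
          by move=> k kF; rewrite coordD coordN (uP i).1// (uP j).1// subr0.
        apply: le_trans (ler_wpM2r (nm_ge0 _) (ler_norm K)) _.
        apply: ler_wpM2l => //; rewrite (linB T_linear) mulr_natl mulr2n.
        apply: le_trans (nm_dist _ _ y) _; rewrite nm_distC; apply: lerD; last exact: (uP i).2.
        exact: le_trans (uP j).2 (mono _ _ ij).
      have c0 : 0 < `|K| * 2 + 1 by rewrite ltr_wpDl// mulr_ge0.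
      have [i iP] := half_pow_small (divr_gt0 e0 c0); exists i.
      move: iP; rewrite ler_pdivlMr// => iP; apply: le_trans iP.
      by have := h0 i; rewrite mulrDr mulr1; lra.
    exists v => [k kF _|].
      apply: normc_eq => e e0; rewrite subr0.
      have c0 : 0 < `|K| * 2 + 1 by rewrite ltr_wpDl// mulr_ge0.
      have [i iP] := half_pow_small (divr_gt0 e0 c0).
      have := nm_coord (v - u i) k; rewrite coordD coordN (uP i).1// subr0 => h.
      apply: le_trans h _; apply: le_trans (vP i) _.
      move: iP; rewrite ler_pdivlMr// => iP; apply: le_trans iP.
      by have := h0 i; rewrite mulrDr mulr1; lra.
    apply: nm_eq => e e0.
    have c0 : 0 < `|M| * (`|K| * 2) + 1 by rewrite ltr_wpDl// !mulr_ge0.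
    have [i iP] := half_pow_small (divr_gt0 e0 c0).
    apply: le_trans (nm_dist _ _ (T (u i))) _; rewrite -(linB T_linear).
    have := (uP i).2; have : ell2_norm (T (u i - v)) <= `|M| * (`|K| * (2 * 2^-1 ^+ i)).
      apply: le_trans (T_bounded _) _; apply: le_trans (ler_wpM2r (nm_ge0 _) (ler_norm M)) _.
      by rewrite nm_distC; apply: ler_wpM2l.
    move: iP; rewrite ler_pdivlMr// => iP h1 h2; apply: le_trans (lerD h2 h1) _; apply: le_trans iP.
    by rewrite mulrDr mulr1 addrC lerD2r le_eqVlt; apply/orP; left; apply/eqP; ring.
  suff -> : A (k :: s) = [set y | exists2 a, A s a & exists c : R[i], y = a + c *: T (unit_vector k)].
    by apply: approx_closed_add_line (Al s) (A0 s) IH.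
  apply/seteqP; split=> y.
    move=> [u uF ->]; exists (T (u - u k *: unit_vector k)); last first.
      by exists (u k); rewrite (linB T_linear) (linZ T_linear) subrK.
    exists (u - u k *: unit_vector k) => // l lF ls; rewrite coordD coordN coordZ unit_vectorE.
    have [->|lk] := eqVneq l k; first by rewrite mulr1 subrr.
    by rewrite mulr0 subr0; apply: uF => //; rewrite inE negb_or lk.
  move=> [_ [u uF ->] [c ->]]; exists (u + c *: unit_vector k); last first.
    by rewrite (linD T_linear) (linZ T_linear).
  move=> l lF; rewrite inE negb_or => /andP[lk ls].
  by rewrite coordD coordZ unit_vectorE (negPf lk) mulr0 addr0 uF.
rewrite (_ : range T = A (enum_fset F)); first exact: cA.
apply/seteqP; split=> y [u]; last by move=> _ ->; exists u.
by move=> _ <-; exists u => // k ->.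
Qed.

(** A left parametrix gives a finite dimensional kernel and a closed range; a
   right parametrix makes a functional that kills the range determined by its
   values at finitely many unit vectors. *)
Lemma fredholm_of_parametrix F G (K : R) (S : H -> H) :
  (forall u, (forall k, k \in F -> u k = 0) -> ell2_norm u <= K * ell2_norm (T u)) ->
  (forall u, ell2_norm (restrict (fun k : I => k \notin G) (u - T (S u)) : H) <= 2^-1 * ell2_norm u) ->
  fredholm [set: H] T.
Proof.
move=> lb rb; split; split.
- by split=> // a x y _ _; split=> //; apply: T_linear.
- by move=> O [x Ox] _; exists x.
- move=> [x y] xy /=; split=> //; apply: nm_eq => e e0.
  pose d := e / (`|M| + 1).
  have M1 : 0 < `|M| + 1 by rewrite ltr_wpDl.
  have d0 : 0 < d by rewrite divr_gt0.
  have [[z w] [/= [_ ->] [xz yw]]] := xy _ (nbhsx_ballx (x, y) d%:C (etrans (ltcR _ _) d0)).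
  move: xz yw; rewrite /= !ell2_ballE => xz yw.
  apply: le_trans (nm_dist _ _ (T z)) _; rewrite -(linB T_linear).
  rewrite [e](_ : _ = d + `|M| * d); last by rewrite -[d in d + _]mul1r -mulrDl addrC mulrC divfK ?gt_eqF.
  apply: lerD; first exact: ltW.
  apply: le_trans (T_bounded _) _; apply: le_trans (ler_wpM2r (nm_ge0 _) (ler_norm M)) _.
  by apply: ler_wpM2l => //; rewrite nm_distC ltW.
- by apply/approx_closedP; exact: closed_range_of_lower_bound lb.
- apply: (@finite_dim_separated _ _ _ (enum_fset F) (fun k v => v k)).
  + by move=> a u v [_ u0] [_ v0]; split=> //; rewrite T_linear u0 v0 scaler0 addr0.
  + by move=> k a u v; rewrite coordD coordZ.
  move=> v [_ v0] /foldr_and_mem vF; apply: nm_eq0; apply/le_anti; rewrite nm_ge0 andbT.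
  by have := lb _ vF; rewrite v0 nm0 mulr0.
apply: (@finite_dim_separated _ _ _ (enum_fset G) (fun k (phi : H -> R[i]) => phi (unit_vector k))).
- move=> a phi psi [phid d0 phi0] [psid _ psi0].
  split; [|exact: d0|by move=> u _; rewrite !fctE phi0// psi0//= scaler0 addr0].
  have [M1 _ phib] := dual_bounded phid; have [M2 _ psib] := dual_bounded psid.
  have phil := phid.1; have psil := psid.1.
  apply: (@dual_of_bounded _ (normc a * M1 + M2)) => [b u v|u].
    by rewrite /= !fctE phil psil/=; rewrite /GRing.scale/=; ring.
  rewrite mulrDl -mulrA; apply: le_trans (le_normcD _ _) _.
  apply: lerD => //; rewrite normcM; apply: ler_wpM2l; [exact: Defs.normc_ge0|exact: phib].
- by [].
move=> phi [phid _ phi0] /foldr_and_mem phiG.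
have [M1 M10 phib] := dual_bounded phid; have phil := phid.1.
pose r u := restrict (fun k : I => k \notin G) (u - T (S u)).
have rphi u : phi u = phi (r u).
  transitivity (phi (T (S u) + (restrict (mem G) (u - T (S u)) + r u))).
    congr (phi _); apply: ell2_ext => k; rewrite /r !coordD !restrictE.
    have -> : (u - T (S u) : H) k = u k - T (S u) k by [].
    by rewrite -[mem G k]/(k \in G); case: (k \in G) => /=; ring.
  rewrite !(scalarD phil) phi0// add0r restrict_sum.
  rewrite (big_morph phi (scalarD phil) (scalar0 phil)) big_seq big1 ?add0r// => k kG.
  by rewrite (scalarZ phil) phiG// mulr0.
have phi_half i u : normc (phi u) <= M1 * (2^-1 ^+ i * ell2_norm u).
  elim: i u => [|i IH] u; first by rewrite expr0 mul1r.
  rewrite rphi; apply: le_trans (IH _) _; apply: ler_wpM2l => //.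
  by rewrite exprSr -mulrA; apply: ler_wpM2l (rb u); rewrite exprn_ge0// invr_ge0.
apply/funext => u; apply: normc_eq => e e0; rewrite subr0.
have c0 : 0 < M1 * ell2_norm u + 1 by rewrite ltr_wpDl// mulr_ge0 ?nm_ge0.
have [i iP] := half_pow_small (divr_gt0 e0 c0); apply: le_trans (phi_half i u) _.
move: iP; rewrite ler_pdivlMr// => iP; apply: le_trans iP.
have : 0 < 2^-1 ^+ i :> R by rewrite exprn_gt0.
by rewrite mulrDr mulr1 mulrCA; lra.
Qed.

(** The image of an almost null vector u has a preimage v of small norm, and u - v is
   in the kernel. Starting from more vectors u with disjoint supports than the
   dimension of the kernel allows, a dependence relation between the u - v is
   restricted to the support of the term with the largest coefficient: this term
   would be at most half of itself. *)
Lemma fredholm_no_far_packets : approx_closed (range T) -> finite_dim [set u | T u = 0] ->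
  ~ forall e, 0 < e -> forall F, exists u, exists G, [/\ [disjoint F & G]%fset,
      forall k, k \notin G -> u k = 0, u != 0 & ell2_norm (T u) <= e * ell2_norm u].
Proof.
move=> cT /finite_dim_dependent[d dP] far.
have [K K0 KP] := bounded_preimage T_linear T_bounded cT.
have dK : 0 < d.+1%:R * K + 1 by rewrite ltr_wpDl// mulr_ge0.
pose e := 2^-1 / (d.+1%:R * K + 1); have e0 : 0 < e by rewrite divr_gt0.
have /boolp.choice[P PP] : forall F, exists p : H * {fset I}, [/\ [disjoint F & p.2]%fset,
    forall k, k \notin p.2 -> p.1 k = 0, p.1 != 0 & ell2_norm (T p.1) <= e * ell2_norm p.1].
  by move=> F; have [u [G uG]] := far e e0 F; exists (u, G).
pose fix U (i : nat) : {fset I} := if i is j.+1 then (U j `|` (P (U j)).2)%fset else fset0.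
pose u (i : 'I_d.+1) := (P (U i)).1; pose B (i : 'I_d.+1) := (P (U i)).2.
have BU i j : (i < j)%N -> ((P (U i)).2 `<=` U j)%fset.
  elim: j => // j IH; rewrite ltnS leq_eqVlt => /orP[/eqP ->|/IH h] /=; first exact: fsubsetUr.
  exact: fsubset_trans h (fsubsetUl _ _).
have uB i j k : i != j -> k \in B i -> u j k = 0.
  move=> ij kB; have [_ uj _ _] := PP (U j); apply: uj; apply/negP => kBj.
  have [ij'|ji] := ltnP i j.
    have [/fdisjointP/(_ k)] := PP (U j); rewrite (fsubsetP (BU _ _ ij') _ kB) => /(_ isT).
    by rewrite kBj.
  have {}ji : (j < i)%N by rewrite ltn_neqAle ji andbT eq_sym; exact: ij.
  have [/fdisjointP/(_ k)] := PP (U i); rewrite (fsubsetP (BU _ _ ji) _ kBj) => /(_ isT).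
  by rewrite [_ \in _]kB.
have /boolp.choice[v vP] : forall i, exists v : H, T v = T (u i) /\ ell2_norm v <= K * (e * ell2_norm (u i)).
  move=> i; have [v v1 v2] := KP (u i); exists v; split=> //; apply: le_trans v2 _.
  by apply: ler_wpM2l => //; have [] := PP (U i).
have [i|c [i1 ci1] c0] := dP (fun i => u i - v i).
  by rewrite /= (linB T_linear) (vP i).1 subrr.
pose q i := normc (c i) * ell2_norm (u i).
have q0 i : 0 <= q i by rewrite mulr_ge0 ?nm_ge0 ?Defs.normc_ge0.
pose i0 := [arg max_(i > i1) q i]%O.
have qmax i : q i <= q i0 by rewrite /i0; case: arg_maxP => // j _ /(_ i isT).
have cuv : \sum_i c i *: u i = \sum_i c i *: v i.
  by apply/eqP; rewrite -subr_eq0 -sumrB -[X in _ == X]c0; apply/eqP/eq_bigr => i _; rewrite scalerBr.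
have coord_sum (f : 'I_d.+1 -> H) k : (\sum_i f i : H) k = \sum_i f i k.
  by elim/big_rec2: _ => // i y1 y2 _ <-.
have : q i0 <= 2^-1 * q i0.
  rewrite {1}/q -nmZ.
  have -> : c i0 *: u i0 = restrict (mem (B i0)) (\sum_i c i *: v i).
    rewrite -cuv; apply: ell2_ext => k; rewrite restrictE coord_sum coordZ; case: ifPn => kB.
      rewrite (bigD1 i0)// big1 => [|j ji]; first by rewrite coordZ /= addr0.
      rewrite coordZ (uB i0 j)// ?mulr0//.
      by rewrite eq_sym.
    by have [_ -> // _ _] := PP (U i0); rewrite mulr0.
  apply: le_trans (nm_restrict _ _) _; apply: le_trans (nm_sum _ _) _.
  apply: (@le_trans _ _ (\sum_(i < d.+1) K * e * q i0)).
    apply: ler_sum => i _; rewrite nmZ; apply: (@le_trans _ _ (K * e * q i)).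
      apply: le_trans (ler_wpM2l (Defs.normc_ge0 _) (vP i).2) _.
      by rewrite /q le_eqVlt; apply/orP; left; apply/eqP; ring.
    by apply: ler_wpM2l => //; rewrite mulr_ge0 ?(ltW e0).
  rewrite sumr_const card_ord -[_ *+ d.+1]mulr_natl mulrA; apply: ler_wpM2r => //.
  have eE : (d.+1%:R * K + 1) * e = 2^-1 by rewrite mulrC divfK ?gt_eqF.
  by rewrite mulrA -eE; apply: ler_wpM2r; [exact: ltW|rewrite lerDl].
move=> qh; have {}q0 : q i1 = 0.
  by apply/le_anti; rewrite q0 andbT; apply: le_trans (qmax i1) _; move: qh; lra.
move/eqP: q0; rewrite mulf_eq0 => /orP[/eqP/eq0_normc|/eqP/nm_eq0] z0.
  by rewrite z0 eqxx in ci1.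
by have [_ _ /eqP h _] := PP (U i1); apply: h.
Qed.

End FredholmCriterion.

(** * Ellipticity gives a parametrix *)

Section Parametrix.
Context {R : realType} {n : nat}.
Local Notation Z := ('rV[int]_n).
Local Notation H := (ell2 R Z).
Implicit Types (u v w : H) (a b : Z -> Z -> R[i]) (k l m p q : Z) (D : nat) (C : R).

Definition kernel_oscillates_slowly a := forall m p e, 0 < e ->
  exists D, forall k, k \notin box D -> normc (a (k + p) m - a k m) <= e.

(** Outside a box, each row of b is an inverse of the same row of a for the
   convolution product, with a rate for the truncated convolutions. *)
Definition convolution_inverse b a := exists K D1, 0 <= K /\ forall k, k \notin box D1 ->
  forall D m, normc ((m == 0)%:R - \sum_(p <- box D) b k p * a k (m - p)) <= K * tail R n D.

Lemma small_tail C e : 0 <= C -> 0 < e ->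
  exists D0, forall D, (D0 <= D)%N -> C * tail R n D <= e.
Proof.
move=> C0 e0; have C1 : 0 < C + 1 by rewrite ltr_wpDl.
have [D0 DP] := @tail_small R n _ (divr_gt0 e0 C1); exists D0 => D /DP.
rewrite ler_pdivlMr// => h; apply: le_trans h; rewrite mulrC; apply: ler_wpM2l; last by rewrite lerDl.
exact: tail_ge0.
Qed.

Variables (T : H -> H) (a b : Z -> Z -> R[i]) (C C' : R).
Hypotheses (aC : dominated C a) (bC : dominated C' b).
Hypothesis T_band : forall D u, ell2_norm (T u - band D a u : H) <= C * tail R n D * ell2_norm u.

Let C0 : 0 <= C := dominated_ge0 aC.
Let C'0 : 0 <= C' := dominated_ge0 bC.
Let W0 : 0 <= decay_total R n := decay_total_ge0.
Let M := C' * decay_total R n.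
Let M0 : 0 <= M. Proof. exact: mulr_ge0. Qed.

(** The truncated operator with kernel b is an approximate left inverse of T on
   the families supported far away. *)
Lemma far_lower_bound : kernel_oscillates_slowly a -> convolution_inverse b a ->
  exists K r, forall u, (forall k, k \in box r -> u k = 0) -> ell2_norm u <= K * ell2_norm (T u).
Proof.
move=> slow [K [D1 [K0 conv]]].
have e0 : 0 < 4^-1 :> R by rewrite invr_gt0.
have [D2 inv] := band_inverse aC bC K0 slow conv e0.
have [D3 small] := small_tail (mulr_ge0 M0 C0) e0.
pose D := maxn D2 D3; have [r rP] := inv D (leq_maxl _ _).
exists (2 * M), r => u ur; have {}rP := rP u.
have {}small := small D (leq_maxr _ _).
have uE : u = restrict (fun k => k \notin box r) (band D b (band D a u)) -
    restrict (fun k => k \notin box r) (band D b (band D a u) - u).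
  apply: ell2_ext => k; rewrite coordD coordN !restrictE.
  by case: ifPn => [_|/negPn/ur ->]; rewrite ?subr0// coordD coordN; ring.
have h1 : ell2_norm (band D b (band D a u)) <= M * (ell2_norm (T u) + C * tail R n D * ell2_norm u).
  apply: le_trans (nm_band _ _ bC) _; apply: ler_wpM2l => //.
  apply: le_trans (nm_le_add _ (T u)) _; rewrite addrC lerD2l nm_distC.
  exact: T_band.
have h2 : M * C * tail R n D * ell2_norm u <= 4^-1 * ell2_norm u.
  by apply: ler_wpM2r small; exact: nm_ge0.
have := nmB (restrict (fun k => k \notin box r) (band D b (band D a u)))
  (restrict (fun k => k \notin box r) (band D b (band D a u) - u)); rewrite -uE => h3.
have h4 := nm_restrict (fun k => k \notin box r) (band D b (band D a u)).
have h5 : M * (ell2_norm (T u) + C * tail R n D * ell2_norm u) =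
  M * ell2_norm (T u) + M * C * tail R n D * ell2_norm u by ring.
rewrite h5 in h1; rewrite -mulrA; move: h1 h2 h3 rP h4.
move: (ell2_norm _) (ell2_norm _) (ell2_norm _) (M * ell2_norm (T u)) (ell2_norm u) => x y z t s.
move: (M * C * _ * _) => q; lra.
Qed.

(** The same composition in the other order. *)
Lemma far_approximate_inverse : kernel_oscillates_slowly b -> convolution_inverse a b ->
  exists S r, forall u,
    ell2_norm (restrict (fun k => k \notin box r) (u - T (S u)) : H) <= 2^-1 * ell2_norm u.
Proof.
move=> slow [K [D1 [K0 conv]]].
have e0 : 0 < 4^-1 :> R by rewrite invr_gt0.
have [D2 inv] := band_inverse bC aC K0 slow conv e0.
have [D3 small] := small_tail (mulr_ge0 M0 C0) e0.
pose D := maxn D2 D3; have [r rP] := inv D (leq_maxl _ _).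
exists (band D b), r => u; have {}rP := rP u.
have {}small := small D (leq_maxr _ _).
have -> : restrict (fun k => k \notin box r) (u - T (band D b u)) =
    - restrict (fun k => k \notin box r) (T (band D b u) - band D a (band D b u)) -
    restrict (fun k => k \notin box r) (band D a (band D b u) - u).
  apply: ell2_ext => k; rewrite coordD !coordN !restrictE !coordD !coordN.
  by case: ifP => _; ring.
apply: le_trans (nmB _ _) _; rewrite nmN.
have h1 := T_band D (band D b u).
have h2 := nm_restrict (fun k => k \notin box r) (T (band D b u) - band D a (band D b u)).
have h3 : C * tail R n D * ell2_norm (band D b u) <= C * tail R n D * (M * ell2_norm u).
  by apply: ler_wpM2l; [rewrite mulr_ge0 ?tail_ge0|exact: nm_band bC].
have h4 : M * C * tail R n D * ell2_norm u <= 4^-1 * ell2_norm u.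
  by apply: ler_wpM2r small; exact: nm_ge0.
have h5 : C * tail R n D * (M * ell2_norm u) = M * C * tail R n D * ell2_norm u by ring.
rewrite h5 in h3; move: h1 h2 h3 h4 rP.
move: (ell2_norm _) (ell2_norm _) (ell2_norm _) (ell2_norm u) => x y z s.
move: (M * C * _ * _) (C * _ * _) => q q'; lra.
Qed.

End Parametrix.

Section Reciprocal.
Context {R : realType} {n : nat}.
Local Notation Z := ('rV[int]_n).
Variables (sigma : Z -> 'rV[R]_n -> R[i]) (C c R1 : R).
Hypothesis sigma_tame : forall k, tame C (sigma k).
Hypothesis c0 : 0 < c.
Hypothesis sigma_far : forall k, R1 <= euclid_norm k -> forall x, c <= normc (sigma k x).

Definition reciprocal (k : Z) (x : 'rV[R]_n) : R[i] :=
  if R1 <= euclid_norm k then (sigma k x)^-1 else 0.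

Lemma reciprocal_tame : exists K, forall k, tame K (reciprocal k).
Proof.
have [K K0 KP] := @tame_inv R n C c c0; exists K => k; have := @sigma_far k; rewrite /reciprocal.
case: (R1 <= _) => [kR|_]; first by apply: KP => // x; apply: kR.
exact: tame0.
Qed.

Lemma far_box : exists D, forall k, k \notin @box n D -> R1 <= euclid_norm k.
Proof.
exists (Num.truncn R1).+1 => k /(@euclid_notin_box R) h; apply: le_trans h.
by apply/ltW/truncnS_gt.
Qed.

Lemma reciprocalK k x : R1 <= euclid_norm k -> sigma k x * reciprocal k x = 1.
Proof.
move=> kR; rewrite /reciprocal kR mulfV//; apply/eqP => s0.
by have := sigma_far kR x; rewrite s0 normc0 leNgt c0.
Qed.

Lemma reciprocal_slow : oscillates_slowly sigma -> oscillates_slowly reciprocal.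
Proof.
move=> slow p e e0; have [D1 far] := far_box.
have [D2 D2P] := slow p (e * (c * c)) (mulr_gt0 e0 (mulr_gt0 c0 c0)).
have [P pP] := in_some_box p; exists (maxn D2 (D1 + P))%N => k kD x.
have kD2 : k \notin box D2 by apply: contra kD; exact/fsubsetP/box_le/leq_maxl.
have kD1 : k \notin box (D1 + P) by apply: contra kD; exact/fsubsetP/box_le/leq_maxr.
have kR : R1 <= euclid_norm k.
  by apply: far; apply: contra kD1; exact/fsubsetP/box_le/leq_addr.
have kpR : R1 <= euclid_norm (k + p) by apply: far; apply: notin_boxD kD1 pP.
have n0 l : R1 <= euclid_norm l -> sigma l x != 0.
  by move=> lR; apply/eqP => s0; have := sigma_far lR x; rewrite s0 normc0 leNgt c0.
rewrite /reciprocal kR kpR.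
have s1 := n0 _ kR; have s2 := n0 _ kpR.
have -> : (sigma (k + p) x)^-1 - (sigma k x)^-1 =
    (sigma k x - sigma (k + p) x) / (sigma k x * sigma (k + p) x).
  by field; rewrite s1 s2.
have cc : c * c <= normc (sigma k x * sigma (k + p) x).
  by rewrite normcM; apply: ler_pM; rewrite ?(ltW c0)//; apply: sigma_far.
rewrite normcM normcV ler_pdivrMr; last by apply: lt_le_trans cc; exact: mulr_gt0.
rewrite normc_distC; apply: le_trans (D2P k kD2 x) _.
by apply: ler_wpM2l => //; exact: ltW.
Qed.

End Reciprocal.

Section KernelOfSymbol.
Context {R : realType} {n : nat}.
Local Notation Z := ('rV[int]_n).
Implicit Types (sigma tau : Z -> 'rV[R]_n -> R[i]).

Lemma kernel_slow sigma C : (forall k, tame C (sigma k)) -> oscillates_slowly sigma ->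
  kernel_oscillates_slowly (kernel sigma).
Proof.
move=> sC slow m p e e0; have [D DP] := slow p e e0; exists D => k kD.
by apply: fcoef_dist (sC _) (sC _) _; apply: DP.
Qed.

Lemma kernel_inverse sigma tau C C' D1 : (forall k, tame C (sigma k)) -> (forall k, tame C' (tau k)) ->
  (forall k, k \notin box D1 -> forall x, sigma k x * tau k x = 1) ->
  convolution_inverse (kernel sigma) (kernel tau).
Proof.
move=> sC tC st; exists (C' * C), D1; split.
  by rewrite mulr_ge0// (tame_ge0 (sC 0), tame_ge0 (tC 0)).
move=> k kD D m; rewrite -mulrA; apply: fcoef_inverse (sC k) (tC k) _ => x.
exact: st.
Qed.

End KernelOfSymbol.

(** * Failure of ellipticity gives almost null wave packets *)

Section WavePackets.
Context {R : realType} {n : nat}.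
Local Notation Z := ('rV[int]_n).
Local Notation H := (ell2 R Z).
Implicit Types (u v w : H) (a : Z -> Z -> R[i]) (k l m p q : Z) (D N : nat) (C : R).

Lemma thin_shell_power D e (p : nat) : 0 < e -> exists N0, forall N, (N0 <= N)%N ->
  (N + D).*2.+1%:R ^+ p - (N - D).*2.+1%:R ^+ p <= e * N.*2.+1%:R ^+ p :> R.
Proof.
elim: p e => [|p IH] e e0; first by exists 0%N => N _; rewrite !expr0 subrr mulr1 ltW.
have [N1 N1P] := IH _ (divr_gt0 e0 (ltr0n _ 4)).
pose N2 := (Num.truncn (8 * D%:R / e)).+1; exists (maxn (maxn N1 N2) D) => N.
rewrite !geq_max -andbA => /and3P[/N1P{}N1P NN2 DN].
set x : R := (N + D).*2.+1%:R in N1P *; set y : R := (N - D).*2.+1%:R in N1P *.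
set z : R := N.*2.+1%:R in N1P *.
have xz : x <= 2 * z by rewrite /x /z -natrM ler_nat; lia.
have yz : y <= z by rewrite /y /z ler_nat; lia.
have y0 : 0 <= y by rewrite ler0n.
have z0 : 0 < z by rewrite ltr0n.
have xy : x - y = 4 * D%:R by rewrite /x /y -natrM -natrB; [congr _%:R|]; lia.
have Dz : 4 * D%:R <= e / 2 * z.
  have : 8 * D%:R / e <= z.
    apply: (@le_trans _ _ N2%:R); first exact/ltW/truncnS_gt.
    by rewrite /z ler_nat; lia.
  by rewrite ler_pdivrMr//; lra.
have -> : x ^+ p.+1 - y ^+ p.+1 = x * (x ^+ p - y ^+ p) + (x - y) * y ^+ p.
  by rewrite !exprS; ring.
have h1 : x * (x ^+ p - y ^+ p) <= 2 * z * (e / 4 * z ^+ p).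
  apply: ler_pM => //.
  rewrite subr_ge0; apply: lerXn2r; rewrite ?nnegrE ?ler0n//.
  by rewrite /x /y ler_nat; lia.
have h2 : (x - y) * y ^+ p <= e / 2 * z * z ^+ p.
  by rewrite xy; apply: ler_pM; rewrite ?mulr_ge0 ?exprn_ge0//; apply: lerXn2r; rewrite ?nnegrE// ltW.
apply: le_trans (lerD h1 h2) _; rewrite exprS le_eqVlt; apply/orP; left; apply/eqP.
by field.
Qed.

(** The boundary layer of fixed width D is negligible in a big box: its size is of
   the order of N^(n-1), against N^n for the box. *)
Lemma thin_shell D e : 0 < e -> exists2 N, (D <= N)%N &
  (#|` (@box n (N + D) `\` box (N - D))%fset|)%:R <= e * (#|` @box n N|)%:R :> R.
Proof.
move=> e0; have [N0 N0P] := thin_shell_power D n e0; exists (maxn N0 D); first exact: leq_maxr.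
set N := maxn _ _; have := N0P N (leq_maxl _ _).
have sub : (@box n (N - D) `<=` box (N + D))%fset by apply: box_le; lia.
rewrite cardfsDS// natrB ?fsubset_leq_card// !card_box !natrX.
done.
Qed.

Lemma sum_mem_le (I : choiceType) (A F : {fset I}) : \sum_(i <- A) (i \in F)%:R <= (#|` F|)%:R :> R.
Proof.
rewrite (bigID (mem F))/= [X in _ + X]big1 ?addr0; last by move=> i /negPf ->.
rewrite (eq_bigr (fun=> 1)) => [|i ->//]; rewrite big_const_seq iter_addr_0 ler_nat -size_filter.
by apply: uniq_leq_size; [rewrite filter_uniq|move=> i; rewrite mem_filter => /andP[]].
Qed.

Definition wave_packet N k0 (x0 : 'rV[R]_n) : H :=
  \sum_(l <- [fset (k0 + j)%R | j in @box n N]%fset) echar l x0 *: unit_vector l.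

Lemma wave_packetE N k0 x0 k : wave_packet N k0 x0 k =
  if k - k0 \in box N then echar k x0 else 0.
Proof.
rewrite sum_unit_vectorE; congr (if _ then _ else _).
apply/imfsetP/idP => [[j jN ->]|kN]; first by rewrite [k0 + j]addrC addrK.
by exists (k - k0) => //; rewrite addrC subrK.
Qed.

Lemma nm_wave_packet N k0 x0 : (#|` @box n N|)%:R <= ell2_norm (wave_packet N k0 x0) ^+ 2.
Proof.
have := ell2_norm_sum [fset (k0 + j)%R | j in @box n N]%fset (ell2P (wave_packet N k0 x0)).
apply: le_trans; rewrite (sum_imfset _ _ (@addrI _ k0)).
rewrite (eq_big_seq (fun=> 1)) => [|j jN]; last first.
  by rewrite wave_packetE [k0 + j]addrC addrK jN normc_echar expr1n.
by rewrite big_const_seq count_predT iter_addr_0.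
Qed.

Variables (T : H -> H) (sigma : Z -> 'rV[R]_n -> R[i]) (C : R).
Hypothesis sigma_tame : forall k, tame C (sigma k).
Hypothesis T_band : forall D u,
  ell2_norm (T u - band D (kernel sigma) u : H) <= C * tail R n D * ell2_norm u.
Hypothesis slow : oscillates_slowly sigma.

(** A plane wave cut off to a large box is multiplied by the value of the symbol
   in the middle, with errors due to the truncation of the Fourier series, to
   the oscillation of the symbol along the box, and to the boundary. *)
Lemma wave_packet_almost_null e : 0 < e -> exists N r, forall k0 x0,
  k0 \notin box r -> normc (sigma k0 x0) <= e ->
  ell2_norm (T (wave_packet N k0 x0)) <= 5 * e * ell2_norm (wave_packet N k0 x0).
Proof.
move=> e0; have aC := kernel_dominated sigma_tame; have C0 := dominated_ge0 aC.
have [D /(_ D (leqnn _)) small] := @small_tail R n C e C0 e0.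
pose M := C * decay_total R n; have M0 : 0 <= M by rewrite mulr_ge0 ?decay_total_ge0.
have M1 : 0 < M ^+ 2 + 1 by rewrite ltr_wpDl ?sqr_ge0.
have [N DN shell] := @thin_shell D _ (divr_gt0 (exprn_gt0 2 e0) M1).
have [r rP] : exists r0, forall r, (r0 <= r)%N -> forall j, j \in enum_fset (@box n N) ->
    forall k, k \notin box r -> forall x, normc (sigma (k + j) x - sigma k x) <= e.
  apply: eventually_all => j _; have [r0 r0P] := slow j e0.
  exists r0 => r rr k kr; apply: r0P; apply: contra kr; exact/fsubsetP/box_le.
exists N, r => k0 x0 k0r s0; set u := wave_packet N k0 x0.
have u0 := nm_ge0 u.
suff h : ell2_norm (band D (kernel sigma) u) <= 4 * e * ell2_norm u.
  apply: le_trans (nm_le_add _ (band D (kernel sigma) u)) _.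
  have h1 := T_band D u; have h2 : C * tail R n D * ell2_norm u <= e * ell2_norm u by apply: ler_wpM2r.
  by apply: le_trans (lerD (le_trans h1 h2) h) _; rewrite le_eqVlt; apply/orP; left; apply/eqP; ring.
pose F := (@box n (N + D) `\` box (N - D))%fset.
pose g j : R := (3 * e) ^+ 2 * (j \in box N)%:R + M ^+ 2 * (j \in F)%:R.
have ug k : normc (band D (kernel sigma) u k) ^+ 2 <= g (k - k0).
  rewrite (bandE _ _ _ aC) /g; set j := k - k0.
  have kj : k = k0 + j by rewrite addrC subrK.
  have [jD|jD] := boolP (j \in box (N - D)).
    have jN : j \in box N by apply: (fsubsetP (box_le _)) jD; exact: leq_subr.
    rewrite jN mulr1 !inE jD /= mulr0 addr0 ler_pXn2r ?nnegrE ?Defs.normc_ge0 ?mulr_ge0 ?(ltW e0)//.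
    rewrite (eq_big_seq (fun m => echar k x0 * (kernel sigma k m * echar m x0))) => [|m mD]; last first.
      rewrite wave_packetE (_ : k + m - k0 = j + m); last by rewrite addrAC.
      rewrite (_ : j + m \in box N); last by rewrite -(subnK DN); apply: boxD.
      by rewrite echarDl; ring.
    rewrite -mulr_sumr normcM normc_echar mul1r.
    set s := \sum_(m <- _) _.
    have h1 : normc (sigma k x0 - s) <= e by apply: le_trans small; apply: fourier_inversion.
    have h2 : normc (sigma k x0 - sigma k0 x0) <= e by rewrite kj; apply: (rP r (leqnn _)).
    have h3 := le_normc_dist (sigma k x0) 0 (sigma k0 x0); rewrite !subr0 in h3.
    have h4 := le_normc_dist s 0 (sigma k x0); rewrite !subr0 [normc (s - _)]normc_distC in h4.
    lra.
  have [jF|jF] := boolP (j \in box (N + D)).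
    rewrite !inE jF jD /= mulr1; apply: ler_wpDl; first by rewrite mulr_ge0 ?sqr_ge0.
    rewrite ler_pXn2r ?nnegrE ?Defs.normc_ge0//; apply: le_trans (le_normc_sum _ _ _) _.
    apply: (@le_trans _ _ (\sum_(m <- box D) C * decay R m)).
      apply: ler_sum => m _; rewrite normcM wave_packetE.
      case: ifP => _; rewrite ?normc_echar ?mulr1 ?normc0 ?mulr0; first exact: aC.
      by rewrite mulr_ge0 ?decay_ge0.
    by rewrite -mulr_sumr; apply: ler_wpM2l => //; apply: sum_decay.
  rewrite big1_seq => [|m /andP[_ mD]]; last first.
    rewrite wave_packetE (_ : k + m - k0 = j + m); last by rewrite addrAC.
    by rewrite (negPf (notin_boxD jF mD)) mulr0.
  by rewrite normc0 expr0n /= addr_ge0// mulr_ge0 ?sqr_ge0 ?ler0n.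
apply: nm_le_sums => [|A]; first by rewrite !mulr_ge0 ?(ltW e0).
apply: le_trans (ler_sum _ (fun k _ => ug k)) _.
rewrite -(sum_imfset A g (@addIr _ (- k0))) /g big_split/= -!mulr_sumr.
have h1 := sum_mem_le [fset (k - k0)%R | k in A]%fset (box N).
have h2 := sum_mem_le [fset (k - k0)%R | k in A]%fset F.
have h3 := nm_wave_packet N k0 x0; rewrite -/u in h3.
have h4 : M ^+ 2 * (#|` F|)%:R <= e ^+ 2 * (#|` @box n N|)%:R.
  apply: (@le_trans _ _ ((M ^+ 2 + 1) * (#|` F|)%:R)).
    by apply: ler_wpM2r => //; rewrite lerDl.
  by rewrite mulrC -ler_pdivlMr//; move: shell; rewrite -/F [leRHS]mulrAC.
apply: le_trans (lerD (ler_wpM2l (sqr_ge0 _) h1) (ler_wpM2l (sqr_ge0 _) h2)) _.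
apply: le_trans (lerD (lexx _) h4) _; rewrite -mulrDl [leRHS]exprMn.
apply: ler_pM h3; rewrite ?addr_ge0 ?sqr_ge0//.
by have := sqr_ge0 e; rewrite !exprMn; lra.
Qed.

End WavePackets.

(** * Fredholm operators with symbols of order zero *)

Section Main.
Context {R : realType} {n : nat}.
Local Notation Z := ('rV[int]_n).
Local Notation H := (ell2 R Z).
Variables (sigma : Z -> 'rV[R]_n -> R[i]) (C : R).
Hypothesis sigma_tame : forall k, tame C (sigma k).
Hypothesis slow : oscillates_slowly sigma.

Let aC := kernel_dominated sigma_tame.
Let T_linear := (pdo_ell2_band sigma_tame).1.
Let T_band := (pdo_ell2_band sigma_tame).2.

Lemma pdo_ell2_bounded : exists M, forall u : H, ell2_norm (pdo_ell2 sigma u) <= M * ell2_norm u.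
Proof.
exists (C * tail R n 0 + C * decay_total R n) => u; rewrite mulrDl.
apply: le_trans (nm_le_add _ (band 0 (kernel sigma) u)) _.
by apply: lerD; [exact: T_band|exact: nm_band aC].
Qed.

Lemma far_bounded_below_fredholm (c R1 : R) : 0 < c ->
  (forall k, R1 <= euclid_norm k -> forall x, c <= normc (sigma k x)) ->
  fredholm [set: H] (pdo_ell2 sigma).
Proof.
move=> c0 far; have [M MP] := pdo_ell2_bounded.
have [K tK] := reciprocal_tame sigma_tame c0 far.
have [D Dfar] := @far_box R n R1.
have inv k : k \notin box D -> forall x, sigma k x * reciprocal sigma R1 k x = 1.
  by move=> kD x; apply: (reciprocalK c0 far); apply: Dfar.
have inv' k : k \notin box D -> forall x, reciprocal sigma R1 k x * sigma k x = 1.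
  by move=> kD x; rewrite mulrC inv.
have bC := kernel_dominated tK.
have [K1 [F lb]] := far_lower_bound aC bC T_band (kernel_slow sigma_tame slow)
  (kernel_inverse tK sigma_tame inv').
have [S [G rb]] := far_approximate_inverse aC bC T_band
  (kernel_slow tK (reciprocal_slow c0 far slow)) (kernel_inverse sigma_tame tK inv).
exact: (fredholm_of_parametrix T_linear MP lb rb).
Qed.

(** If the symbol had arbitrarily small values arbitrarily far away, wave packets
   located there would be almost null and could be chosen with disjoint
   supports. *)
Lemma fredholm_far_bounded_below : fredholm [set: H] (pdo_ell2 sigma) ->
  exists c R1 : R, [/\ 0 < c, 0 < R1 & forall x k, R1 <= euclid_norm k -> c <= normc (sigma k x)].
Proof.
move=> [_ [/approx_closedP cT fin _]]; apply: contrapT => nell.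
have [M MP] := pdo_ell2_bounded.
apply: (fredholm_no_far_packets T_linear MP cT) => [|e e0 A].
  rewrite (_ : [set u | _] = [set u : H | [set: H] u /\ pdo_ell2 sigma u = 0])//.
  by apply/seteqP; split=> u //= [].
have e5 : 0 < e / 5 by rewrite divr_gt0.
have [N [r rP]] := wave_packet_almost_null sigma_tame T_band slow e5.
have [B AB] := fset_in_box A.
have [k [x [kQ kx]]] : exists k x, k \notin box (maxn r (B + N)) /\ normc (sigma k x) <= e / 5.
  apply: contrapT => nk; apply: nell.
  exists (e / 5), ((n * maxn r (B + N))%:R + 1); split=> // x k kR.
  rewrite leNgt; apply/negP => /ltW kx; apply: nk; exists k, x; split=> //.
  apply/negP => /(@euclid_box R) /(le_trans kR); rewrite gerDl.
  by rewrite leNgt ltr01.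
have kr : k \notin box r by apply: contra kQ; exact/fsubsetP/box_le/leq_maxl.
have kB : k \notin box (B + N) by apply: contra kQ; exact/fsubsetP/box_le/leq_maxr.
exists (wave_packet N k x), [fset (k + j)%R | j in @box n N]%fset; split.
- apply/fdisjointP => l /(fsubsetP AB) lB; apply/negP => /imfsetP[j /= jN lk].
  by move/negP: (notin_boxD kB jN); rewrite -lk.
- by move=> l lG; rewrite sum_unit_vectorE (negPf lG).
- apply/eqP => w0; have := nm_wave_packet N k x; rewrite w0 nm0 expr0n/= card_box.
  by rewrite leNgt ltr0n expn_gt0.
by have := rP k x kr kx; rewrite [5 * _]mulrC divfK.
Qed.

End Main.

Lemma M_class_S_class (R : realType) (n : nat) (Lambda : 'rV[int]_n -> R) (rho m : R)
    (sigma : 'rV[int]_n -> 'rV[R]_n -> R[i]) :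
  M_class Lambda rho m sigma -> S_class Lambda rho m sigma.
Proof.
move=> [_ /(_ (fun=> false))]; congr S_class; apply/funext => k; apply/funext => x.
rewrite /kpow big1 ?mul1r => [|j _]; last by rewrite expr0.
by rewrite /Delta; elim: (enum 'I_n).
Qed.

Theorem theorem6p3 (R : realType) (n : nat)
    (mu0 mu1 mu : R) (Lambda : 'rV[int]_n -> R)
    (Lambda_weight : is_weight mu0 mu1 mu Lambda)
    (rho : R) (rho_gt0 : 0 < rho) (rho_le : rho <= 1 / mu)
    (sigma : 'rV[int]_n -> 'rV[R]_n -> R[i])
    (sigma_M0 : M_class Lambda rho 0 sigma) :
  fredholm [set: ell2 R 'rV[int]_n] (pdo_ell2 sigma) <-> M_elliptic Lambda 0 sigma.
Proof.
have sigmaS := M_class_S_class sigma_M0.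
have L0 : forall k, 0 < Lambda k by have [] := Lambda_weight.
have [C _ sigmaC] := S_class_tame sigmaS L0.
have slow := S_class_slow Lambda_weight rho_gt0 sigmaS.
split=> [/(fredholm_far_bounded_below sigmaC slow)|] [c [R1 [c0 R10 far]]].
  by exists c, R1; split=> // x k kR; rewrite powRr0 mulr1; apply: far.
apply: (far_bounded_below_fredholm sigmaC slow c0) => k kR x.
by have := far x k kR; rewrite powRr0 mulr1.
Qed.
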